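(* Let $N\ge 1$ be an integer, $B(z)=z^N$, $\omega=e^{2\pi i/N}$, and let $\theta$ be an inner function with $\dim K_\theta\ge N$. Then the following are equivalent: (i) $A^\theta_B$ has a reducing subspace such that the restriction of $A^\theta_B$ to it has one-dimensional defects; (ii) $\theta(z)=b(z)u(z^N)$ for some inner function $u$, where $b$ is either $1$ or a finite Blaschke product of the form $b(z)=\prod_{i=1}^{l}\psi_{\alpha_i,J_i}(z)$ with $l\le N-1$, $\alpha_i\in\mathbb D$, $J_i\subset\{0,\dots,N-1\}$, and moreover $$\sum_{i=1}^{l}\min\{|J_i|,\,N-|J_i|\}\le N-1.$$
   Context: $\mathbb D$ is the open unit disc, $\mathbb T$ the unit circle, $H^2$ the Hardy space of $\mathbb D$, viewed as a subspace of $L^2(\mathbb T)$. An inner function is a function in $H^2$ with boundary values of modulus 1 a.e. on $\mathbb T$ (unimodular constants are allowed). For $\theta$ inner, $K_\theta=H^2\ominus\theta H^2$. For $\theta,B$ inner, $A^\theta_B\in\mathcal L(K_\theta)$ is the truncated Toeplitz operator $A^\theta_B f=P_{K_\theta}(Bf)$, where $P_{K_\theta}$ is the orthogonal projection onto $K_\theta$. A closed subspace $M$ is reducing for an operator $T$ if $M$ and $M^\perp$ are both invariant under $T$ (it may be the whole space). For a contraction $R$, put $D_R=(I-R^*R)^{1/2}$ and let $\mathcal D_R$ be the closure of the range of $D_R$; $R$ has $d$-dimensional defects if $\dim\mathcal D_R=\dim\mathcal D_{R^*}=d$. For $\alpha\in\mathbb D$, $\phi_\alpha(z)=\dfrac{z-\alpha}{1-\bar\alpha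 z}$. For $\alpha\in\mathbb D$ and $J\subset\{0,\dots,N-1\}$, $\psi_{\alpha,J}(z)=\prod_{i\in J}\phi_{\omega^i\alpha}(z)$ (the empty product is 1); $|J|$ is the cardinality of $J$. *)

(* Defs.v *)
From HB Require Import structures.
From mathcomp Require Import all_boot all_order all_algebra.
From mathcomp Require Import complex.
From mathcomp Require Import ring.
From mathcomp Require Import all_classical all_reals all_analysis.

Set Implicit Arguments.
Unset Strict Implicit.
Unset Printing Implicit Defensive.

Import Order.TTheory GRing.Theory Num.Theory numFieldNormedType.Exports.

Local Open Scope classical_set_scope.
Local Open Scope ring_scope.
Local Open Scope quotient_scope.

Section DotNorm.
Variables (C : numClosedFieldType) (U : lmodType C).
Variable form : {dot U for (@Num.conj C)}.

Lemma dot_ge0 u : 0 <= form u u.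
Proof.
have [->|u0] := eqVneq u 0; first by rewrite linear0l.
exact/ltW/neq0_dnorm_gt0.
Qed.

Lemma dot_CauchySchwarz u v : `|form u v| ^+ 2 <= form u u * form v v.
Proof.
have [->|v0] := eqVneq v 0; first by rewrite linear0r linear0l normr0 expr0n /= mulr0.
have vv0 : 0 < form v v := neq0_dnorm_gt0 _ v0.
have fC : form v u = (form u v)^* by rewrite hermC expr0 mul1r.
have vvr : (form v v)^* = form v v by apply/CrealP; exact: gtr0_real.
set a := form u v / form v v; have := dot_ge0 (u - a *: v).
have av w : form (a *: v) w = a * form v w by rewrite linearZl_LR.
have va w : form w (a *: v) = a^* * form w v by rewrite linearZr_LR.
rewrite linearBl !linearBr /= !av !va fC /a rmorphM fmorphV /= vvr.
rewrite (_ : _ - _ = form u u - `|form u v| ^+ 2 / form v v).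
  by rewrite subr_ge0 ler_pdivrMr.
by rewrite normCK; field; rewrite gt_eqF.
Qed.

Lemma dot_triangle u v :
  sqrtC (form (u + v) (u + v)) <= sqrtC (form u u) + sqrtC (form v v).
Proof.
have s0 w : 0 <= sqrtC (form w w) by rewrite sqrtC_ge0.
rewrite -(@ler_sqr _ (sqrtC (form (u + v) _))) ?nnegrE ?addr_ge0//.
rewrite sqrrD !sqrtCK linearDl !linearDr /=.
have -> : form v u = (form u v)^* by rewrite hermC expr0 mul1r.
rewrite -addrA -[leRHS]addrA lerD2l [_ *+ 2 + _]addrC addrA [_ + form v v]addrC.
rewrite lerD2l.
have -> : form u v + (form u v)^* = 'Re (form u v) *+ 2.
  by rewrite ReE -mulr_natr divfK ?pnatr_eq0.
rewrite lerMn2r /=.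
have le1 : 'Re (form u v) <= `|form u v|.
  exact: (leif_Re_Creal _).1.
apply: le_trans le1 _.
rewrite -(@ler_sqr _ `|_|) ?nnegrE ?mulr_ge0// exprMn !sqrtCK.
exact: dot_CauchySchwarz.
Qed.
End DotNorm.

Section L2.
Variable R : realType.
Local Notation C := R[i].

Definition cis (t : R) : C := Complex (cos t) (sin t).

Lemma twopi_gt0 : 0 < 2 * pi :> R.
Proof. by rewrite mulr_gt0 ?pi_gt0. Qed.

(* The normalized arc length measure on the unit circle, carried to [0, 2 pi] by
   the parametrization cis. *)
Definition circle_measure : probability _ R := uniform_prob twopi_gt0.

(* A function on the unit circle is represented by a function on the complex
   plane, of which only the values on the circle are relevant. *)
Definition square_integrable : {pred C -> C} := fun f =>
  ((fun t => complex.Re (f (cis t))) \in Lfun circle_measure 2%:E) &&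
  ((fun t => complex.Im (f (cis t))) \in Lfun circle_measure 2%:E).

Let le12 : (1 <= 2%:E :> \bar R)%E. Proof. by rewrite lee_fin ler1n. Qed.
Let le11 : (1 <= 1 :> \bar R)%E. Proof. by []. Qed.

Lemma cReD (x y : C) : complex.Re (x + y) = complex.Re x + complex.Re y.
Proof. by case: x; case: y. Qed.
Lemma cImD (x y : C) : complex.Im (x + y) = complex.Im x + complex.Im y.
Proof. by case: x; case: y. Qed.
Lemma cReM (x y : C) : complex.Re (x * y) =
  complex.Re x * complex.Re y - complex.Im x * complex.Im y.
Proof. by case: x; case: y. Qed.
Lemma cImM (x y : C) : complex.Im (x * y) =
  complex.Re x * complex.Im y + complex.Im x * complex.Re y.
Proof. by case: x => a b; case: y. Qed.
Lemma cReJ (x : C) : complex.Re x^* = complex.Re x.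
Proof. by case: x. Qed.
Lemma cImJ (x : C) : complex.Im x^* = - complex.Im x.
Proof. by case: x. Qed.

Lemma square_integrable_submod_closed : submod_closed square_integrable.
Proof.
have L (a : R) f g : f \in Lfun circle_measure 2%:E -> g \in Lfun circle_measure 2%:E ->
    (fun t => a * f t + g t) \in Lfun circle_measure 2%:E.
  by move=> hf hg; exact: (Lfun_submod_closed circle_measure le12).2.
have L0 : (fun=> 0) \in Lfun circle_measure 2%:E := (Lfun_submod_closed circle_measure le12).1.
split; first by apply/andP; split; apply: L0.
move=> a f g /andP[fr fi] /andP[gr gi]; apply/andP; split.
  rewrite (_ : (fun t => _) = (fun t => complex.Re a * complex.Re (f (cis t)) +
     (- complex.Im a * complex.Im (f (cis t)) + complex.Re (g (cis t))))).
    by apply: (L) => //; apply: (L).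
  by apply/funext => t; rewrite cReD cReM addrA mulNr.
rewrite (_ : (fun t => _) = (fun t => complex.Re a * complex.Im (f (cis t)) +
     (complex.Im a * complex.Re (f (cis t)) + complex.Im (g (cis t))))).
  by apply: (L) => //; apply: (L).
by apply/funext => t; rewrite cImD cImM addrA.
Qed.

HB.instance Definition _ := GRing.isSubmodClosed.Build C (C -> C)
  square_integrable square_integrable_submod_closed.

Record L2fun := MkL2fun { L2fun_val :> C -> C; _ : L2fun_val \in square_integrable }.
HB.instance Definition _ := [isSub of L2fun for L2fun_val].
HB.instance Definition _ := [Choice of L2fun by <:].
HB.instance Definition _ := [SubChoice_isSubLmodule of L2fun by <:].

Lemma ae_circle_filter : Filter (almost_everywhere circle_measure).
Proof. exact: ae_filter_ringOfSetsType. Qed.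
#[global] Existing Instance ae_circle_filter.

Definition ae_null : {pred L2fun} :=
  fun f => `[< {ae circle_measure, forall t, f (cis t) = 0} >].

Lemma ae_null_submod_closed : submod_closed ae_null.
Proof.
split; first by apply/asboolP; apply: aeW.
move=> a f g /asboolP f0 /asboolP g0; apply/asboolP.
apply: filterS2 f0 g0 => t ft gt.
by change (a * f (cis t) + g (cis t) = 0); rewrite ft gt mulr0 addr0.
Qed.

HB.instance Definition _ := GRing.isSubmodClosed.Build C L2fun
  ae_null ae_null_submod_closed.

Definition L2 : Type := {ideal_quot ae_null}.
HB.instance Definition _ := GRing.Zmodule.on L2.
HB.instance Definition _ := EqQuotient.on L2.

Lemma L2P (f g : L2fun) :
  \pi_L2 f = \pi_L2 g <-> {ae circle_measure, forall t, f (cis t) = g (cis t)}.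
Proof.
split=> [/eqP|h].
  rewrite -Quotient.idealrBE => /asboolP; apply: filterS => t /= h.
  by apply/eqP; rewrite -subr_eq0; apply/eqP.
apply/eqP; rewrite -Quotient.idealrBE; apply/asboolP.
apply: filterS h => t h; apply/eqP.
by change (f (cis t) - g (cis t) == 0); rewrite subr_eq0 h.
Qed.

Lemma L2_piD (f g : L2fun) : \pi_L2 (f + g) = \pi_L2 f + \pi_L2 g.
Proof. exact: raddfD. Qed.

Definition L2_scale (a : C) (x : L2) : L2 := \pi_L2 (a *: repr x).

Lemma L2_piZ a (f : L2fun) : L2_scale a (\pi_L2 f) = \pi_L2 (a *: f).
Proof.
apply/L2P; have /L2P := reprK (\pi_L2 f).
by apply: filterS => t h; change (a * repr (\pi_L2 f) (cis t) = a * f (cis t)); rewrite h.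
Qed.

Lemma L2_scaleA a b x : L2_scale a (L2_scale b x) = L2_scale (a * b) x.
Proof. by elim/quotW: x => f; rewrite (L2_piZ b) (L2_piZ a) (L2_piZ (a * b)) scalerA. Qed.
Lemma L2_scale1 : left_id 1 L2_scale.
Proof. by elim/quotW=> f; rewrite L2_piZ scale1r. Qed.
Lemma L2_scaleDr : right_distributive L2_scale +%R.
Proof. by move=> a; elim/quotW=> f; elim/quotW=> g; rewrite -L2_piD (L2_piZ a f) (L2_piZ a g) (L2_piZ a (f + g)) scalerDr L2_piD. Qed.
Lemma L2_scaleDl x : {morph L2_scale^~ x : a b / a + b}.
Proof. by elim/quotW: x => f a b; rewrite (L2_piZ a) (L2_piZ b) (L2_piZ (a + b)) scalerDl L2_piD. Qed.

HB.instance Definition _ := GRing.Zmodule_isLmodule.Build C L2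
  L2_scaleA L2_scale1 L2_scaleDr L2_scaleDl.

Definition circle_integral (F : C -> C) : C :=
  Complex (\int[circle_measure]_t complex.Re (F (cis t))) (\int[circle_measure]_t complex.Im (F (cis t))).

Definition L2_dot (x y : L2) : C :=
  circle_integral (fun z => repr x z * (repr y z)^*).

Definition circle_integrable (F : C -> C) :=
  circle_measure.-integrable setT (EFin \o (fun t => complex.Re (F (cis t)))) /\
  circle_measure.-integrable setT (EFin \o (fun t => complex.Im (F (cis t)))).

Lemma circle_integrable_mul (f g : L2fun) : circle_integrable (fun z => f z * (g z)^*).
Proof.
have /andP[fr fi] := valP f; have /andP[gr gi] := valP g.
have L (u v : R -> R) a : u \in Lfun circle_measure 1 -> v \in Lfun circle_measure 1 ->
    (fun t => a * u t + v t) \in Lfun circle_measure 1.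
  by move=> hf hg; exact: (Lfun_submod_closed circle_measure le11).2.
split; apply/Lfun1_integrable => /=.
  rewrite (_ : (fun t => _) = fun t => 1 * (complex.Re (f (cis t)) * complex.Re (g (cis t)))
    + complex.Im (f (cis t)) * complex.Im (g (cis t))).
    by apply: L; exact: Lfun2_mul_Lfun1.
  by apply/funext => t; rewrite cReM cReJ cImJ mulrN opprK mul1r.
rewrite (_ : (fun t => _) = fun t => -1 * (complex.Re (f (cis t)) * complex.Im (g (cis t)))
    + complex.Im (f (cis t)) * complex.Re (g (cis t))).
  by apply: L; exact: Lfun2_mul_Lfun1.
by apply/funext => t; rewrite cImM cReJ cImJ mulrN mulN1r.
Qed.

Lemma circle_integral_linear a F G : circle_integrable F -> circle_integrable G ->
  circle_integral (fun z => a * F z + G z) = a * circle_integral F + circle_integral G.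
Proof.
move=> [Fr Fi] [Gr Gi].
have Z (r : R) u : circle_measure.-integrable setT (EFin \o u) ->
    circle_measure.-integrable setT (EFin \o (fun t => r * u t)).
  by move=> h; exact: (integrableZl measurableT r h).
have D u v : circle_measure.-integrable setT (EFin \o u) -> circle_measure.-integrable setT (EFin \o v) ->
    circle_measure.-integrable setT (EFin \o (fun t => u t + v t)).
  by move=> h k; exact: (integrableD measurableT h k).
rewrite /circle_integral; case: a => a b; apply/eqP; rewrite eq_complex /=.
apply/andP; split; apply/eqP.
  transitivity (\int[circle_measure]_t ((a * complex.Re (F (cis t)) +
      - b * complex.Im (F (cis t))) + complex.Re (G (cis t)))).
    by apply: eq_Rintegral => t _; rewrite cReD cReM mulNr.
  rewrite !RintegralD ?RintegralZl //; last 3 first.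
  - exact: Z.
  - exact: Z.
  - by apply: (D); exact: Z.
  by rewrite mulNr.
transitivity (\int[circle_measure]_t ((a * complex.Im (F (cis t)) +
      b * complex.Re (F (cis t))) + complex.Im (G (cis t)))).
  by apply: eq_Rintegral => t _; rewrite cImD cImM.
rewrite !RintegralD ?RintegralZl //; first exact: Z.
- exact: Z.
- by apply: (D); exact: Z.
Qed.

Lemma eq_ae_circle_integral F G : circle_integrable F -> circle_integrable G ->
  {ae circle_measure, forall t, F (cis t) = G (cis t)} -> circle_integral F = circle_integral G.
Proof.
move=> [Fr Fi] [Gr Gi] FG; rewrite /circle_integral /Rintegral.
congr (Complex (fine _) (fine _)); apply: ae_eq_integral => //.
- exact: measurable_int Fr.
- exact: measurable_int Gr.
- by apply: filterS FG => t /= ->.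
- exact: measurable_int Fi.
- exact: measurable_int Gi.
- by apply: filterS FG => t /= ->.
Qed.

Lemma L2_dotE (f g : L2fun) :
  L2_dot (\pi_L2 f) (\pi_L2 g) = circle_integral (fun z => f z * (g z)^*).
Proof.
apply: eq_ae_circle_integral; [exact: circle_integrable_mul|exact: circle_integrable_mul|].
have /L2P := reprK (\pi_L2 f); have /L2P := reprK (\pi_L2 g).
by apply: filterS2 => t -> ->.
Qed.

Lemma L2_dotC x y : L2_dot x y = (-1) ^+ false * (L2_dot y x)^*.
Proof.
elim/quotW: x => f; elim/quotW: y => g; rewrite expr0 mul1r !L2_dotE.
have [ir ii] := circle_integrable_mul g f.
apply/eqP; rewrite eq_complex /circle_integral /= ; apply/andP; split; apply/eqP.
  by apply: eq_Rintegral => t _; rewrite !cReM !cReJ !cImJ !mulrN mulrC [X in _ - - X = _]mulrC.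
rewrite -mulN1r -RintegralZl//.
by apply: eq_Rintegral => t _; rewrite !cImM !cReJ !cImJ mulN1r !mulrN opprD opprK
  mulrC [X in _ + X = _]mulrC addrC.
Qed.

Lemma L2_dotl y a x1 x2 : L2_dot (a *: x1 + x2) y = a * L2_dot x1 y + L2_dot x2 y.
Proof.
elim/quotW: x1 => f1; elim/quotW: x2 => f2; elim/quotW: y => g.
have -> : a *: \pi_L2 f1 = \pi_L2 (a *: f1) by exact: L2_piZ.
rewrite -L2_piD !L2_dotE -circle_integral_linear; [|exact: circle_integrable_mul|exact: circle_integrable_mul].
by congr circle_integral; apply/funext => z; rewrite mulrA -mulrDl.
Qed.

Lemma L2_dot_bilinear :
  bilinear_for ( *%R) (@Num.conj C \; *%R) L2_dot.
Proof.
split=> [y|x] a x1 x2 /=; first exact: L2_dotl.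
rewrite L2_dotC expr0 mul1r L2_dotl rmorphD rmorphM /=.
by rewrite -[L2_dot x x2]mul1r -[L2_dot x x1]mul1r (L2_dotC x x2) (L2_dotC x x1) !expr0 !mul1r.
Qed.

HB.instance Definition _ := bilinear_isBilinear.Build C L2 L2 C
  ( *%R : GRing.Scale.law C C) (@Num.conj C \; *%R : GRing.Scale.law C C) L2_dot L2_dot_bilinear.
HB.instance Definition _ := @isHermitianSesquilinear.Build C L2 false (@Num.conj C)
  L2_dot L2_dotC.

Lemma L2_dot_gt0 x : x != 0 -> 0 < L2_dot x x.
Proof.
elim/quotW: x => f nz; rewrite L2_dotE.
have [ir ii] := circle_integrable_mul f f.
have I0 : \int[circle_measure]_t complex.Im (f (cis t) * (f (cis t))^*) = 0.
  under eq_Rintegral do rewrite cImM cReJ cImJ mulrN mulrC addNr.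
  by rewrite Rintegral_cst ?mul0r.
rewrite /circle_integral /= I0 lt_def; apply/andP; split; last first.
  rewrite lecE /= eqxx /= Rintegral_ge0// => t _.
  by rewrite cReM cReJ cImJ mulrN opprK -!expr2 addr_ge0 ?sqr_ge0.
apply: contraNneq nz => -[/eqP h]; apply/eqP.
rewrite -(raddf0 (\pi_L2)); apply/L2P.
have ge0 t : 0 <= complex.Re (f (cis t) * (f (cis t))^*).
  by rewrite cReM cReJ cImJ mulrN opprK -!expr2 addr_ge0 ?sqr_ge0.
have : (\int[circle_measure]_t `|(complex.Re (f (cis t) * (f (cis t))^*))%:E| = 0)%E.
  under eq_integral do rewrite gee0_abs ?lee_fin ?ge0//.
  apply/eqP; rewrite -fine_eq0 ?integrable_fin_num//.
move/(ae_eq_integral_abs _ measurableT (measurable_int _ ir)).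
apply: filterS => t /= /(_ I) [].
rewrite cReM cReJ cImJ mulrN opprK -!expr2 => /eqP.
rewrite paddr_eq0 ?sqr_ge0// !sqrf_eq0 => /andP[/eqP fr /eqP fi].
by apply/eqP; rewrite eq_complex fr fi /= !eqxx.
Qed.

HB.instance Definition _ := isDotProduct.Build C L2 L2_dot L2_dot_gt0.

Definition L2_norm (x : L2) : C := sqrtC (L2_dot x x).

Lemma L2_normD x y : L2_norm (x + y) <= L2_norm x + L2_norm y.
Proof. exact: dot_triangle. Qed.

Lemma L2_normZ a x : L2_norm (a *: x) = `|a| * L2_norm x.
Proof.
rewrite /L2_norm linearZl_LR linearZr_LR /= mulrA -normCK sqrtCM ?nnegrE ?exprn_ge0//.
  by rewrite sqrCK.
by have [->|/L2_dot_gt0/ltW//] := eqVneq x 0; rewrite linear0l.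
Qed.

Lemma L2_norm0_eq0 x : L2_norm x = 0 -> x = 0.
Proof.
move/eqP; rewrite sqrtC_eq0 => h; apply/eqP; apply: contraTT h => /L2_dot_gt0.
by rewrite lt0r => /andP[].
Qed.

HB.instance Definition _ := Lmodule_isNormed.Build C L2 L2_normD L2_normZ L2_norm0_eq0.

Lemma L2_normE (x : L2) : `|x| = sqrtC (L2_dot x x).
Proof. by []. Qed.

End L2.

Section Operators.
Variable R : realType.
Local Notation C := R[i].
Local Notation H := (L2 R).
Local Notation "''[' x , y ]" := (L2_dot x y).

Definition closed_subspace (M : set H) : Prop :=
  [/\ M 0, (forall a x y, M x -> M y -> M (a *: x + y)) & closed M].

Definition orthogonal_in (K M : set H) : set H :=
  [set x | K x /\ forall y, M y -> '[x, y] = 0].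

Definition invariant_under (T : H -> H) (M : set H) : Prop :=
  forall x, M x -> M (T x).

Definition reducing (K : set H) (T : H -> H) (M : set H) : Prop :=
  [/\ closed_subspace M, M `<=` K, invariant_under T M
    & invariant_under T (orthogonal_in K M)].

Definition orthogonal_projection (K : set H) (f : H) : H :=
  xget 0 [set g | K g /\ forall h, K h -> '[f - g, h] = 0].

(* In the definitions below an operator on the closed subspace M is given by a
   map of the whole of L2, of which only the values on M are relevant. *)
Definition adjoint_on (M : set H) (T : H -> H) (x : H) : H :=
  xget 0 [set y | M y /\ forall z, M z -> '[T z, x] = '[z, y]].

Definition linear_on (M : set H) (T : H -> H) : Prop :=
  forall a x y, M x -> M y -> T (a *: x + y) = a *: T x + T y.

Definition bounded_on (M : set H) (T : H -> H) : Prop :=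
  exists c : C, forall x, M x -> `|T x| <= c * `|x|.

Definition positive_sqrt_on (M : set H) (T D : H -> H) : Prop :=
  [/\ invariant_under D M, linear_on M D, bounded_on M D,
      (forall x, M x -> 0 <= '[D x, x])
    & forall x, M x -> D (D x) = T x].

(* The square root of I - T^* T is unique on M when it exists, which is the case
   if T is a contraction of M. *)
Definition defect_operator (M : set H) (T : H -> H) : H -> H :=
  xget (fun=> 0) [set D | positive_sqrt_on M (fun x => x - adjoint_on M T (T x)) D].

Definition defect_space (M : set H) (T : H -> H) : set H :=
  closure (defect_operator M T @` M).

Definition linearly_independent (d : nat) (e : 'I_d -> H) : Prop :=
  forall c : 'I_d -> C, \sum_(i < d) c i *: e i = 0 -> forall i, c i = 0.

Definition has_dim (S : set H) (d : nat) : Prop :=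
  exists e : 'I_d -> H, [/\ forall i, S (e i), linearly_independent e
    & forall x, S x -> exists c : 'I_d -> C, x = \sum_(i < d) c i *: e i].

(* dim S >= d, where dim S may be infinite *)
Definition dim_at_least (S : set H) (d : nat) : Prop :=
  exists e : 'I_d -> H, (forall i, S (e i)) /\ linearly_independent e.

(* The second defect space is that of (I - T T^* )^(1/2), as T^** = T on M. *)
Definition has_defects (M : set H) (T : H -> H) (d : nat) : Prop :=
  has_dim (defect_space M T) d /\ has_dim (defect_space M (adjoint_on M T)) d.
End Operators.

Section InnerFunctions.
Variable R : realType.
Local Notation C := R[i].
Local Notation H := (L2 R).

(* the class of f, or 0 if f is not square integrable *)
Definition to_L2 (f : C -> C) : H := \pi_H (insubd 0 f).

Lemma to_L2E (f : C -> C) : f \in @square_integrable R ->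
  {ae circle_measure R, forall t, repr (to_L2 f) (cis t) = f (cis t)}.
Proof.
move=> f2; have /L2P := reprK (to_L2 f).
by apply: filterS => t ->; rewrite (insubdK _ f2).
Qed.

Definition fourier_coef (x : H) (n : int) : C :=
  circle_integral (fun z => repr x z * (z ^ n)^*).

Definition hardy : set H := [set x | forall n : int, n < 0 -> fourier_coef x n = 0].

(* Functions of the Hardy space are represented by their boundary values, so
   that only the values of theta on the unit circle are relevant. *)
Definition inner_function (theta : C -> C) : Prop :=
  [/\ theta \in @square_integrable R, hardy (to_L2 theta)
    & {ae circle_measure R, forall t, `|theta (cis t)| = 1}].

Definition mul_L2 (f : C -> C) (x : H) : H := to_L2 (fun z => f z * repr x z).

Definition model_space (theta : C -> C) : set H :=
  orthogonal_in hardy (mul_L2 theta @` hardy).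

Definition truncated_toeplitz (theta B : C -> C) (f : H) : H :=
  orthogonal_projection (model_space theta) (mul_L2 B f).

Definition blaschke_factor (alpha z : C) : C := (z - alpha) / (1 - alpha^* * z).

Definition omega (N : nat) : C := cis (2 * pi / N%:R).

Definition psi (N : nat) (alpha : C) (J : {set 'I_N}) (z : C) : C :=
  \prod_(i in J) blaschke_factor (omega N ^+ i * alpha) z.

End InnerFunctions.

(* Main.v *)
Require Import Defs.
From HB Require Import structures.
From mathcomp Require Import all_boot all_order all_algebra.
From mathcomp Require Import complex.
From mathcomp Require Import ring lra zify.
From mathcomp Require Import all_classical all_reals all_analysis measurable_realfun.

Import Order.TTheory GRing.Theory Num.Theory numFieldNormedType.Exports.

Local Open Scope classical_set_scope.
Local Open Scope ring_scope.
Local Open Scope quotient_scope.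

(** Let [T] be the compression of multiplication by [z^N] to the model space of
    [theta]. Both conditions of the theorem are equivalent to an identity
      [theta p = q u(z^N)]  almost everywhere on the circle
    with [u] inner and [p], [q] nonzero polynomials of degree less than [N].

    From a reducing subspace [M] to the identity ([reducing_factor]): on [M] the
    adjoint of [T] is the backward shift by [N] places. If [w] spans the range of
    [I - T T^*], the elements of [M] orthogonal to [w] keep their norm under the
    backward shift, so they have no coefficients of index below [N]. Hence the
    first [N] coefficients of every element of [M], and after shifting all its
    blocks of [N] consecutive coefficients, are multiples of those of [w]: the
    elements of [M] have the form [q(z) F(z^N)] with one polynomial [q]. If [v]
    spans the other defect, [z^N v = T v + theta p], so [theta p = q u(z^N)], and
    [|theta| = 1] makes [|u|] constant ([inner_factor]).

    From the identity to a reducing subspace ([lift_reducing], [lift_defects]):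
    the map [F |-> q(z) F(z^N)] is a multiple of an isometry, commutes with the
    backward shifts, and carries [u H^2] into [theta H^2], since
    [q u(z^N) r(z^N) = theta p r(z^N)]. So it carries the model space of [u] onto a
    reducing subspace for [T] on which [T] is a copy of the compression of
    multiplication by [z], whose defects are one-dimensional unless [u] is
    constant. If [u] is constant, [x |-> p x] maps the model space of [theta]
    injectively to polynomials of degree at most [N - 2], contrary to the
    assumption on its dimension ([dim_model_space_lt]).

    Between the identity and products of the [psi a J] ([psi_prod_quotient],
    [psi_factorization]): the product of the Blaschke factors over a whole orbit
    is [phi_b(z^N)] with [b = a^N]. So [psi a J] is a quotient of polynomials of
    degree [#|J|], or [phi_b(z^N)] times a quotient of polynomials of degree
    [N - #|J|]; choosing the shorter one for each factor gives the identity with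
    degrees bounded by the sum of the minima. Conversely, [|p| = |q|] on the
    circle, so the zeros of [p] and [q] are common or reflected, and they can be
    removed one orbit at a time: a zero of [q] in the disc is one of [theta], and
    zeros of [p] on an orbit must come from a factor [phi_b(z^N)] of [u(z^N)], the
    rest of whose zeros is left to [theta].

    As inner functions are known by boundary values only, their zeros are
    expressed by divisibility in the Hardy space, considered as a module over the
    polynomials ([hardy_bezout], [hardy_div_outer], [blaschke_divide]). What is
    used of [L2] is its completeness ([L2_complete]), hence orthogonal projections,
    the uniqueness of Fourier coefficients ([fourier_uniqueness]), and the
    invariance of arc length under [z |-> z^N] ([circle_integral_power]). *)

Module Import OrbitProducts.
Set Implicit Arguments.
Unset Strict Implicit.
Unset Printing Implicit Defensive.

(** * Arcs and the sign iteration *)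

Section FourierUniqueness.
Variable R : realType.
Local Notation C := R[i].
Local Notation mu := (circle_measure R).

(** The sets over which the integral of [g] vanishes form a Dynkin system
    containing the rays, hence contain all Borel sets. *)
Lemma ae_eq0_of_integral_rays (g : R -> R) :
    mu.-integrable setT (EFin \o g) -> (\int[mu]_t (g t)%:E = 0)%E ->
    (forall x, (\int[mu]_(t in `]-oo, x[%classic) (g t)%:E = 0)%E) ->
  {ae mu, forall t, g t = 0}.
Proof.
move=> ig g0 gx.
have P A : measurable A -> (\int[mu]_(t in A) (g t)%:E = 0)%E.
  move=> mA.
  apply: (@dynkin_induction _ (measurableTypeR R)
     [set A | exists x, A = `]-oo, x[%classic]
     (fun A => (\int[mu]_(t in A) (g t)%:E = 0)%E)) => //.
  - exact: measurable_realfun.RGenInftyO.measurableE.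
  - move=> _ _ [x ->] [y ->]; exists (Num.min x y).
    apply/seteqP; split => t /=; rewrite !in_itv/= lt_min.
      by move=> [-> ->].
    by move=> /andP.
  - by move=> _ [x ->].
  - move=> S mS S0.
    have := @integral_setU _ _ _ mu S (~` S) (EFin \o g) mS (measurableC mS).
    rewrite setUv => /(_ (measurable_int _ ig)).
    rewrite /= g0 S0 add0e => <- //.
    by apply/disj_setPS; rewrite setICr.
  - move=> F mF tF F0.
    have := @charge_semi_sigma_additive _ _ _ (induced_charge ig) F mF tF
      (bigcupT_measurable _ mF).
    move=> /cvg_lim => /(_ (@ereal_hausdorff R)) E; apply: (etrans (esym E)).
    rewrite (_ : (fun _ => _) = fun=> 0%E); first by rewrite lim_cst.
    by apply/funext => n; rewrite big1// => i _; exact: F0.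
  - suff: (@measurable_realfun.RGenInftyO.G R).-sigma.-measurable A by [].
    by rewrite -measurable_realfun.RGenInftyO.measurableE.
have := @integral_ae_eq _ _ _ mu setT measurableT (cst 0%E) (EFin \o g) ig.
move=> /(_ (measurable_cst _)) H.
have : ae_eq mu setT (EFin \o g) (cst 0%E).
  by apply: H => E _ mE; rewrite P// integral0.
by apply: filterS => t /= /(_ I) [].
Qed.

(** The Newton iteration for the sign: a polynomial map of [[-1, 1]] to itself
    whose iterates converge to the sign, so that trigonometric polynomials stay
    trigonometric, and bounded, along the iteration. *)
Definition sign_step (s : R) : R := s * (3 - s ^+ 2) / 2.

Lemma sign_step_bound s : `|s| <= 1 -> `|sign_step s| <= 1.
Proof.
rewrite /sign_step !ler_norml => /andP[h1 h2].
have hp : 0 <= (1 - s) ^+ 2 * (2 + s) by rewrite mulr_ge0 ?sqr_ge0//; lra.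
have hn : 0 <= (1 + s) ^+ 2 * (2 - s) by rewrite mulr_ge0 ?sqr_ge0//; lra.
apply/andP; split; rewrite -subr_ge0.
  rewrite (_ : _ - _ = (1 + s) ^+ 2 * (2 - s) / 2); last by field.
  by rewrite divr_ge0.
rewrite (_ : _ - _ = (1 - s) ^+ 2 * (2 + s) / 2); last by field.
by rewrite divr_ge0.
Qed.

Lemma iter_sign_bound s n : `|s| <= 1 -> `|iter n sign_step s| <= 1.
Proof. by move=> s1; elim: n => // n IH; rewrite iterS sign_step_bound. Qed.

(** One step multiplies the distance of [u] to 1 by [(1 - u) (2 + u) / 2], which
    is at most [1 - s / 2] once [u >= s]. *)
Lemma iter_sign_pos s n : 0 < s -> s <= 1 ->
  s <= iter n sign_step s <= 1 /\ 1 - iter n sign_step s <= (1 - s / 2) ^+ n.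
Proof.
move=> s0 s1; elim: n => [|n [/andP[h1 h2] h3]]; first by rewrite /= lexx s1 expr0; split => //; lra.
rewrite iterS; set u := iter n _ _ in h1 h2 h3 *.
have -> : sign_step u = 1 - (1 - u) * ((1 - u) * (2 + u) / 2).
  by rewrite /sign_step; field.
have h4 : 0 <= (1 - u) * (2 + u) / 2 <= 1 - s / 2 by apply/andP; split; nra.
case/andP: h4 => h4 h5.
split; last first.
  rewrite opprB addrC subrK exprSr ler_pM//.
  by rewrite subr_ge0.
by apply/andP; split; nra.
Qed.

Lemma sign_stepN s : sign_step (- s) = - sign_step s.
Proof. by rewrite /sign_step sqrrN !mulNr. Qed.

Lemma iter_signN s n : iter n sign_step (- s) = - iter n sign_step s.
Proof. by elim: n => //= n ->; rewrite sign_stepN. Qed.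

Lemma iter_sign_cvg s : `|s| <= 1 -> (iter n sign_step s @[n --> \oo] --> Num.sg s).
Proof.
have pos u : 0 < u -> u <= 1 -> (iter n sign_step u @[n --> \oo] --> (1 : R)).
  move=> u0 u1; apply: (@squeeze_cvgr _ _ _ _ (fun n => 1 - (1 - u / 2) ^+ n) (fun=> 1)).
  - apply: nearW => n; have [/andP[_ ->] h] := iter_sign_pos n u0 u1.
    by rewrite andbT; lra.
  - rewrite -[X in _ --> X]subr0; apply: cvgB; first exact: cvg_cst.
    by apply: cvg_expr; rewrite ger0_norm; lra.
  - exact: cvg_cst.
rewrite ler_norml => /andP[h1 h2].
have [s0|s0|->] := ltgtP s 0.
- rewrite ltr0_sg// -[s]opprK.
  under eq_fun do rewrite iter_signN.
  by apply: cvgN; apply: pos; lra.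
- by rewrite gtr0_sg//; apply: pos.
- rewrite sgr0 (_ : (fun n => _) = fun=> 0); first exact: cvg_cst.
  by apply/funext; elim => //= n ->; rewrite /sign_step !mul0r.
Qed.

End FourierUniqueness.

(** * Bounded multipliers *)

Section Multipliers.
Variable R : realType.
Local Notation C := R[i].
Local Notation mu := (circle_measure R).
Local Notation "x %:C" := (real_complex R x) : ring_scope.

Lemma cisD (s t : R) : cis (s + t) = cis s * cis t.
Proof.
by rewrite /cis cosD sinD [X in Complex _ X]addrC.
Qed.

Lemma cis0 : cis (0 : R) = 1.
Proof. by rewrite /cis cos0 sin0. Qed.

Lemma cisX (t : R) n : cis t ^+ n = cis (n%:R * t).
Proof.
elim: n => [|n IH]; first by rewrite mul0r cis0 expr0.
by rewrite exprSr IH -cisD -natr1 mulrDl mul1r.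
Qed.

Lemma conj_cis (t : R) : (cis t)^* = cis (- t).
Proof. by rewrite /cis cosN sinN. Qed.

Lemma cis_norm (t : R) : `|cis t| = 1.
Proof. by rewrite normc_def /= cos2Dsin2 sqrtr1. Qed.

Lemma cis_neq0 (t : R) : cis t != 0.
Proof. by rewrite -normr_eq0 cis_norm oner_eq0. Qed.

Lemma cis_unit (t : R) : cis t \is a GRing.unit.
Proof. by rewrite unitfE cis_neq0. Qed.

Lemma cisV (t : R) : (cis t)^-1 = (cis t)^*.
Proof. by rewrite invC_norm cis_norm expr1n invr1 mul1r. Qed.

Lemma conjX_cis (t : R) (n : int) : (cis t ^ n)^* = cis t ^ (- n).
Proof. by rewrite -exprz_inv cisV rmorphXz// unitfE cis_neq0. Qed.

Lemma Lfun2P (u : R -> R) : u \in Lfun mu 2%:E <->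
  measurable_fun setT u /\ mu.-integrable setT (EFin \o (fun x => u x ^+ 2)).
Proof.
split=> [h|[mf /integrableP[_ fi]]].
  by split; [move: h; rewrite inE => /andP[/[!inE]] | exact: Lfun2_integrable_sqr].
rewrite inE; apply/andP; split; rewrite inE//= /finite_norm.
rewrite unlock poweR_lty//; apply: le_lt_trans fi.
rewrite ge0_le_integral//.
- by move=> t _; rewrite poweR_ge0.
- apply/measurable_EFinP.
  apply/(@measurableT_comp _ _ _ _ _ _ (fun x : R => x `^ 2)%R) => //.
  exact/measurableT_comp.
- apply: measurableT_comp => //; apply/measurable_EFinP; exact: measurable_funX.
- by move=> t _/=; rewrite lee_fin normrX powR_mulrn.
Qed.

Lemma integrable_mul_ae_bounded (g h : R -> R) (K : R) :
  mu.-integrable setT (EFin \o g) -> measurable_fun setT h ->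
  {ae mu, forall t, `|h t| <= K} ->
  mu.-integrable setT (EFin \o (fun t => h t * g t)).
Proof.
move=> ig mh hK; have mg : measurable_fun setT g.
  by apply/measurable_EFinP; exact: measurable_int ig.
apply/integrableP; split; first by apply/measurable_EFinP; exact: measurable_funM.
have/integrableP[_] := integrableZl measurableT `|K| ig.
apply: le_lt_trans; apply: ae_ge0_le_integral => //.
- apply: measurableT_comp => //; apply/measurable_EFinP; exact: measurable_funM.
- apply: measurableT_comp => //; apply/measurable_EFinP.
  by apply: measurable_funM => //.
apply: filterS hK => t hK _ /=; rewrite lee_fin !normrM normr_id.
by apply: ler_wpM2r => //; apply: le_trans hK _; exact: ler_norm.
Qed.

(** Multiplication by such a function is a bounded operator of [L2]. *)
Definition multiplier (f : C -> C) : Prop :=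
  [/\ measurable_fun setT (fun t => complex.Re (f (cis t))),
      measurable_fun setT (fun t => complex.Im (f (cis t)))
    & exists K : R, {ae mu, forall t, `|f (cis t)| <= K%:C}].

Lemma normc_ge_Im (x : C) : `|complex.Im x|%:C <= `|x|.
Proof.
rewrite normc_def lecR -sqrtr_sqr ler_wsqrtr//.
by rewrite lerDr sqr_ge0.
Qed.

Lemma multiplier_ae_Re f : multiplier f ->
  exists K : R, {ae mu, forall t, `|complex.Re (f (cis t))| <= K /\ `|complex.Im (f (cis t))| <= K}.
Proof.
move=> [_ _ [K fK]]; exists K; apply: filterS fK => t fK.
split; rewrite -lecR; apply: le_trans fK; [exact: normc_ge_Re|exact: normc_ge_Im].
Qed.

Lemma circle_integrableM f F : multiplier f -> circle_integrable F ->
  circle_integrable (fun z => f z * F z).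
Proof.
move=> mf [Fr Fi]; have [K fK] := multiplier_ae_Re mf; have [mr mi _] := mf.
have rK : {ae mu, forall t, `|complex.Re (f (cis t))| <= K} by apply: filterS fK => t [].
have iK : {ae mu, forall t, `|complex.Im (f (cis t))| <= K} by apply: filterS fK => t [].
split.
  have I1 := integrable_mul_ae_bounded Fr mr rK.
  have I2 := integrable_mul_ae_bounded Fi mi iK.
  apply: eq_integrable (integrableB measurableT I1 I2) => // t _ /=.
  by rewrite cReM EFinB.
have I1 := integrable_mul_ae_bounded Fi mr rK.
have I2 := integrable_mul_ae_bounded Fr mi iK.
apply: eq_integrable (integrableD measurableT I1 I2) => // t _ /=.
by rewrite cImM EFinD.
Qed.

Lemma square_integrableP (f : C -> C) : f \in @square_integrable R <->
  [/\ measurable_fun setT (fun t => complex.Re (f (cis t))),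
      measurable_fun setT (fun t => complex.Im (f (cis t)))
    & mu.-integrable setT (EFin \o (fun t => complex.Re (f (cis t) * (f (cis t))^* )))].
Proof.
have E t : complex.Re (f (cis t) * (f (cis t))^*) =
    complex.Re (f (cis t)) ^+ 2 + complex.Im (f (cis t)) ^+ 2.
  by rewrite cReM cReJ cImJ mulrN opprK -!expr2.
split=> [/andP[/Lfun2P[mr ir] /Lfun2P[mi ii]]|[mr mi fi]].
  split => //; apply: eq_integrable (integrableD measurableT ir ii) => // t _ /=.
  by rewrite E EFinD.
apply/andP; split; apply/Lfun2P; split=> //; apply: le_integrable fi => //;
  try by apply/measurable_EFinP; exact: measurable_funX.
- move=> t _ /=; rewrite E lee_fin !ger0_norm ?addr_ge0 ?sqr_ge0//.
  by rewrite lerDl sqr_ge0.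
- move=> t _ /=; rewrite E lee_fin !ger0_norm ?addr_ge0 ?sqr_ge0//.
  by rewrite lerDr sqr_ge0.
Qed.

Lemma multiplier_cst c : multiplier (fun=> c).
Proof.
split; [exact: measurable_cst|exact: measurable_cst|].
exists (complex.Re `|c|); apply: aeW => t.
by rewrite normc_def.
Qed.

Lemma multiplierD f g : multiplier f -> multiplier g -> multiplier (fun z => f z + g z).
Proof.
move=> [fr fi [K fK]] [gr gi [L gL]]; split.
- by under eq_fun do rewrite cReD; exact: measurable_funD.
- by under eq_fun do rewrite cImD; exact: measurable_funD.
exists (K + L); apply: filterS2 fK gL => t fK gL.
by rewrite (le_trans (ler_normD _ _))// rmorphD lerD.
Qed.

Lemma multiplierM f g : multiplier f -> multiplier g -> multiplier (fun z => f z * g z).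
Proof.
move=> [fr fi [K fK]] [gr gi [L gL]]; split.
- by under eq_fun do rewrite cReM; apply: measurable_funB; exact: measurable_funM.
- by under eq_fun do rewrite cImM; apply: measurable_funD; exact: measurable_funM.
exists (K * L); apply: filterS2 fK gL => t fK gL.
by rewrite normrM rmorphM ler_pM.
Qed.

Lemma multiplier_conj f : multiplier f -> multiplier (fun z => (f z)^* ).
Proof.
move=> [fr fi [K fK]]; split.
- by under eq_fun do rewrite cReJ.
- by under eq_fun do rewrite cImJ; exact: measurableT_comp.
by exists K; apply: filterS fK => t; rewrite norm_conjC.
Qed.

Lemma multiplier_id : multiplier id.
Proof.
split; [| |by exists 1; apply: aeW => t /=; rewrite cis_norm].
- exact: measurable_realfun.continuous_measurable_fun (@continuous_cos R).
- exact: measurable_realfun.continuous_measurable_fun (@continuous_sin R).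
Qed.

Lemma multiplierX f n : multiplier f -> multiplier (fun z => f z ^+ n).
Proof.
move=> mf; elim: n => [|n IH]; first exact: multiplier_cst.
by under eq_fun do rewrite exprS; exact: multiplierM.
Qed.

Lemma multiplier_circle f g : (forall t, f (cis t) = g (cis t)) -> multiplier f -> multiplier g.
Proof.
by move=> fg [fr fi [K fK]]; split; [under eq_fun do rewrite -fg..|exists K; apply: filterS fK => t; rewrite fg].
Qed.

Lemma multiplier_exprz (n : int) : multiplier (fun z => z ^ n).
Proof.
case: n => n; first exact/multiplierX/multiplier_id.
apply: (@multiplier_circle (fun z => (z^* ) ^+ n.+1)).
  by move=> t; rewrite NegzE -exprz_inv cisV.
exact/multiplierX/multiplier_conj/multiplier_id.
Qed.

Lemma square_integrableM f g : multiplier f -> g \in @square_integrable R ->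
  (fun z => f z * g z) \in @square_integrable R.
Proof.
move=> mf /square_integrableP[gr gi ig]; have [fr fi [K fK]] := mf.
apply/square_integrableP; split.
- by under eq_fun do rewrite cReM; apply: measurable_funB; exact: measurable_funM.
- by under eq_fun do rewrite cImM; apply: measurable_funD; exact: measurable_funM.
have E (z : C) : z * z^* = (complex.Re (z * z^* ))%:C.
  by case: z => a b; apply/eqP; rewrite eq_complex /= eqxx /=; apply/eqP; ring.
rewrite (_ : _ \o _ = EFin \o (fun t => complex.Re (f (cis t) * (f (cis t))^* ) *
    complex.Re (g (cis t) * (g (cis t))^* ))); last first.
  apply/funext => t /=; congr EFin.
  rewrite [in LHS]rmorphM mulrACA [f _ * _]E [g _ * _]E -rmorphM; done.
have mff := multiplierM mf (multiplier_conj mf).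
have [K' fK'] := multiplier_ae_Re mff; have [mr mi _] := mff.
by apply: integrable_mul_ae_bounded => //; apply: filterS fK' => t [/= h _]; exact: h.
Qed.

End Multipliers.

(** * Uniqueness of Fourier coefficients *)

Section FourierUniqueness2.
Variable R : realType.
Local Notation C := R[i].
Local Notation mu := (circle_measure R).
Local Notation "x %:C" := (real_complex R x) : ring_scope.

Definition trigonometric (f : R -> R) : Prop := exists s : seq (C * int),
  forall t, (f t)%:C = \sum_(i <- s) i.1 * cis t ^ i.2.

Lemma trigonometric_cst a : trigonometric (fun=> a).
Proof. by exists [:: (a%:C, 0%:Z)] => t; rewrite big_seq1 expr0z mulr1. Qed.

Lemma trigonometricD f g : trigonometric f -> trigonometric g ->
  trigonometric (fun t => f t + g t).
Proof.
move=> [s sf] [r rg]; exists (s ++ r) => t.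
by rewrite big_cat /= -sf -rg rmorphD.
Qed.

Lemma trigonometricM f g : trigonometric f -> trigonometric g ->
  trigonometric (fun t => f t * g t).
Proof.
move=> [s sf] [r rg]; exists [seq (i.1 * j.1, i.2 + j.2) | i <- s, j <- r] => t.
rewrite rmorphM /= sf rg big_distrl /= big_allpairs_dep /=; apply: eq_bigr => i _.
rewrite big_distrr /=; apply: eq_bigr => j _ /=.
by rewrite exprzDr ?cis_unit// mulrACA.
Qed.

Lemma trigonometric_cos : trigonometric (@cos R).
Proof.
exists [:: (1 / 2, 1%:Z); (1 / 2, - 1%:Z)] => t.
rewrite big_cons big_seq1 /= -conjX_cis expr1z -mulrDr.
apply/eqP; rewrite eq_complex /=.
rewrite !(mul0r, oppr0, mulr0, expr0n, addr0, add0r, subr0, mul1r, subrr, eqxx, andbT)/=.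
by apply/eqP; field.
Qed.

Lemma trigonometric_sin : trigonometric (@sin R).
Proof.
exists [:: (Complex 0 (- 1 / 2), 1%:Z); (Complex 0 (1 / 2), - 1%:Z)] => t.
rewrite big_cons big_seq1 /= -conjX_cis expr1z.
by apply/eqP; rewrite eq_complex /=; apply/andP; split; apply/eqP; field.
Qed.

Lemma trigonometric_iter_sign f n : trigonometric f ->
  trigonometric (fun t => iter n (@sign_step R) (f t)).
Proof.
move=> tf; elim: n => // n IH.
rewrite (_ : (fun t => _) = (fun t => iter n (@sign_step R) (f t) *
  ((3 + (-1) * (iter n (@sign_step R) (f t) * iter n (@sign_step R) (f t))) * 2^-1))).
  do 2 apply: trigonometricM => //; last exact: trigonometric_cst.
  by do ?[apply: trigonometricD|apply: trigonometricM|exact: trigonometric_cst|exact: IH].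
by apply/funext => t; rewrite iterS /sign_step expr2 mulN1r -mulrA.
Qed.

Lemma circle_integral_eq (F G : C -> C) : (forall t, F (cis t) = G (cis t)) ->
  circle_integral F = circle_integral G.
Proof. by move=> FG; congr Complex; apply: eq_Rintegral => t _; rewrite FG. Qed.

Lemma circle_integrable_eq (F G : C -> C) : (forall t, F (cis t) = G (cis t)) ->
  circle_integrable F -> circle_integrable G.
Proof.
by move=> FG [Fr Fi]; split; [apply: eq_integrable Fr|apply: eq_integrable Fi] => // t _ /=; rewrite FG.
Qed.

Lemma circle_integral0 : circle_integral (fun=> 0 : C) = 0.
Proof. by rewrite /circle_integral /= Rintegral_cst// mul0r. Qed.

Lemma circle_integrable0 : circle_integrable (fun=> 0 : C).
Proof. by split; exact: integrable0. Qed.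

Lemma circle_integral_sum (I : Type) (s : seq I) (F : I -> C -> C) (c : I -> C) :
  (forall i, circle_integrable (F i)) ->
  circle_integrable (fun z => \sum_(i <- s) c i * F i z) /\
  circle_integral (fun z => \sum_(i <- s) c i * F i z) = \sum_(i <- s) c i * circle_integral (F i).
Proof.
move=> iF; elim: s => [|i s [IH1 IH2]].
  rewrite big_nil; split.
    by apply: circle_integrable_eq circle_integrable0 => t; rewrite big_nil.
  apply: etrans (circle_integral0); apply: circle_integral_eq => t; exact: big_nil.
split.
  apply: (@circle_integrable_eq (fun z => c i * F i z + \sum_(i <- s) c i * F i z)).
    by move=> t; rewrite big_cons.
  have [h1 h2] := circle_integrableM (multiplier_cst (c i)) (iF i).
  case: IH1 => h3 h4; split.
    by apply: eq_integrable (integrableD measurableT h1 h3) => // t _; rewrite /= cReD.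
  by apply: eq_integrable (integrableD measurableT h2 h4) => // t _; rewrite /= cImD.
rewrite big_cons -IH2 -circle_integral_linear//.
by apply: circle_integral_eq => t; rewrite big_cons.
Qed.

Lemma integral_trigonometric (F : C -> C) (f : R -> R) : circle_integrable F ->
  (forall n : int, circle_integral (fun z => F z * z ^ n) = 0) -> trigonometric f ->
  \int[mu]_t (f t * complex.Re (F (cis t))) = 0 /\
  \int[mu]_t (f t * complex.Im (F (cis t))) = 0.
Proof.
move=> iF F0 [s sf].
have iFn (i : C * int) : circle_integrable (fun z => F z * z ^ i.2).
  apply: circle_integrable_eq (circle_integrableM (multiplier_exprz R i.2) iF) => t.
  by rewrite mulrC.
have [_] := @circle_integral_sum _ s (fun i z => F z * z ^ i.2) (fun i => i.1) iFn.
rewrite [X in _ = X]big1 => [|i _]; last by rewrite F0 mulr0.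
have E t : \sum_(i <- s) i.1 * (F (cis t) * cis t ^ i.2) = (f t)%:C * F (cis t).
  by rewrite sf big_distrl /=; apply: eq_bigr => i _; rewrite mulrCA mulrC.
rewrite /circle_integral => -[h1 h2]; split.
  rewrite -[RHS]h1; apply: eq_Rintegral => t _; rewrite E.
  by rewrite cReM /= mul0r subr0.
rewrite -[RHS]h2; apply: eq_Rintegral => t _; rewrite E.
by rewrite cImM /= mul0r addr0.
Qed.

Lemma circle_measure_itv : {ae mu, forall t, 0 < t < 2 * pi}.
Proof.
pose p : R := 2 * pi.
have m0 : mu (~` `]0, p[%classic) = 0%E.
  apply: (etrans (integral_uniform_pdf 0 (2 * pi) (~` `]0, p[%classic))).
  rewrite (_ : _ `&` _ = [set 0] `|` [set p]); last first.
    apply/seteqP; split => t /=; rewrite !in_itv/=.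
      move=> [/negP h /andP[t0 tp]]; move: h; rewrite !lt_neqAle t0 tp !andbT.
      by rewrite negb_and !negbK => /orP[/eqP <-|/eqP]; [left|right].
    have p0 : 0 < p := twopi_gt0 R.
    by move=> [->|->]; rewrite !ltxx ?lexx ?(ltW p0) ?andbF.
  apply: null_set_integral => //.
  - exact: measurableU.
  - by apply: measurable_funTS; apply/measurable_EFinP; exact: measurable_uniform_pdf.
  - by rewrite null_set_setU//; exact: lebesgue_measure_set1.
exists (~` `]0, p[%classic); split; [exact: measurableC|exact: m0|].
by move=> t /= h h2; apply: h; move: h2; rewrite /= in_itv.
Qed.

Lemma circle_measure_neq (x : R) : {ae mu, forall t, t != x}.
Proof.
exists [set x]; split => //; last by move=> t /= /negP; rewrite negbK => /eqP.
have /null_content_dominatesP := dominates_uniform_prob (twopi_gt0 R).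
by apply => //; exact: lebesgue_measure_set1.
Qed.

(** By the product formula it is [(cos (t - x / 2) - cos (x / 2)) / 2]. Between 0
    and [2 pi] it changes sign only at [x], from positive to negative, so that the
    sign iteration started there yields the arc from 0 to [x]. *)
Lemma trigonometric_arc (x : R) : trigonometric (fun t => sin (t / 2) * sin ((x - t) / 2)).
Proof.
rewrite (_ : (fun t => _) = (fun t => 2^-1 * (cos (x / 2) * cos t + (sin (x / 2) * sin t +
  (- cos (x / 2)))))).
  by do ?[apply: trigonometricD|apply: trigonometricM|exact: trigonometric_cst|
    exact: trigonometric_cos|exact: trigonometric_sin].
apply/funext => t; have -> : (x - t) / 2 = x / 2 - t / 2 by field.
have -> : cos t = cos (t / 2 + t / 2) by congr cos; field.
have -> : sin t = sin (t / 2 + t / 2) by congr sin; field.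
rewrite sinB cosD sinD.
have := cos2Dsin2 (t / 2); set c := cos (t / 2); set s := sin (t / 2) => h.
rewrite [X in _ = 2^-1 * (_ + (_ + - X))](_ : _ = cos (x / 2) * (c ^+ 2 + s ^+ 2)).
  by field.
by rewrite h mulr1.
Qed.

(** The indicator of the arc from 0 to [x] is [(1 + sign s) / 2], where [s] is the
    trigonometric polynomial of [trigonometric_arc]; the iterates of [sign_step]
    on [s] are bounded by 1, so dominated convergence applies. *)
Lemma integral_ray_eq0 (g : R -> R) : mu.-integrable setT (EFin \o g) ->
  (forall f, trigonometric f -> \int[mu]_t (f t * g t) = 0) ->
  forall x, (\int[mu]_(t in `]-oo, x[%classic) (g t)%:E = 0)%E.
Proof.
move=> ig g0 x.
have mg : measurable_fun setT g by apply/measurable_EFinP; exact: measurable_int ig.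
have g0E f : trigonometric f -> mu.-integrable setT (EFin \o (fun t => f t * g t)) ->
    (\int[mu]_t (f t * g t)%:E = 0)%E.
  move=> tf ifg; have /eqP := g0 _ tf; rewrite /Rintegral fine_eq0 => [/eqP //|].
  exact: integrable_fin_num.
have g00 : (\int[mu]_t (g t)%:E = 0)%E.
  rewrite -[RHS](g0E _ (trigonometric_cst 1)).
    by apply: eq_integral => t _; rewrite mul1r.
  by apply: eq_integrable ig => // t _ /=; rewrite mul1r.
rewrite integral_mkcond.
have mgx : measurable_fun setT ((fun t => (g t)%:E) \_ `]-oo, x[%classic).
  by apply/(measurable_restrictT _ _).1 => //; apply: measurable_funTS; exact: measurable_int ig.
have [x0|x0] := leP x 0.
  rewrite -[RHS](@integral0 _ _ _ mu setT); apply: ae_eq_integral => //.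
  apply: filterS circle_measure_itv => t /andP[t0 _] _.
  rewrite patchE /= ifF//; apply/negbTE/negP; rewrite inE /= in_itv /= => tx.
  by have := lt_trans tx (le_lt_trans x0 t0); rewrite ltxx.
have [xp|xp] := leP (2 * pi) x.
  rewrite -[RHS]g00; apply: ae_eq_integral => //; first exact: measurable_int ig.
  apply: filterS circle_measure_itv => t /andP[_ t1] _.
  rewrite patchE /= ifT// inE /= in_itv /=; exact: lt_le_trans xp.
pose s t := sin (t / 2) * sin ((x - t) / 2).
have sb t : `|s t| <= 1 by rewrite normrM mulr_ile1 ?sin_max.
have ms : measurable_fun setT s.
  have mh a b : measurable_fun setT (fun t : R => sin ((a + b * t) / 2)).
    apply: measurable_realfun.continuous_measurable_fun => t.
    apply: (@continuous_comp _ _ _ (fun t => (a + b * t) / 2) (@sin R)); last exact: continuous_sin.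
    apply: cvgM; last exact: cvg_cst.
    by apply: cvgD; [exact: cvg_cst|apply: cvgM; [exact: cvg_cst|exact: cvg_id]].
  apply: measurable_funM.
    by have := mh 0 1; under eq_fun do rewrite add0r mul1r.
  by have := mh x (-1); under eq_fun do rewrite mulN1r.
have mits n : measurable_fun setT (fun t => iter n (@sign_step R) (s t)).
  elim: n => //= n IH; apply: measurable_funM; last exact: measurable_cst.
  apply: measurable_funM => //; apply: measurable_funB => //; exact: measurable_funX.
pose G t := Num.sg (s t) * g t.
have cvgG t : (iter n (@sign_step R) (s t) * g t)%:E @[n --> \oo] --> (G t)%:E.
  apply: cvg_EFin; first by apply: nearW.
  by apply: cvgM; [exact: iter_sign_cvg|exact: cvg_cst].
have mG : measurable_fun setT (EFin \o G).
  apply: (emeasurable_fun_cvg (fun n t => (iter n (@sign_step R) (s t) * g t)%:E)).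
    by move=> n; apply/measurable_EFinP; exact: measurable_funM.
  by move=> t _; exact: cvgG.
have mitg n : measurable_fun setT (fun t => (iter n (@sign_step R) (s t) * g t)%:E).
  by apply/measurable_EFinP; exact: measurable_funM.
have [iG _ lim] : [/\ mu.-integrable setT (EFin \o G),
    [sequence \int[mu]_t `|(iter n (@sign_step R) (s t) * g t)%:E - (G t)%:E|]_n @ \oo --> 0
  & [sequence \int[mu]_t (iter n (@sign_step R) (s t) * g t)%:E]_n @ \oo -->
      \int[mu]_t (G t)%:E]%E.
  apply: (@dominated_convergence _ _ _ mu setT measurableT
    (fun n t => (iter n (@sign_step R) (s t) * g t)%:E) (EFin \o G) (fun t => `|g t|%:E)) => //.
  - by apply: aeW => t _; exact: cvgG.
  - exact: integrable_abse ig.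
  - by apply: aeW => t n _; rewrite lee_fin normrM ler_piMl// iter_sign_bound.
have IG : (\int[mu]_t (G t)%:E = 0)%E.
  move/cvg_lim : lim => /(_ (@ereal_hausdorff R)) E; apply: etrans (esym E) _.
  rewrite (_ : (fun _ => _) = fun=> 0%E); first by rewrite lim_cst.
  apply/funext => n; apply: g0E; first exact/trigonometric_iter_sign/trigonometric_arc.
  apply: (integrable_mul_ae_bounded (K := 1) ig (mits n)).
  by apply: aeW => t; exact: iter_sign_bound.
have igG := integrableZl measurableT 2^-1 (integrableD measurableT ig iG).
transitivity (\int[mu]_t (2^-1%:E * ((g t)%:E + (G t)%:E)))%E; last first.
  rewrite (integralZl measurableT (integrableD measurableT ig iG)).
  by rewrite (integralD measurableT ig iG) g00 IG adde0 mule0.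
apply: ae_eq_integral => //; first exact: measurable_int igG.
apply: filterS2 circle_measure_itv (circle_measure_neq x) => t /andP[t0 t1] tx _.
have st : 0 < sin (t / 2) by apply: sin_gt0_pi; apply/andP; split; lra.
rewrite patchE /G /s sgrM (gtr0_sg st) mul1r; case: ifPn; rewrite ?notin_setE ?inE /= in_itv /=.
  move=> tx'; rewrite gtr0_sg ?mul1r -?EFinD -?EFinM; first by congr EFin; field.
  by apply: sin_gt0_pi; apply/andP; split; lra.
move/negP; rewrite -leNgt => xt; have {tx}xt : x < t by rewrite lt_neqAle eq_sym tx.
rewrite ltr0_sg ?mulN1r -?EFinD -?EFinM ?subrr ?mulr0//.
rewrite -[(x - t) / 2]opprK sinN oppr_lt0; apply: sin_gt0_pi; apply/andP; split; lra.
Qed.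

(** An integrable function on the circle all of whose Fourier coefficients
    vanish is zero: bounded limits of trigonometric polynomials, obtained by
    iterating the sign step, include the indicators of the arcs. *)
Lemma fourier_uniqueness (F : C -> C) : circle_integrable F ->
  (forall n : int, circle_integral (fun z => F z * z ^ n) = 0) ->
  {ae mu, forall t, F (cis t) = 0}.
Proof.
move=> iF F0; have [ir ii] := iF.
have H g : mu.-integrable setT (EFin \o g) ->
    (forall f, trigonometric f -> \int[mu]_t (f t * g t) = 0) -> {ae mu, forall t, g t = 0}.
  move=> ig g0; apply: ae_eq0_of_integral_rays => //; last exact: integral_ray_eq0.
  have /eqP := g0 _ (trigonometric_cst 1); rewrite /Rintegral.
  rewrite (_ : (\int[mu]_t (1 * g t)%:E = \int[mu]_t (g t)%:E)%E); last first.
    by apply: eq_integral => t _; rewrite mul1r.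
  by rewrite fine_eq0 => [/eqP //|]; exact: integrable_fin_num.
have := H _ ir (fun f tf => (integral_trigonometric iF F0 tf).1).
have := H _ ii (fun f tf => (integral_trigonometric iF F0 tf).2).
by apply: filterS2 => t i0 r0; apply/eqP; rewrite eq_complex i0 r0 !eqxx.
Qed.
End FourierUniqueness2.

(** * Completeness of the space of square integrable functions *)

Section Completeness.
Variable R : realType.
Local Notation C := R[i].
Local Notation H := (L2 R).
Local Notation mu := (circle_measure R).
Local Notation "x %:C" := (real_complex R x) : ring_scope.

Lemma limn_einf_le (u : (\bar R)^nat) c : (forall n, u n <= c)%E -> (limn_einf u <= c)%E.
Proof.
move=> uc; rewrite limn_einf_lim; apply: lime_le; first exact: is_cvg_einfs.
apply: nearW => n; apply: le_trans (uc n); apply: ereal_inf_lbound.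
by exists n => /=.
Qed.

(** The weighted inequality [d <= e / 2 + d^2 / (2 e)] with [e = 2^-n] turns the
    bound on squares into one on the first moments; these are summable, so the
    increments are summable almost everywhere. *)
Lemma ae_cvg_of_square_geometric (u : nat -> R -> R) :
  (forall n, measurable_fun setT (u n)) ->
  (forall n, (\int[mu]_t ((u n.+1 t - u n t) ^+ 2)%:E <= (2^-1 ^+ n.*2)%:E)%E) ->
  {ae mu, forall t, cvgn (u ^~ t)}.
Proof.
move=> um ub; pose d n t := `|u n.+1 t - u n t|.
have md n : measurable_fun setT (d n) by apply: measurableT_comp => //; exact: measurable_funB.
have md2 n : measurable_fun setT (fun t => (u n.+1 t - u n t) ^+ 2).
  by apply: measurable_funX; exact: measurable_funB.
have dle n : (\int[mu]_t (d n t)%:E <= (2^-1 ^+ n)%:E)%E.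
  pose e : R := 2^-1 ^+ n; have e0 : 0 < e by rewrite exprn_gt0// invr_gt0.
  have : (\int[mu]_t (d n t)%:E <= \int[mu]_t ((e / 2)%:E + (2^-1 / e)%:E * ((u n.+1 t - u n t) ^+ 2)%:E))%E.
    apply: ge0_le_integral => //.
    - by move=> t _; rewrite lee_fin normr_ge0.
    - by apply/measurable_EFinP; exact: md.
    - by apply: emeasurable_funD => //; apply: measurable_funeM; apply/measurable_EFinP; exact: md2.
    move=> t _; rewrite -EFinM -EFinD lee_fin -(real_normK (num_real (u n.+1 t - u n t))) -/(d n t).
    rewrite -subr_ge0 (_ : _ - _ = (2^-1 / e) * (d n t - e) ^+ 2); last first.
      by field; rewrite gt_eqF.
    by rewrite mulr_ge0 ?sqr_ge0// divr_ge0// ltW.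
  move/le_trans; apply.
  have m2 : measurable_fun setT (fun t => ((u n.+1 t - u n t) ^+ 2)%:E).
    by apply/measurable_EFinP; exact: md2.
  have e2 : 0 <= 2^-1 / e by rewrite divr_ge0// ltW.
  have n2 t : (0 <= ((u n.+1 t - u n t) ^+ 2)%:E)%E by rewrite lee_fin sqr_ge0.
  rewrite ge0_integralD//; last 3 first.
  - by move=> t _; rewrite lee_fin divr_ge0// ltW.
  - by move=> t _; rewrite mule_ge0.
  - exact: measurable_funeM.
  have -> : (\int[mu]__ (e / 2)%:E = (e / 2)%:E)%E.
    rewrite integral_cst// -[RHS]mule1; congr (_ * _)%E; exact: probability_setT.
  rewrite ge0_integralZl//.
  apply: (@le_trans _ _ ((e / 2)%:E + (2^-1 / e)%:E * (2^-1 ^+ n.*2)%:E)%E).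
    by rewrite leeD2l// lee_pmul2l// ?lte_fin ?divr_gt0 ?invr_gt0.
  rewrite -EFinM -EFinD lee_fin -muln2 exprM -/e.
  by rewrite le_eqVlt; apply/orP; left; apply/eqP; field; rewrite gt_eqF.
have sumd : (\int[mu]_t (\sum_(n <oo) (d n t)%:E) < +oo)%E.
  rewrite integral_nneseries//; last first.
  - by move=> n t _; rewrite lee_fin normr_ge0.
  - by move=> n; apply/measurable_EFinP; exact: md.
  apply: (@le_lt_trans _ _ 2%:E); last exact: ltry.
  apply: lime_le.
    by apply: is_cvg_nneseries => n _ _; apply: integral_ge0 => t _; rewrite lee_fin normr_ge0.
  apply: nearW => n; apply: (@le_trans _ _ (2 - 2 * 2^-1 ^+ n)%:E); last first.
    by rewrite lee_fin gerBl// mulr_ge0// exprn_ge0// invr_ge0.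
  elim: n => [|n IH]; first by rewrite big_geq// expr0 mulr1 subrr.
  rewrite big_nat_recr//=; apply: le_trans (leeD IH (dle n)) _.
  by rewrite -EFinD lee_fin exprSr le_eqVlt; apply/orP; left; apply/eqP; field.
have isum : mu.-integrable setT (fun t => \sum_(n <oo) (d n t)%:E)%E.
  apply/integrableP; split.
    apply: ge0_emeasurable_sum => [k t _ _|k _]; first by rewrite lee_fin normr_ge0.
    by apply/measurable_EFinP; exact: md.
  under eq_integral => t _.
    rewrite gee0_abs; last by apply: nneseries_ge0 => k _ _; rewrite lee_fin normr_ge0.
    over.
  exact: sumd.
have := integrable_ae measurableT isum; apply: filterS => t /(_ I) fint.
have : cvgn (series (fun n => u n.+1 t - u n t)).
  apply: normed_cvg.
  have : cvgn (fun n => (\sum_(0 <= k < n) d k t)%:E).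
    apply: ereal_nondecreasing_is_cvgn => m n mn; rewrite lee_fin.
    rewrite (big_cat_nat _ mn)//= lerDl sumr_ge0// => i _; exact: normr_ge0.
  have -> : (fun n => (\sum_(0 <= k < n) d k t)%:E) = (fun n => \sum_(0 <= k < n) (d k t)%:E)%E.
    by apply/funext => n; rewrite sumEFin.
  move=> cv; have : (\sum_(0 <= k < n) (d k t)%:E)%E @[n --> \oo] --> (fine (\sum_(n <oo) (d n t)%:E)%E)%:E.
    by rewrite fineK.
  under eq_fun do rewrite sumEFin.
  by move/fine_cvg => /= h; apply/cvg_ex; eexists; exact: h.
have -> : (fun n => u n.+1 t - u n t) = telescope (u ^~ t) by [].
rewrite telescopeK => h; rewrite (_ : u ^~ t = fun n => (u n t - u 0%N t) + u 0%N t).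
  by apply: is_cvgD => //; exact: is_cvg_cst.
by apply/funext => n; rewrite subrK.
Qed.

Definition sqmod (z : C) : R := complex.Re z ^+ 2 + complex.Im z ^+ 2.

Lemma sqmod_ge0 z : 0 <= sqmod z. Proof. by rewrite addr_ge0 ?sqr_ge0. Qed.

Lemma sqmodE z : sqmod z = complex.Re (z * z^* ).
Proof. by rewrite cReM cReJ cImJ mulrN opprK -!expr2. Qed.

Lemma L2_dot_real (x : H) : L2_dot x x = (complex.Re (L2_dot x x))%:C.
Proof.
have : 0 <= L2_dot x x := dot_ge0 _ x.
by case: (L2_dot x x) => u v; rewrite lecE /= => /andP[/eqP -> _].
Qed.

Lemma L2_norm_sq (x : H) : `|x| ^+ 2 = L2_dot x x.
Proof. by rewrite L2_normE sqrtCK. Qed.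

Lemma cReB (u v : C) : complex.Re (u - v) = complex.Re u - complex.Re v.
Proof. by case: u; case: v. Qed.

Lemma cImB (u v : C) : complex.Im (u - v) = complex.Im u - complex.Im v.
Proof. by case: u; case: v. Qed.

Lemma L2_dist_integral (x y : H) :
  (\int[mu]_t (sqmod (repr x (cis t) - repr y (cis t)))%:E)%E = (complex.Re (`|x - y| ^+ 2))%:E.
Proof.
have E : x - y = \pi_(L2 R) (repr x - repr y) by rewrite raddfB /= !reprK.
rewrite L2_norm_sq E L2_dotE /= /Rintegral fineK.
  by apply: eq_integral => t _; rewrite sqmodE.
apply: integrable_fin_num => //; exact: (circle_integrable_mul (repr x - repr y) (repr x - repr y)).1.
Qed.

Lemma repr_measurable (x : H) :
  measurable_fun setT (fun t => complex.Re (repr x (cis t))) /\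
  measurable_fun setT (fun t => complex.Im (repr x (cis t))).
Proof. by have /square_integrableP[] := valP (repr x). Qed.

Lemma geometric_dist (x : nat -> H) : (forall n, `|x n.+1 - x n| <= 2^-1 ^+ n) ->
  forall n m, `|x (n + m)%N - x n| <= 2 * 2^-1 ^+ n.
Proof.
move=> xg n m; apply: (@le_trans _ _ (2 * 2^-1 ^+ n - 2 * 2^-1 ^+ (n + m))); last first.
  by rewrite gerBl mulr_ge0// exprn_ge0// invr_ge0.
elim: m => [|m IH]; first by rewrite addn0 !subrr normr0.
rewrite addnS -(subrK (x (n + m)%N) (x (n + m).+1)) -addrA.
apply: le_trans (ler_normD _ _) _; apply: le_trans (lerD (xg _) IH) _.
by rewrite exprSr le_eqVlt; apply/orP; left; apply/eqP; field.
Qed.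

(** Real and imaginary parts converge almost everywhere; the limit, taken as an
    upper limit to be measurable and defined everywhere, is close to each term by
    Fatou's lemma. *)
Lemma L2_complete (x : nat -> H) : (forall n, `|x n.+1 - x n| <= 2^-1 ^+ n) ->
  exists y, forall n, `|y - x n| <= 2 * 2^-1 ^+ n.
Proof.
move=> xg; pose a n t := complex.Re (repr (x n) (cis t)).
pose b n t := complex.Im (repr (x n) (cis t)).
have ma n : measurable_fun setT (a n) := (repr_measurable (x n)).1.
have mb n : measurable_fun setT (b n) := (repr_measurable (x n)).2.
have sqb n m : (\int[mu]_t (sqmod (repr (x (n + m)%N) (cis t) - repr (x n) (cis t)))%:E <=
    ((2 * 2^-1 ^+ n) ^+ 2)%:E)%E.
  rewrite L2_dist_integral lee_fin -lecR.
  have -> : (complex.Re (`|x (n + m)%N - x n| ^+ 2))%:C = `|x (n + m)%N - x n| ^+ 2.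
    by rewrite L2_norm_sq [RHS]L2_dot_real.
  rewrite rmorphXn rmorphM rmorphXn fmorphV !rmorph_nat /=.
  by rewrite lerXn2r ?nnegrE ?mulr_ge0 ?exprn_ge0 ?invr_ge0// geometric_dist.
have sqb1 n : (\int[mu]_t (sqmod (repr (x n.+1) (cis t) - repr (x n) (cis t)))%:E <=
    (2^-1 ^+ n.*2)%:E)%E.
  rewrite L2_dist_integral lee_fin -lecR.
  have -> : (complex.Re (`|x n.+1 - x n| ^+ 2))%:C = `|x n.+1 - x n| ^+ 2.
    by rewrite L2_norm_sq [RHS]L2_dot_real.
  rewrite rmorphXn fmorphV !rmorph_nat /= -muln2 exprM.
  by rewrite lerXn2r ?nnegrE ?exprn_ge0 ?invr_ge0.
have msq n m : measurable_fun setT (fun t => (sqmod (repr (x n) (cis t) - repr (x m) (cis t)))%:E).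
  apply/measurable_EFinP; under eq_fun do rewrite /sqmod cReB cImB.
  apply: measurable_funD; apply: measurable_funX.
    by apply: measurable_funB; [exact: (ma n)|exact: (ma m)].
  by apply: measurable_funB; [exact: (mb n)|exact: (mb m)].
have cva : {ae mu, forall t, cvgn (a ^~ t)}.
  apply: ae_cvg_of_square_geometric => // n; apply: le_trans (sqb1 n).
  apply: ge0_le_integral => //.
  - by move=> t _; rewrite lee_fin sqr_ge0.
  - by apply/measurable_EFinP; apply: measurable_funX; exact: (measurable_funB (ma n.+1) (ma n)).
  - exact: msq.
  by move=> t _; rewrite lee_fin /sqmod cReB lerDl sqr_ge0.
have cvb : {ae mu, forall t, cvgn (b ^~ t)}.
  apply: ae_cvg_of_square_geometric => // n; apply: le_trans (sqb1 n).
  apply: ge0_le_integral => //.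
  - by move=> t _; rewrite lee_fin sqr_ge0.
  - by apply/measurable_EFinP; apply: measurable_funX; exact: (measurable_funB (mb n.+1) (mb n)).
  - exact: msq.
  by move=> t _; rewrite lee_fin /sqmod cImB lerDr sqr_ge0.
pose f (z : C) : C := Complex (fine (limn_esup (fun n => (complex.Re (repr (x n) z))%:E)))
  (fine (limn_esup (fun n => (complex.Im (repr (x n) z))%:E))).
have fine_lim (u : nat -> R) : cvgn u -> u @ \oo --> fine (limn_esup (fun n => (u n)%:E)).
  move=> cu; have h : (u n)%:E @[n --> \oo] --> (limn u)%:E by apply: cvg_EFin => //; exact: nearW.
  by rewrite (cvg_limn_einf_sup h).2 /=.
have cvf : {ae mu, forall t, a ^~ t @ \oo --> complex.Re (f (cis t)) /\
    b ^~ t @ \oo --> complex.Im (f (cis t))}.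
  by apply: filterS2 cva cvb => t ca cb; split; exact: fine_lim.
have mfr : measurable_fun setT (fun t => complex.Re (f (cis t))).
  apply: (measurableT_comp (fine_measurable measurableT)).
  apply: (@measurable_fun_limn_esup _ _ _ _ (fun n t => (a n t)%:E)) => // n.
  by apply/measurable_EFinP; exact: ma.
have mfi : measurable_fun setT (fun t => complex.Im (f (cis t))).
  apply: (measurableT_comp (fine_measurable measurableT)).
  apply: (@measurable_fun_limn_esup _ _ _ _ (fun n t => (b n t)%:E)) => // n.
  by apply/measurable_EFinP; exact: mb.
have msf n : measurable_fun setT (fun t => (sqmod (f (cis t) - repr (x n) (cis t)))%:E).
  apply/measurable_EFinP; under eq_fun do rewrite /sqmod cReB cImB.
  apply: measurable_funD; apply: measurable_funX.
    by apply: measurable_funB; [exact: mfr|exact: (ma n)].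
  by apply: measurable_funB; [exact: mfi|exact: (mb n)].
have fat n : (\int[mu]_t (sqmod (f (cis t) - repr (x n) (cis t)))%:E <=
    ((2 * 2^-1 ^+ n) ^+ 2)%:E)%E.
  have F := @fatou _ _ _ mu setT measurableT
    (fun m t => (sqmod (repr (x (n + m)%N) (cis t) - repr (x n) (cis t)))%:E)
    (fun m => msq _ _) (fun m t _ => sqmod_ge0 _).
  apply: le_trans (limn_einf_le (sqb n)); apply: le_trans F.
  rewrite le_eqVlt; apply/orP; left; apply/eqP; apply: ae_eq_integral => //.
  - exact: msf.
  - have -> : (fun t => limn_einf (fun m => (sqmod (repr (x (n + m)%N) (cis t) - repr (x n) (cis t)))%:E)) =
      (fun t => - limn_esup (fun m => - (sqmod (repr (x (n + m)%N) (cis t) - repr (x n) (cis t)))%:E))%E.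
      by [].
    apply: measurableT_comp => //.
    apply: (@measurable_fun_limn_esup _ _ _ _ (fun m t =>
      - (sqmod (repr (x (n + m)%N) (cis t) - repr (x n) (cis t)))%:E)%E) => // m.
    by apply: measurableT_comp => //; exact: msq.
  apply: filterS cvf => t [cr ci] _; apply/esym.
  apply: (cvg_limn_einf_sup _).1; apply: cvg_EFin; first exact: nearW.
  rewrite /sqmod cReB cImB; under eq_fun do rewrite /sqmod cReB cImB.
  have sh (u : nat -> R) (l : R) : u @ \oo --> l -> u (n + m)%N @[m --> \oo] --> l.
    by move=> ul; under eq_fun do rewrite addnC; apply: (eq_ind_r (fun P : Prop => P) _ (cvg_shiftn n u (nbhs l))); exact: ul.
  have sq (u : nat -> R) (l : R) : u @ \oo --> l -> u n ^+ 2 @[n --> \oo] --> l ^+ 2.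
    by move=> ul; rewrite expr2; under eq_fun do rewrite expr2; exact: cvgM.
  have ca : a (n + m)%N t - a n t @[m --> \oo] --> complex.Re (f (cis t)) - a n t.
    by apply: cvgB; [exact: (sh (a ^~ t))|exact: cvg_cst].
  have cb : b (n + m)%N t - b n t @[m --> \oo] --> complex.Im (f (cis t)) - b n t.
    by apply: cvgB; [exact: (sh (b ^~ t))|exact: cvg_cst].
  exact: (cvgD (sq _ _ ca) (sq _ _ cb)).
have fsq n : (fun z => f z - repr (x n) z) \in @square_integrable R.
  apply/square_integrableP; split.
  - by under eq_fun do rewrite cReB; apply: measurable_funB; [exact: mfr|exact: (ma n)].
  - by under eq_fun do rewrite cImB; apply: measurable_funB; [exact: mfi|exact: (mb n)].
  apply/integrableP; split.
    by apply: (eq_measurable_fun _ _ (msf n)) => t _ /=; rewrite sqmodE.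
  apply: le_lt_trans (ltry ((2 * 2^-1 ^+ n) ^+ 2)); apply: le_trans (fat n).
  rewrite le_eqVlt; apply/orP; left; apply/eqP; apply: eq_integral => t _ /=.
  by rewrite ger0_norm -?sqmodE ?sqmod_ge0.
have f2 : f \in @square_integrable R.
  rewrite (_ : f = (fun z => f z - repr (x 0%N) z) + (repr (x 0%N) : C -> C)).
    by apply: rpredD => //; exact: valP.
  by apply/funext => z; rewrite [RHS]subrK.
exists (to_L2 f) => n.
rewrite -(@ler_sqr _ `|_|) ?nnegrE ?mulr_ge0 ?exprn_ge0 ?invr_ge0//.
rewrite L2_norm_sq L2_dot_real -L2_norm_sq.
have -> : (2 * 2^-1 ^+ n) ^+ 2 = ((2 * 2^-1 ^+ n) ^+ 2 : R)%:C.
  by rewrite rmorphXn rmorphM rmorphXn fmorphV !rmorph_nat.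
rewrite lecR -lee_fin -L2_dist_integral; apply: le_trans (fat n).
rewrite le_eqVlt; apply/orP; left; apply/eqP; apply: ae_eq_integral => //.
- apply/measurable_EFinP; under eq_fun do rewrite /sqmod cReB cImB.
  have [h1 h2] := repr_measurable (to_L2 f).
  apply: measurable_funD; apply: measurable_funX.
    exact: (measurable_funB h1 (ma n)).
  exact: (measurable_funB h2 (mb n)).
- exact: msf.
by apply: filterS (to_L2E f2) => t -> _.
Qed.
End Completeness.

(** * Orthogonal projections *)

Section Hilbert.
Variable R : realType.
Local Notation C := R[i].
Local Notation H := (L2 R).
Local Notation "x %:C" := (real_complex R x) : ring_scope.
Local Notation "''[' x , y ]" := (L2_dot x y) : ring_scope.
Implicit Types (x y z : H) (a b : C) (K M : set H).

Lemma dotDl x y z : '[x + y, z] = '[x, z] + '[y, z]. Proof. exact: linearDl. Qed.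
Lemma dotDr x y z : '[x, y + z] = '[x, y] + '[x, z]. Proof. exact: linearDr. Qed.
Lemma dotBl x y z : '[x - y, z] = '[x, z] - '[y, z]. Proof. exact: linearBl. Qed.
Lemma dotBr x y z : '[x, y - z] = '[x, y] - '[x, z]. Proof. exact: linearBr. Qed.
Lemma dotZl a x y : '[a *: x, y] = a * '[x, y]. Proof. by rewrite linearZl_LR. Qed.
Lemma dotZr a x y : '[x, a *: y] = a^* * '[x, y]. Proof. by rewrite linearZr_LR. Qed.
Lemma dot0l y : '[0, y] = 0. Proof. exact: linear0l. Qed.
Lemma dot0r y : '[y, 0] = 0. Proof. exact: linear0r. Qed.
Lemma dotC x y : '[x, y] = '[y, x]^* . Proof. by rewrite L2_dotC expr0 mul1r. Qed.

Lemma dot_eq0 x : '[x, x] = 0 -> x = 0.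
Proof.
move=> h; apply/eqP; apply: contraT => /L2_dot_gt0; by rewrite h ltxx.
Qed.

Lemma dot_sumr (I : Type) (s : seq I) (F : I -> H) x :
  '[x, \sum_(i <- s) F i] = \sum_(i <- s) '[x, F i].
Proof.
elim: s => [|i s IH]; first by rewrite !big_nil dot0r.
by rewrite !big_cons dotDr IH.
Qed.

Lemma dot_suml (I : Type) (s : seq I) (F : I -> H) x :
  '[\sum_(i <- s) F i, x] = \sum_(i <- s) '[F i, x].
Proof.
elim: s => [|i s IH]; first by rewrite !big_nil dot0l.
by rewrite !big_cons dotDl IH.
Qed.

Lemma norm_dot_le x y : `|'[x, y]| <= `|x| * `|y|.
Proof.
rewrite -(@ler_sqr _ `|'[x, y]|) ?nnegrE ?mulr_ge0// exprMn !L2_norm_sq.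
exact: dot_CauchySchwarz.
Qed.

(** Norms in [L2] are complex numbers, which carry only a partial order; bounds by
    a geometric sequence stand in for the usual arguments with a small real. *)
Lemma geometric_small_eq0 (c z : C) : (forall n, `|z| <= c * 2^-1 ^+ n) -> z = 0.
Proof.
move=> h; have c0 : 0 <= c by have := h 0%N; rewrite expr0 mulr1; apply: le_trans.
apply/eqP; rewrite -normr_eq0; apply/negPn/negP => zn.
have z0 : 0 < `|z| by rewrite lt_def zn normr_ge0.
have cE : c = (complex.Re c)%:C by move: c0; case: (c) => u v; rewrite lecE /= => /andP[/eqP -> _].
have zE : `|z| = (complex.Re `|z|)%:C by rewrite normc_def.
set r := complex.Re `|z| in zE; set s := complex.Re c in cE.
have r0 : 0 < r by move: z0; rewrite zE ltcR.
have s0 : 0 <= s by move: c0; rewrite cE lecR.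
have sr : 0 <= s / r by rewrite divr_ge0// ltW.
have [n sn] : exists n : nat, s / r < n%:R.
  by exists (Num.bound (s / r)); rewrite -{1}(ger0_norm sr); have := archi_boundP sr; rewrite ger0_norm.
have := h n; rewrite zE cE -[2]/(2%:R) -(rmorph_nat (real_complex R)) -fmorphV -rmorphXn -rmorphM lecR.
rewrite exprVn ler_pdivlMr ?exprn_gt0// => h2.
have : r * 2 ^+ n <= r * n%:R by apply: le_trans h2 _; apply/ltW; rewrite -ltr_pdivrMl// mulrC.
rewrite ler_pM2l// -natrX ler_nat leqNgt; by rewrite ltn_expl.
Qed.

Lemma closed_geometric_lim M (y : H) (u : nat -> H) (c : C) : closed M ->
  (forall n, M (u n)) -> (forall n, `|y - u n| <= c * 2^-1 ^+ n) -> M y.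
Proof.
move=> cM Mu uy; apply: cM => B /nbhs_ballP[e /= e0 eB].
have [n hn] : exists n, `|y - u n| < e.
  apply: contrapT => /forallNP h.
  suff e00 : e = 0 by move: e0; rewrite e00 ltxx.
  apply: (@geometric_small_eq0 c) => n; rewrite gtr0_norm//.
  apply: le_trans (uy n); rewrite (real_leNgt (gtr0_real e0) (normr_real _)).
  exact/negP.
by exists (u n); split => //; apply: eB; rewrite -ball_normE.
Qed.

Lemma closedP M : (forall y (u : nat -> H), (forall n, M (u n)) ->
    (forall n, `|y - u n| <= 2^-1 ^+ n) -> M y) -> closed M.
Proof.
move=> h y cy.
have [u hu] : {u : nat -> H & forall n, M (u n) /\ `|y - u n| <= 2^-1 ^+ n}.
  apply: (@choice _ _ (fun n u => M u /\ `|y - u| <= 2^-1 ^+ n)) => n.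
  have e0 : 0 < 2^-1 ^+ n :> C by rewrite exprn_gt0// invr_gt0.
  have [z [Mz]] := cy _ (nbhsx_ballx y _ e0).
  by rewrite -ball_normE => /ltW yz; exists z.
by apply: (h y u) => n; have [] := hu n.
Qed.

(** The algebraic part of [closed_subspace], kept apart because closedness is
    obtained and used separately. *)
Definition linear_subspace M := M 0 /\ forall a x y, M x -> M y -> M (a *: x + y).

Lemma linear_subspaceD M x y : linear_subspace M -> M x -> M y -> M (x + y).
Proof. by move=> [_ h] Mx My; rewrite -[x]scale1r; exact: h. Qed.

Lemma linear_subspaceZ M a x : linear_subspace M -> M x -> M (a *: x).
Proof. by move=> [M0 h] Mx; rewrite -[_ *: _]addr0; exact: h. Qed.

Lemma linear_subspaceB M x y : linear_subspace M -> M x -> M y -> M (x - y).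
Proof. by move=> sM Mx My; rewrite -scaleN1r; apply: linear_subspaceD => //; exact: linear_subspaceZ. Qed.

Lemma parallelogram x y : `|x - y| ^+ 2 = 2 * `|x| ^+ 2 + 2 * `|y| ^+ 2 - `|x + y| ^+ 2.
Proof. rewrite !L2_norm_sq !(dotBl, dotBr, dotDl, dotDr); ring. Qed.

(** A minimizing sequence for the distance is a Cauchy sequence by the
    parallelogram identity; choosing it with geometric speed lets [L2_complete]
    apply. *)
Lemma projection_exists K x : closed K -> linear_subspace K ->
  exists y, K y /\ forall h, K h -> '[x - y, h] = 0.
Proof.
move=> cK sK; pose N z : R := complex.Re (`|z| ^+ 2).
have NE z : (N z)%:C = `|z| ^+ 2 by rewrite /N L2_norm_sq -L2_dot_real.
have N0 z : 0 <= N z by rewrite -lecR NE exprn_ge0.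
pose D := [set N (x - k) | k in K]; pose d := inf D.
have hD : has_inf D.
  by split; [exists (N (x - 0)); exists 0 => //; exact: sK.1|exists 0 => _ [k _ <-]].
have dle k : K k -> d <= N (x - k) by move=> Kk; apply: ge_inf; [exact: hD.2|exists k].
(* with this margin the parallelogram identity bounds the increments by 2^-n *)
pose e n : R := 2^-1 ^+ n.*2 / 4.
have [u hu] : {u : nat -> H & forall n, K (u n) /\ N (x - u n) <= d + e n}.
  apply: (@choice _ _ (fun n u => K u /\ N (x - u) <= d + e n)) => n.
  have e0 : 0 < e n by rewrite divr_gt0// exprn_gt0// invr_gt0.
  by have [_ [k Kk <-] /ltW h] := inf_adherent e0 hD; exists k.
have uK n := (hu n).1.
have step n : `|u n.+1 - u n| <= 2^-1 ^+ n.
  rewrite -(@ler_sqr _ `|_|) ?nnegrE ?exprn_ge0 ?invr_ge0// -NE.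
  have -> : (2^-1 ^+ n) ^+ 2 = (2^-1 ^+ n.*2 : R)%:C.
    by rewrite -exprM muln2 rmorphXn fmorphV rmorph_nat.
  rewrite lecR.
  have P : N (u n.+1 - u n) = 2 * N (x - u n) + 2 * N (x - u n.+1) - 4 * N (x - 2^-1 *: (u n + u n.+1)).
    apply: complexI; rewrite !(rmorphB, rmorphD, rmorphM) /=.
    have -> : u n.+1 - u n = (x - u n) - (x - u n.+1) by rewrite opprB [RHS]addrC addrA subrK.
    rewrite [LHS]NE parallelogram.
    have -> : x - u n + (x - u n.+1) = 2 *: (x - 2^-1 *: (u n + u n.+1)).
      rewrite scalerBr scalerA divff ?pnatr_eq0// scale1r scaler_nat mulr2n.
      by rewrite opprD addrACA.
    by rewrite normrZ exprMn normr_nat !NE rmorph1; ring.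
  rewrite P; have h1 := (hu n).2; have h2 := (hu n.+1).2.
  have h3 : d <= N (x - 2^-1 *: (u n + u n.+1)).
    by apply: dle; apply: linear_subspaceZ => //; exact: linear_subspaceD.
  have h4 : e n.+1 = e n / 4 by rewrite /e doubleS !exprS; field.
  have h5 : 2^-1 ^+ n.*2 = 4 * e n by rewrite /e; field.
  have h6 : 0 <= e n by rewrite divr_ge0// exprn_ge0// invr_ge0.
  rewrite h5; rewrite h4 in h2; lra.
have [y hy] := L2_complete step; exists y; split.
  by apply: (@closed_geometric_lim K y u 2).
move=> h Kh.
apply: (@geometric_small_eq0 (`|h| + 2 * `|h|)) => n.
have -> : x - y = (x - u n) - (y - u n) by rewrite opprB addrA subrK.
rewrite dotBl; apply: le_trans (ler_normB _ _) _; rewrite mulrDl; apply: lerD; last first.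
  apply: le_trans (norm_dot_le _ _) _.
  by rewrite mulrAC; apply: ler_wpM2r.
have [->|h0] := eqVneq h 0; first by rewrite dot0r !normr0 mul0r.
have hh : 0 < '[h, h] := L2_dot_gt0 h0.
set w := x - u n; pose c := '[w, h] / '[h, h].
have : (d + e n - N (w - c *: h))%:C <= (e n)%:C.
  rewrite lecR lerBlDr addrC lerD2l.
  by rewrite /w -addrA -opprD; apply: dle; apply: linear_subspaceD => //; exact: linear_subspaceZ.
have wn : `|w| ^+ 2 <= (d + e n)%:C by rewrite -NE lecR; exact: (hu n).2.
rewrite rmorphB /= NE => h1.
have {}h1 : `|w| ^+ 2 - `|w - c *: h| ^+ 2 <= (e n)%:C.
  by apply: le_trans h1; rewrite lerD2r.
rewrite -(@ler_sqr _ `|_|) ?nnegrE ?mulr_ge0 ?exprn_ge0 ?invr_ge0//.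
have h2 : `|w| ^+ 2 - `|w - c *: h| ^+ 2 = `|'[w, h]| ^+ 2 / '[h, h].
  clearbody w; have cc : '[h, h]^* = '[h, h] by rewrite -dotC.
  rewrite !L2_norm_sq !(dotBl, dotBr, dotZl, dotZr) normCK /c rmorphM fmorphV /= cc -(dotC h w).
by field; rewrite gt_eqF.
move: h1; rewrite h2 ler_pdivrMr// => h1; apply: le_trans h1 _.
rewrite exprMn L2_norm_sq mulrC ler_wpM2l ?(ltW hh)//.
have -> : (2^-1 ^+ n) ^+ 2 = (2^-1 ^+ n.*2 : R)%:C.
  by rewrite -exprM muln2 rmorphXn fmorphV rmorph_nat.
rewrite lecR /e ler_pdivrMr// ler_peMr ?exprn_ge0 ?invr_ge0//.
by rewrite ler1n.
Qed.
End Hilbert.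

(** * The power map preserves arc length *)

Section PowerMap.
Variable R : realType.
Local Notation C := R[i].
Local Notation mu := (circle_measure R).
Local Notation leb := (@lebesgue_measure R).
Local Open Scope ereal_scope.

(** The push-forward of Lebesgue measure along an affine map, scaled by its slope,
    agrees with Lebesgue measure on intervals. *)
Lemma ge0_integral_affine (a b : R) (D : set R) (f : R -> \bar R) : (0 < a)%R ->
  measurable D -> measurable_fun setT f -> (forall t, 0 <= f t) ->
  \int[leb]_(t in (fun t => a * t + b)%R @^-1` D) f (a * t + b)%R =
  a^-1%:E * \int[leb]_(t in D) f t.
Proof.
move=> a0 mD mf f0.
have mphi : measurable_fun setT ((fun t => a * t + b)%R : measurableTypeR R -> measurableTypeR R).
  apply: measurable_funD => //; exact: measurable_funM.
pose phi : measurableTypeR R -> measurableTypeR R := (fun t => a * t + b)%R.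
pose k : {nonneg R} := NngNum (ltW a0).
pose pf := pushforward leb phi : {measure set (measurableTypeR R) -> \bar R}.
pose m := mscale k (pf mphi) : {measure set (measurableTypeR R) -> \bar R}.
have mE A : measurable A -> leb A = m A.
  apply: lebesgue_measure_unique => _ [[u v]] _ <- /=.
  rewrite /m /mscale /= /pushforward.
  rewrite (_ : phi @^-1` _ = `](u - b) / a, (v - b) / a]%classic)%R; last first.
    apply/seteqP; split => t /=; rewrite !in_itv /= ltr_pdivrMr// ler_pdivlMr// mulrC;
      by rewrite ltrBlDr lerBrDr.
  rewrite !lebesgue_measure_itv /= !lte_fin ltr_pM2r ?invr_gt0// ltrD2r.
  case: ifP => _; last by rewrite mule0.
  rewrite -!EFinD -EFinM; congr EFin; field; by rewrite gt_eqF.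
have -> : \int[leb]_(t in D) f t = \int[m]_(t in D) f t.
  by apply: eq_measure_integral => A mA _; exact: mE.
rewrite ge0_integral_mscale//; last by apply: measurable_funTS.
rewrite muleA -EFinM mulVf ?gt_eqF// mul1e ge0_integral_pushforward//.
by apply: measurable_funTS.
Qed.

Lemma ge0_integral_period (p : R) (f : R -> \bar R) (n : nat) : (0 < p)%R ->
  measurable_fun setT f -> (forall t, 0 <= f t) -> (forall t, f (t + p)%R = f t) ->
  \int[leb]_(t in `[0%R, (n%:R * p)%R[%classic) f t = n%:R%:E * \int[leb]_(t in `[0%R, p[%classic) f t.
Proof.
move=> p0 mf f0 fp; elim: n => [|n IH].
  by rewrite !mul0r mul0e set_itvco0 integral_set0.
have fnp m t : f (1 * t + m%:R * p)%R = f t.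
  by rewrite mul1r; elim: m => [|m IHm]; rewrite ?mul0r ?addr0// -natr1 mulrDl mul1r addrA fp.
have np : (0 <= n%:R * p)%R by rewrite mulr_ge0// ltW.
rewrite (@itv_bndbnd_setU _ _ _ (BLeft (n%:R * p)%R)) ?bnd_simp//=; last first.
  by rewrite ler_pM2r// ler_nat.
rewrite ge0_integral_setU//=.
- rewrite IH -natr1 EFinD ge0_muleDl ?lee_fin// mul1e; congr (_ + _).
  have := @ge0_integral_affine 1 (n%:R * p)%R `[(n%:R * p)%R, ((n%:R + 1) * p)%R[%classic f ltr01.
  rewrite invr1 mul1e => <- //.
  rewrite (_ : _ @^-1` _ = `[0%R, p[%classic); first by apply: eq_integral => t _; rewrite fnp.
  apply/seteqP; split => t /=; rewrite !in_itv /= mul1r mulrDl mul1r;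
    by rewrite addrC lerDl ltrD2l.
- exact: measurable_funTS.
- apply/disj_setPS => t [] /=; rewrite !in_itv /= => /andP[_ h] /andP[h2 _].
  by have := lt_le_trans h h2; rewrite ltxx.
Qed.

(** [t |-> n t] stretches one period to [n] periods. *)
Lemma ge0_circle_power (f : R -> \bar R) (n : nat) : (0 < n)%N ->
  measurable_fun setT f -> (forall t, 0 <= f t) -> (forall t, f (t + 2 * pi)%R = f t) ->
  \int[mu]_t f (n%:R * t)%R = \int[mu]_t f t.
Proof.
move=> n0 mf f0 fp.
have p0 : (0 < 2 * pi :> R)%R := twopi_gt0 R.
have n0' : (0 < n%:R :> R)%R by rewrite ltr0n.
have mfn : measurable_fun setT (fun t : R => f (n%:R * t)%R).
  by apply: measurableT_comp => //; exact: measurable_funM.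
rewrite !(integral_uniform (twopi_gt0 R))//; congr (_ * _).
rewrite -!integral_itv_bndo_bndc; try exact: measurable_funTS.
have := @ge0_integral_affine n%:R 0 `[0%R, (n%:R * (2 * pi))%R[%classic f n0' (measurable_itv _) mf f0.
rewrite ge0_integral_period// muleA -EFinM mulVf ?gt_eqF// mul1e => <-.
rewrite (_ : _ @^-1` _ = `[0%R, (2 * pi)%R[%classic); first by apply: eq_integral => t _; rewrite addr0.
by apply/seteqP; split => t /=; rewrite !in_itv /= addr0 ltr_pM2l// pmulr_rge0.
Qed.

Lemma cis_periodic (t : R) : cis (t + 2 * pi) = cis t :> C.
Proof. by rewrite /cis mulr_natl cosD2pi sinD2pi. Qed.

Lemma circle_power_measurable (h : C -> R) (n : nat) :
  measurable_fun setT (fun t => h (cis t)) -> measurable_fun setT (fun t => h (cis t ^+ n)%R).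
Proof.
move=> mh; under eq_fun do rewrite cisX.
apply: (measurableT_comp mh); exact: measurable_funM.
Qed.

Lemma ge0_integral_circle_power (h : C -> R) (n : nat) : (0 < n)%N ->
  measurable_fun setT (fun t => h (cis t)) -> (forall z, 0 <= h z)%R ->
  \int[mu]_t (h (cis t ^+ n)%R)%:E = \int[mu]_t (h (cis t))%:E.
Proof.
move=> n0 mh h0; rewrite -(@ge0_circle_power (fun t => (h (cis t))%:E) n n0).
- by apply: eq_integral => t _; rewrite cisX.
- exact/measurable_EFinP.
- by move=> t; rewrite lee_fin.
- by move=> t; rewrite cis_periodic.
Qed.

(** The power map is measure preserving, so the integral of [`|h|] detects both
    conditions. *)
Lemma ae_circle_power (h : C -> R) (n : nat) : (0 < n)%N ->
  measurable_fun setT (fun t => h (cis t)) ->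
  {ae mu, forall t, h (cis t ^+ n)%R = 0%R} <-> {ae mu, forall t, h (cis t) = 0%R}.
Proof.
move=> n0 mh.
have E : \int[mu]_t `|(h (cis t ^+ n)%R)%:E| = \int[mu]_t `|(h (cis t))%:E|.
  apply: (@ge0_integral_circle_power (fun z => `|h z|%R)) => //.
  exact: measurableT_comp.
have A (k : R -> R) : measurable_fun setT k ->
    (\int[mu]_t `|(k t)%:E| = 0 <-> {ae mu, forall t, k t = 0%R}).
  move=> mk; have mk' : measurable_fun setT (EFin \o k) by exact/measurable_EFinP.
  have := ae_eq_integral_abs mu measurableT mk' => -[h1 h2]; split.
    by move=> /h1; apply: filterS => t /= /(_ I) [].
  by move=> h3; apply: h2; apply: filterS h3 => t /= ->.
rewrite -(A _ mh) -(A _ (circle_power_measurable n mh)); by rewrite E.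
Qed.

Lemma integrable_circle_power (h : C -> R) (n : nat) : (0 < n)%N ->
  mu.-integrable setT (fun t => (h (cis t))%:E) ->
  mu.-integrable setT (fun t => (h (cis t ^+ n)%R)%:E) /\
  \int[mu]_t (h (cis t ^+ n)%R)%:E = \int[mu]_t (h (cis t))%:E.
Proof.
move=> n0 ih; have mh : measurable_fun setT (fun t => h (cis t)).
  by apply/measurable_EFinP; exact: measurable_int ih.
split.
  apply/integrableP; split; first by apply/measurable_EFinP; exact: circle_power_measurable.
  have/integrableP[_] := ih; rewrite -(@ge0_integral_circle_power (fun z => `|h z|%R) n) //.
  exact: measurableT_comp.
rewrite integralE [RHS]integralE; congr (_ - _).
  under eq_integral do rewrite funeposE -EFin_max.
  under [RHS]eq_integral do rewrite funeposE -EFin_max.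
  apply: (@ge0_integral_circle_power (fun z => Num.max (h z) 0)%R n n0) => [|z].
    exact: measurable_maxr.
  by rewrite le_max lexx orbT.
under eq_integral do rewrite funenegE -EFinN -EFin_max.
under [RHS]eq_integral do rewrite funenegE -EFinN -EFin_max.
apply: (@ge0_integral_circle_power (fun z => Num.max (- h z) 0)%R n n0) => [|z].
  by apply: measurable_maxr => //; exact: measurableT_comp.
by rewrite le_max lexx orbT.
Qed.

Local Close Scope ereal_scope.

Lemma circle_integral_power (F : C -> C) (n : nat) : (0 < n)%N -> circle_integrable F ->
  circle_integrable (fun z => F (z ^+ n)) /\
  circle_integral (fun z => F (z ^+ n)) = circle_integral F.
Proof.
move=> n0 [Fr Fi].
have [h1 h2] := @integrable_circle_power (fun z => complex.Re (F z)) n n0 Fr.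
have [h3 h4] := @integrable_circle_power (fun z => complex.Im (F z)) n n0 Fi.
by split => //; congr Complex; rewrite /Rintegral ?h2 ?h4.
Qed.

Lemma square_integrable_power (f : C -> C) (n : nat) : (0 < n)%N ->
  f \in @square_integrable R -> (fun z => f (z ^+ n)) \in @square_integrable R.
Proof.
move=> n0 /square_integrableP[fr fi f2]; apply/square_integrableP; split.
- exact: (@circle_power_measurable (fun z => complex.Re (f z))).
- exact: (@circle_power_measurable (fun z => complex.Im (f z))).
- exact: (@integrable_circle_power (fun z => complex.Re (f z * (f z)^* )) n n0 f2).1.
Qed.

End PowerMap.

(** * Multiplication operators and Fourier coefficients *)

Section Multiplication.
Variable R : realType.
Local Notation C := R[i].
Local Notation H := (L2 R).
Local Notation mu := (circle_measure R).
Local Notation "''[' x , y ]" := (L2_dot x y) : ring_scope.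
Implicit Types (x y : H) (a b : C) (K M : set H) (f g : C -> C).

Lemma L2_eqP x y : x = y <-> {ae mu, forall t, repr x (cis t) = repr y (cis t)}.
Proof. by rewrite -{1}[x]reprK -{1}[y]reprK; exact: L2P. Qed.

Lemma mul_L2E f x : multiplier f ->
  {ae mu, forall t, repr (mul_L2 f x) (cis t) = f (cis t) * repr x (cis t)}.
Proof. by move=> mf; apply: to_L2E; apply: square_integrableM => //; exact: valP. Qed.

Lemma reprD x y : {ae mu, forall t, repr (x + y) (cis t) = repr x (cis t) + repr y (cis t)}.
Proof.
have /L2P : \pi_(L2 R) (repr (x + y)) = \pi_(L2 R) (repr x + repr y) by rewrite raddfD /= !reprK.
by [].
Qed.

Lemma reprZ a x : {ae mu, forall t, repr (a *: x) (cis t) = a * repr x (cis t)}.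
Proof.
have /L2P : \pi_(L2 R) (repr (a *: x)) = \pi_(L2 R) (a *: repr x).
  by rewrite reprK -[LHS]/(L2_scale a x) -{1}[x]reprK L2_piZ.
by [].
Qed.

Lemma repr0 : {ae mu, forall t, repr (0 : H) (cis t) = 0}.
Proof.
have /L2P : \pi_(L2 R) (repr (0 : H)) = \pi_(L2 R) 0 by rewrite reprK raddf0.
by [].
Qed.

(** Modus ponens inside the almost-everywhere quantifier, to combine any number
    of almost-everywhere identities. *)
Lemma ae_mp (P Q : R -> Prop) : {ae mu, forall t, P t} -> {ae mu, forall t, P t -> Q t} ->
  {ae mu, forall t, Q t}.
Proof. by apply: filterS2 => t Pt; exact. Qed.

Lemma mul_ext f g x : multiplier f -> multiplier g ->
  {ae mu, forall t, f (cis t) = g (cis t)} -> mul_L2 f x = mul_L2 g x.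
Proof.
move=> mf mg fg; apply/L2_eqP; move: (mul_L2E x mf) (mul_L2E x mg) fg.
by apply: filterS3 => t -> -> ->.
Qed.

Lemma mul_linear f a x y : multiplier f ->
  mul_L2 f (a *: x + y) = a *: mul_L2 f x + mul_L2 f y.
Proof.
move=> mf; apply/L2_eqP.
apply: (ae_mp (mul_L2E x mf)); apply: (ae_mp (mul_L2E y mf)); apply: (ae_mp (mul_L2E (a *: x + y) mf)).
apply: (ae_mp (reprD (a *: mul_L2 f x) (mul_L2 f y))); apply: (ae_mp (reprZ a (mul_L2 f x))).
apply: (ae_mp (reprD (a *: x) y)); apply: (ae_mp (reprZ a x)).
by apply: aeW => t -> -> -> -> -> -> ->; rewrite mulrDr mulrCA.
Qed.

Lemma mul_L2D f x y : multiplier f -> mul_L2 f (x + y) = mul_L2 f x + mul_L2 f y.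
Proof. by move=> mf; rewrite -[x]scale1r mul_linear// !scale1r. Qed.

Lemma mul_0 f : multiplier f -> mul_L2 f 0 = 0.
Proof.
move=> mf; have := @mul_linear f (-1) 0 0 mf; rewrite scaler0 addr0 => ->.
by rewrite scaleN1r addNr.
Qed.

Lemma mul_L2Z f a x : multiplier f -> mul_L2 f (a *: x) = a *: mul_L2 f x.
Proof. by move=> mf; rewrite -[a *: x]addr0 mul_linear// mul_0// addr0. Qed.

Lemma mul_L2B f x y : multiplier f -> mul_L2 f (x - y) = mul_L2 f x - mul_L2 f y.
Proof. by move=> mf; rewrite mul_L2D// -scaleN1r mul_L2Z// scaleN1r. Qed.

Lemma mul_L2M f g x : multiplier f -> multiplier g ->
  mul_L2 f (mul_L2 g x) = mul_L2 (fun z => f z * g z) x.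
Proof.
move=> mf mg; apply/L2_eqP.
apply: (ae_mp (mul_L2E x (multiplierM mf mg))); apply: (ae_mp (mul_L2E x mg)).
by apply: (ae_mp (mul_L2E (mul_L2 g x) mf)); apply: aeW => t -> -> ->; rewrite mulrA.
Qed.

Lemma mul_L2C f g x : multiplier f -> multiplier g ->
  mul_L2 f (mul_L2 g x) = mul_L2 g (mul_L2 f x).
Proof.
move=> mf mg; rewrite !mul_L2M//; apply: mul_ext; try exact: multiplierM.
by apply: aeW => t; rewrite mulrC.
Qed.

Lemma mul_cst c x : mul_L2 (fun=> c) x = c *: x.
Proof.
apply/L2_eqP; apply: (ae_mp (mul_L2E x (multiplier_cst c))); apply: (ae_mp (reprZ c x)).
by apply: aeW => t -> ->.
Qed.

Lemma mul_addf f g x : multiplier f -> multiplier g ->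
  mul_L2 (fun z => f z + g z) x = mul_L2 f x + mul_L2 g x.
Proof.
move=> mf mg; apply/L2_eqP.
apply: (ae_mp (mul_L2E x (multiplierD mf mg))); apply: (ae_mp (mul_L2E x mg)); apply: (ae_mp (mul_L2E x mf)).
apply: (ae_mp (reprD (mul_L2 f x) (mul_L2 g x))).
by apply: aeW => t -> -> -> ->; rewrite mulrDl.
Qed.

Lemma dotE x y : '[x, y] = circle_integral (fun z => repr x z * (repr y z)^* ).
Proof. by []. Qed.

Lemma circle_integrable_repr x y : circle_integrable (fun z => repr x z * (repr y z)^* ).
Proof. exact: circle_integrable_mul. Qed.

Lemma mul_adj f x y : multiplier f -> '[mul_L2 f x, y] = '[x, mul_L2 (fun z => (f z)^* ) y].
Proof.
move=> mf; apply: eq_ae_circle_integral; try exact: circle_integrable_repr.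
apply: (ae_mp (mul_L2E x mf)); apply: (ae_mp (mul_L2E y (multiplier_conj mf))).
by apply: aeW => t -> ->; rewrite rmorphM /= conjCK mulrCA mulrA.
Qed.

Definition unimodular (f : C -> C) := {ae mu, forall t, `|f (cis t)| = 1}.

Lemma mul_conjK f x : multiplier f -> unimodular f ->
  mul_L2 (fun z => (f z)^* ) (mul_L2 f x) = x.
Proof.
move=> mf uf; rewrite mul_L2M//; last exact: multiplier_conj.
rewrite -[RHS]scale1r -mul_cst; apply: mul_ext; [exact/multiplierM/mf/multiplier_conj|exact: multiplier_cst|].
by apply: filterS uf => t ft; rewrite mulrC -normCK ft expr1n.
Qed.

Lemma mul_Kconj f x : multiplier f -> unimodular f ->
  mul_L2 f (mul_L2 (fun z => (f z)^* ) x) = x.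
Proof. by move=> mf uf; rewrite mul_L2C ?mul_conjK//; exact: multiplier_conj. Qed.

Lemma mul_isometry f x y : multiplier f -> unimodular f -> '[mul_L2 f x, mul_L2 f y] = '[x, y].
Proof. by move=> mf uf; rewrite mul_adj// mul_conjK. Qed.

Lemma inner_multiplier f : inner_function f -> multiplier f.
Proof.
move=> [/square_integrableP[fr fi _] _ uf]; split=> //.
by exists 1; apply: filterS uf => t ->.
Qed.

Lemma inner_unimodular f : inner_function f -> unimodular f.
Proof. by case. Qed.

Lemma multiplier_square_integrable f : multiplier f -> f \in @square_integrable R.
Proof.
move=> mf; have := @square_integrableM R f (fun=> 1) mf.
rewrite (_ : (fun z => f z * 1) = f); last by apply/funext => z; rewrite mulr1.
apply; apply/square_integrableP; split; try exact: measurable_cst.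
exact: finite_measure_integrable_cst.
Qed.

Lemma to_L2_mul f : multiplier f -> to_L2 f = mul_L2 f (to_L2 (fun=> 1)).
Proof.
move=> mf; apply/L2_eqP.
apply: (ae_mp (mul_L2E (to_L2 (fun=> 1)) mf)); apply: (ae_mp (to_L2E (multiplier_square_integrable mf))).
apply: (ae_mp (to_L2E (multiplier_square_integrable (multiplier_cst 1)))).
by apply: aeW => t -> -> ->; rewrite mulr1.
Qed.

(** The orthonormal basis [z^n] of [L2], and the unitary operators of
    multiplication by [z^n]. *)
Definition e (n : int) : H := to_L2 (fun z => z ^ n).
Definition Z (n : int) (x : H) : H := mul_L2 (fun z => z ^ n) x.

Lemma ZM m n x : Z m (Z n x) = Z (m + n) x.
Proof.
rewrite /Z mul_L2M; try exact: multiplier_exprz.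
apply: mul_ext; [|exact: multiplier_exprz|].
  by apply: multiplierM; exact: multiplier_exprz.
by apply: aeW => t; rewrite exprzDr// cis_unit.
Qed.

Lemma Z0 x : Z 0 x = x.
Proof. by rewrite -[RHS]scale1r -mul_cst; apply: mul_ext; [exact: multiplier_exprz|exact: multiplier_cst|apply: aeW => t; rewrite expr0z]. Qed.

Lemma e_Z n : e n = Z n (e 0).
Proof.
rewrite /e to_L2_mul; last exact: multiplier_exprz.
by congr (mul_L2 _ (to_L2 _)); apply/funext => z; rewrite expr0z.
Qed.

Lemma Ze m n : Z m (e n) = e (m + n).
Proof. by rewrite e_Z ZM -e_Z. Qed.

Lemma Z_adj n x y : '[Z n x, y] = '[x, Z (- n) y].
Proof.
rewrite mul_adj; last exact: multiplier_exprz.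
congr ('[_, _]); apply: mul_ext; [exact/multiplier_conj/multiplier_exprz|exact: multiplier_exprz|].
by apply: aeW => t; rewrite conjX_cis.
Qed.

Lemma fourier_coefE x n : fourier_coef x n = '[x, e n].
Proof.
apply: eq_ae_circle_integral; last 2 first.
- exact: circle_integrable_repr.
- apply: filterS (to_L2E (multiplier_square_integrable (multiplier_exprz R n))) => t.
  by rewrite -/(e n) => ->.
apply: (@circle_integrable_eq _ (fun z => (z ^ n)^* * (1 * (repr x z * (1 : C)^* )))).
  by move=> t; rewrite mul1r rmorph1 mulr1 mulrC.
apply: circle_integrableM; first exact/multiplier_conj/multiplier_exprz.
apply: circle_integrableM; first exact: multiplier_cst.
exact: (circle_integrable_mul (repr x) (MkL2fun (multiplier_square_integrable (multiplier_cst 1)))).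
Qed.

Lemma coef_Z k x n : '[Z k x, e n] = '[x, e (n - k)].
Proof. by rewrite Z_adj Ze addrC. Qed.

Lemma coef_inj x : (forall n, '[x, e n] = 0) -> x = 0.
Proof.
move=> x0; apply/L2_eqP.
have h1 : circle_integrable (repr x).
  have := circle_integrable_mul (repr x) (MkL2fun (multiplier_square_integrable (multiplier_cst 1))).
  by apply: circle_integrable_eq => t; rewrite /= rmorph1 mulr1.
have : {ae mu, forall t, repr x (cis t) = 0}.
  apply: fourier_uniqueness => // n; rewrite -[RHS](x0 (- n)) -fourier_coefE.
  by apply: circle_integral_eq => t; rewrite conjX_cis opprK.
by move=> h; apply: (ae_mp h); apply: (ae_mp repr0); apply: aeW => t -> ->.
Qed.

Lemma coef_ext x y : (forall n, '[x, e n] = '[y, e n]) -> x = y.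
Proof. by move=> h; apply/eqP; rewrite -subr_eq0; apply/eqP/coef_inj => n; rewrite dotBl h subrr. Qed.

(** The constant 1 is added because the integral over an interval of the uniform
    law is computed for nonnegative functions. *)
Lemma Rintegral_uniform_FTC (f F : R -> R) : (forall t, 0 <= 1 + f t) ->
  continuous f -> (forall t, is_derive t (1 : R) F (1 + f t)) -> F (2 * pi) - F 0 = 2 * pi ->
  mu.-integrable setT (EFin \o f) -> \int[mu]_t f t = 0.
Proof.
move=> f0 cf dF FE fi.
have mf : measurable_fun setT f by exact: measurable_realfun.continuous_measurable_fun.
have c1f : continuous (fun t => 1 + f t).
  by move=> t; apply: cvgD; [exact: cvg_cst|exact: cf].
have p0 : 0 < 2 * pi :> R := twopi_gt0 R.
have E : (\int[mu]_t (1 + f t)%:E = 1)%E.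
  rewrite (integral_uniform (twopi_gt0 R)); last 2 first.
  - apply/measurable_EFinP; exact: measurable_funD.
  - by move=> t; rewrite lee_fin.
  rewrite (@continuous_FTC2 _ (fun t => 1 + f t) F) //.
  - by rewrite -EFinB FE subr0 -EFinM mulVf ?gt_eqF.
  - exact: continuous_subspaceT.
  - have cF : continuous F.
      move=> t; apply: differentiable_continuous; apply/derivable1_diffP.
      by have [] := dF t.
    split; [by move=> t _; have [] := dF t|exact: cvg_at_right_filter (cF _)|exact: cvg_at_left_filter (cF _)].
  - by move=> t _; rewrite derive1E; have [_ ->] := dF t.
have i1 : mu.-integrable setT (EFin \o (fun=> 1 : R)) by exact: finite_measure_integrable_cst.
have : \int[mu]_t (1 + f t) = 1 by rewrite /Rintegral E.
rewrite RintegralD//= Rintegral_cst//.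
have -> : fine (mu [set: R]) = 1 by rewrite (_ : mu _ = 1%E) //; exact: probability_setT.
by rewrite mul1r => /eqP; rewrite -subr_eq0 addrAC subrr add0r => /eqP.
Qed.

Lemma circle_integrable_multiplier f : multiplier f -> circle_integrable f.
Proof.
move=> mf; have := circle_integrable_mul (MkL2fun (multiplier_square_integrable mf))
  (MkL2fun (multiplier_square_integrable (multiplier_cst 1))).
by apply: circle_integrable_eq => t /=; rewrite rmorph1 mulr1.
Qed.

Lemma integral_cos : \int[mu]_t (cos t) = 0.
Proof.
apply: (@Rintegral_uniform_FTC _ (fun t => t + sin t)).
- by move=> t; rewrite -lerBlDl sub0r cos_geN1.
- exact: continuous_cos.
- by rewrite mulr_natl sin2pi sin0 !addr0 subr0.
- exact: (circle_integrable_multiplier (multiplier_id R)).1.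
Qed.

Lemma integral_sin : \int[mu]_t (sin t) = 0.
Proof.
apply: (@Rintegral_uniform_FTC _ (fun t => t - cos t)).
- by move=> t; rewrite -lerBlDl sub0r sin_geN1.
- exact: continuous_sin.
- move=> t; have h : is_derive t (1 : R) (id - @cos R) (1 - (- sin t)) by exact: is_deriveB.
  by rewrite opprK in h.
- by rewrite mulr_natl cos2pi cos0; ring.
- exact: (circle_integrable_multiplier (multiplier_id R)).2.
Qed.

Lemma circle_integral_conj f : multiplier f ->
  circle_integral (fun z => (f z)^* ) = (circle_integral f)^*.
Proof.
move=> mf; have [ir ii] := circle_integrable_multiplier mf.
apply/eqP; rewrite eq_complex /=; apply/andP; split; apply/eqP.
  by apply: eq_Rintegral => t _; rewrite cReJ.
by rewrite -mulN1r -RintegralZl//; apply: eq_Rintegral => t _; rewrite cImJ mulN1r.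
Qed.

(** For [n > 0] the power map reduces the integral of [z^n] to that of [z]. *)
Lemma circle_integral_exprz (n : int) : circle_integral (fun z : C => z ^ n) = (n == 0)%:R.
Proof.
have pos (m : nat) : (0 < m)%N -> circle_integral (fun z : C => z ^+ m) = 0.
  move=> m0; have [_ ->] := circle_integral_power m0 (circle_integrable_multiplier (multiplier_id R)).
  by rewrite /circle_integral /= integral_cos integral_sin.
case: n => [[|n]|n].
- rewrite eqxx (_ : circle_integral _ = circle_integral (fun=> 1 : C)); last first.
    by apply: circle_integral_eq => t; rewrite expr0z.
  rewrite /circle_integral /= !Rintegral_cst//= mul0r mul1r.
  by rewrite (_ : mu _ = 1%E) //; exact: probability_setT.
- exact: pos.
rewrite (_ : circle_integral _ = circle_integral (fun z : C => (z ^+ n.+1)^* )); last first.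
  by apply: circle_integral_eq => t; rewrite NegzE -conjX_cis.
rewrite circle_integral_conj ?pos ?rmorph0//.
exact/multiplierX/multiplier_id.
Qed.

Lemma dot_to_L2 f g : multiplier f -> multiplier g ->
  '[to_L2 f, to_L2 g] = circle_integral (fun z => f z * (g z)^* ).
Proof.
move=> mf mg; have hf := multiplier_square_integrable mf; have hg := multiplier_square_integrable mg.
have E h (hh : h \in @square_integrable R) : to_L2 h = \pi_(L2 R) (MkL2fun hh).
  by congr (\pi_(L2 R) _); apply: val_inj; rewrite insubdK.
by rewrite (E _ hf) (E _ hg) L2_dotE.
Qed.

Lemma dot_e m n : '[e m, e n] = (m == n)%:R.
Proof.
rewrite dot_to_L2; try exact: multiplier_exprz.
rewrite -(subr_eq0 m n) -circle_integral_exprz; apply: circle_integral_eq => t.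
by rewrite conjX_cis -exprzDr ?cis_unit.
Qed.
End Multiplication.

(** * The Hardy space *)

Section Hardy.
Variable R : realType.
Local Notation C := R[i].
Local Notation H := (L2 R).
Local Notation "''[' x , y ]" := (L2_dot x y) : ring_scope.
Local Notation e := (e R).
Local Notation P := (@orthogonal_projection R).
Implicit Types (x y h : H) (a b c : C) (K M : set H) (f g : C -> C) (p q : {poly C}).

Lemma closed_ortho (S : set H) : closed [set x | forall y, S y -> '[x, y] = 0].
Proof.
apply: closedP => y u Mu uy s Ss.
apply: (@geometric_small_eq0 _ `|s|) => n.
rewrite -[y](subrK (u n)) dotDl (Mu n s Ss) addr0 mulrC.
by apply: le_trans (norm_dot_le _ _) _; apply: ler_wpM2r.
Qed.

Lemma linear_subspace_ortho (S : set H) : linear_subspace [set x | forall y, S y -> '[x, y] = 0].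
Proof.
split=> [y _|a x y hx hy s Ss]; first exact: dot0l.
by rewrite dotDl dotZl hx// hy// mulr0 addr0.
Qed.

Lemma linear_subspaceI K M : linear_subspace K -> linear_subspace M -> linear_subspace (K `&` M).
Proof. by move=> [K0 Kl] [M0 Ml]; split => // a x y [] ? ? [] ? ?; split; [exact: Kl|exact: Ml]. Qed.

Lemma closed_subspaceP M : closed_subspace M <-> closed M /\ linear_subspace M.
Proof. by split=> [[h1 h2 h3]|[h1 [h2 h3]]]; [split|split]. Qed.

Lemma projP K x : closed K -> linear_subspace K ->
  K (P K x) /\ forall h, K h -> '[x - P K x, h] = 0.
Proof.
move=> cK sK; have [y hy] := projection_exists x cK sK.
exact: (@xgetPex _ 0 [set g | K g /\ forall h, K h -> '[x - g, h] = 0] (ex_intro _ y hy)).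
Qed.

Lemma projU K x y : linear_subspace K -> K y -> (forall h, K h -> '[x - y, h] = 0) -> P K x = y.
Proof.
move=> sK Ky yP.
have [] := @xgetPex _ 0 [set g | K g /\ forall h, K h -> '[x - g, h] = 0]
  (ex_intro _ y (conj Ky yP)).
rewrite -/(orthogonal_projection K x); set z := orthogonal_projection K x => Kz zP.
have Kd : K (z - y) by exact: linear_subspaceB.
apply/eqP; rewrite -subr_eq0; apply/eqP/dot_eq0.
rewrite -{1}[z](subrK x) -addrA dotDl yP// addr0.
by rewrite -[z - x]opprB -scaleN1r dotZl zP// mulr0.
Qed.

Lemma hardyP x : hardy x <-> forall n : int, n < 0 -> '[x, e n] = 0.
Proof. by split=> h n n0; have := h n n0; rewrite fourier_coefE. Qed.

Lemma hardyE :
  @hardy R = [set x | forall y, [set e n | n in [set n : int | n < 0]] y -> '[x, y] = 0].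
Proof.
apply/seteqP; split => x /=; first by move=> /hardyP h y [n n0 <-]; exact: h.
by move=> h; apply/hardyP => n n0; apply: h; exists n.
Qed.

Lemma closed_hardy : closed (@hardy R).
Proof. by rewrite hardyE; exact: closed_ortho. Qed.

Lemma linear_subspace_hardy : linear_subspace (@hardy R).
Proof. by rewrite hardyE; exact: linear_subspace_ortho. Qed.

Lemma hardy_e (n : int) : 0 <= n -> hardy (e n).
Proof.
move=> n0; apply/hardyP => m m0; rewrite dot_e; case: eqP => // E.
by move: m0; rewrite -E ltNge n0.
Qed.

Definition antihardy x := forall n : int, 0 <= n -> '[x, e n] = 0.

(** An element of [L2] without Fourier coefficients of nonnegative index is
    orthogonal to the Hardy space: its projection there has no coefficient at all. *)
Lemma antihardy_dot x h : antihardy x -> hardy h -> '[x, h] = 0.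
Proof.
move=> ax hh; have [hP oP] := projP x closed_hardy linear_subspace_hardy.
suff P0 : P (@hardy R) x = 0 by have := oP h hh; rewrite P0 subr0.
apply: coef_inj => n; have [n0|n0] := ltP n 0; first by move/hardyP: hP; exact.
have := oP _ (hardy_e n0); rewrite dotBl ax// sub0r => /eqP; by rewrite oppr_eq0 => /eqP.
Qed.

Lemma hardy_Z (n : int) x : 0 <= n -> hardy x -> hardy (Z n x).
Proof.
move=> n0 /hardyP hx; apply/hardyP => m m0; rewrite coef_Z; apply: hx.
by rewrite subr_lt0; exact: lt_le_trans n0.
Qed.

Lemma coef_mul_e f (k n : int) : multiplier f -> '[mul_L2 f (e k), e n] = '[to_L2 f, e (n - k)].
Proof.
move=> mf; have -> : mul_L2 f (e k) = Z k (to_L2 f); last by rewrite coef_Z.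
by rewrite to_L2_mul// /Z mul_L2C//; [rewrite e_Z /Z; congr (mul_L2 _ (mul_L2 _ _))|exact: multiplier_exprz].
Qed.

(** The adjoint of the multiplication by an analytic [f] maps the functions
    [e n] with [n < 0] to antianalytic ones, which [antihardy_dot] pairs to 0
    with the Hardy space. *)
Lemma hardy_mul f x : multiplier f -> hardy (to_L2 f) -> hardy x -> hardy (mul_L2 f x).
Proof.
move=> mf /hardyP hf hx; apply/hardyP => n n0.
have mfc := multiplier_conj mf.
rewrite mul_adj// dotC antihardy_dot ?rmorph0// => k k0.
rewrite dotC -(mul_adj _ _ mf) coef_mul_e// hf ?rmorph0//.
by rewrite subr_lt0; exact: lt_le_trans k0.
Qed.

Lemma hardy_inner theta x : inner_function theta -> hardy x -> hardy (mul_L2 theta x).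
Proof. by move=> it; apply: hardy_mul; [exact: inner_multiplier|case: it]. Qed.

Lemma multiplier_poly p : multiplier (fun z => p.[z]).
Proof.
elim/poly_ind: p => [|p c IH].
  by apply: multiplier_circle (multiplier_cst 0) => t; rewrite horner0.
apply: multiplier_circle (multiplierD (multiplierM IH (multiplier_id R)) (multiplier_cst c)) => t.
by rewrite !hornerE.
Qed.

Lemma mul_polyE p (m : nat) x : (size p <= m)%N ->
  mul_L2 (fun z => p.[z]) x = \sum_(i < m) p`_i *: Z i x.
Proof.
move=> pm.
have E : forall k, mul_L2 (fun z => \sum_(i < k) p`_i * z ^+ i) x = \sum_(i < k) p`_i *: Z i x /\
    multiplier (fun z => \sum_(i < k) p`_i * z ^+ i).
  elim=> [|k [IH1 IH2]].
    rewrite big_ord0; split.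
      rewrite -(scale0r x) -mul_cst; congr mul_L2; apply/funext => z; exact: big_ord0.
    by apply: multiplier_circle (multiplier_cst 0) => t; rewrite big_ord0.
  have mk : multiplier (fun z => p`_k * z ^+ k).
    by apply: multiplierM; [exact: multiplier_cst|exact/multiplierX/multiplier_id].
  split; last by apply: multiplier_circle (multiplierD IH2 mk) => t; rewrite big_ord_recr.
  rewrite big_ord_recr -IH1 /= /Z -mul_L2Z; last exact: multiplier_exprz.
  rewrite -mul_cst mul_L2M; [|exact: multiplier_exprz|exact: multiplier_cst].
  rewrite -(mul_addf _ IH2); last by apply: multiplierM; [exact: multiplier_exprz|exact: multiplier_cst].
  congr mul_L2; apply/funext => z; rewrite big_ord_recr /=; congr (_ + _); exact: mulrC.
rewrite -(E m).1; congr mul_L2; apply/funext => z; exact: horner_coef_wide.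
Qed.

Lemma coef_mul_poly p (m : nat) x n : (size p <= m)%N ->
  '[mul_L2 (fun z => p.[z]) x, e n] = \sum_(i < m) p`_i * '[x, e (n - i%:Z)].
Proof.
move=> pm; rewrite (mul_polyE _ pm) dot_suml; apply: eq_bigr => i _.
by rewrite dotZl coef_Z.
Qed.

Lemma hardy_poly p x : hardy x -> hardy (mul_L2 (fun z => p.[z]) x).
Proof.
move=> /hardyP hx; apply/hardyP => n n0; rewrite (coef_mul_poly _ _ (leqnn _)) big1// => i _.
rewrite hx ?mulr0//; apply: le_lt_trans n0; rewrite gerBl//.
Qed.

End Hardy.

(** * Blaschke factors and model spaces *)

Section Model.
Variable R : realType.
Local Notation C := R[i].
Local Notation H := (L2 R).
Local Notation "x %:C" := (real_complex R x) : ring_scope.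
Local Notation "''[' x , y ]" := (L2_dot x y) : ring_scope.
Local Notation e := (e R).
Local Notation P := (@orthogonal_projection R).
Implicit Types (x y h : H) (a b c : C) (K M : set H) (f g : C -> C) (p q : {poly C}).

Lemma multiplier_inv f (d : R) : 0 < d -> multiplier f ->
  (forall t, d%:C <= `|f (cis t)|) -> multiplier (fun z => (f z)^-1).
Proof.
move=> d0 [fr fi _] fd.
have mN : measurable_fun setT (fun t => (sqmod (f (cis t)))^-1).
  rewrite /sqmod.
  have mS : measurable_fun setT (fun t => complex.Re (f (cis t)) ^+ 2 + complex.Im (f (cis t)) ^+ 2).
    by apply: measurable_funD; exact: measurable_funX.
  under eq_fun do rewrite -powR_inv1 ?sqmod_ge0//.
  exact: (measurableT_comp (measurable_powR (-1)) mS).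
split.
- rewrite (_ : (fun t => _) = fun t => complex.Re (f (cis t)) * (sqmod (f (cis t)))^-1).
    exact: measurable_funM.
  by apply/funext => t; case: (f (cis t)) => u v.
- rewrite (_ : (fun t => _) = fun t => - complex.Im (f (cis t)) * (sqmod (f (cis t)))^-1).
    by apply: measurable_funM => //; exact: measurableT_comp.
  by apply/funext => t; case: (f (cis t)) => u v; rewrite /= mulNr.
have dC : 0 < d%:C by rewrite ltcR.
exists d^-1; apply: aeW => t; rewrite normfV fmorphV lef_pV2 ?posrE//.
exact: lt_le_trans (fd t).
Qed.

Lemma blaschke_denom_gt0 a z : `|a| < 1 -> `|z| = 1 -> 0 < `|1 - a^* * z|.
Proof.
move=> a1 z1; rewrite normr_gt0 subr_eq0; apply/eqP => E.
have : `|a^* * z| = 1 by rewrite -E normr1.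
by rewrite normrM z1 mulr1 norm_conjC => E2; move: a1; rewrite E2 ltxx.
Qed.

Lemma blaschke_norm a z : `|a| < 1 -> `|z| = 1 -> `|blaschke_factor a z| = 1.
Proof.
move=> a1 z1; have d0 := blaschke_denom_gt0 a1 z1.
rewrite /blaschke_factor normrM normfV.
suff -> : `|z - a| = `|1 - a^* * z| by rewrite divff ?gt_eqF.
have zz : z * z^* = 1 by rewrite -normCK z1 expr1n.
have -> : `|z - a| = `|z^* * (z - a)| by rewrite normrM norm_conjC z1 mul1r.
rewrite -[RHS]norm_conjC; congr `|_|; rewrite rmorphB rmorph1 rmorphM /= conjCK mulrBr.
by rewrite [z^* * z]mulrC zz [a * _]mulrC.
Qed.

Lemma geometric_bound_eq0 (r : R) (c b : C) : r < 1 -> 0 <= r ->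
  (forall k : nat, `|b| <= r%:C ^+ k * c) -> b = 0.
Proof.
move=> r1 r0 h.
have [m hm] : exists m : nat, r ^+ m <= 2^-1.
  have : `|r| < 1 by rewrite ger0_norm.
  move/cvg_expr/cvgrPdist_le => /(_ 2^-1) [|n _ hn]; first by rewrite invr_gt0.
  by exists n; have := hn n (leqnn n); rewrite /= sub0r normrN ger0_norm ?exprn_ge0.
have c0 : 0 <= c by have := h 0%N; rewrite expr0 mul1r; apply: le_trans.
apply: (@geometric_small_eq0 _ c) => n; apply: le_trans (h (m * n)%N) _.
rewrite mulrC ler_wpM2l// exprM -rmorphXn -[2]/(2%:R) -(rmorph_nat (real_complex R)) -fmorphV -!rmorphXn.
by rewrite lecR lerXn2r ?nnegrE ?exprn_ge0 ?invr_ge0.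
Qed.

(** Multiplication by the outer factor [1 - c z] can be undone inside the Hardy
    space: coefficients of negative index would grow geometrically. *)
Lemma hardy_div_outer c x : `|c| < 1 ->
  hardy (mul_L2 (fun z => (1 - c *: 'X : {poly C}).[z]) x) -> hardy x.
Proof.
move=> c1 /hardyP hx; apply/hardyP => n n0.
have step m : m < 0 -> '[x, e m] = c * '[x, e (m - 1)].
  move=> m0; have := hx m m0; rewrite (coef_mul_poly (m := 2)); last first.
    apply: leq_trans (size_polyD _ _) _; rewrite geq_max size_poly1 size_polyN /=.
    by apply: leq_trans (size_scale_leq _ _) _; rewrite size_polyX.
  set q := 1 - _; have q0 : q`_0 = 1 by rewrite /q coefB coef1 coefZ coefX mulr0 subr0.
  have q1 : q`_1 = - c by rewrite /q coefB coef1 coefZ coefX mulr1 sub0r.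
  rewrite big_ord_recl big_ord1 /= q0 q1 mul1r mulNr subr0.
  by move/eqP; rewrite subr_eq0 => /eqP.
have iter k : '[x, e n] = c ^+ k * '[x, e (n - k%:Z)].
  elim: k => [|k IH]; first by rewrite expr0 mul1r subr0.
  rewrite IH step; last by apply: le_lt_trans n0; rewrite gerBl.
  by rewrite mulrA -exprSr -addrA -opprD -[k.+1]addn1 PoszD.
have [r rE] : exists r : R, `|c| = r%:C by exists (complex.Re `|c|); rewrite normc_def.
apply: (@geometric_bound_eq0 r (`|x| * 1)).
- by rewrite -ltcR -rE.
- by rewrite -lecR -rE normr_ge0.
move=> k; rewrite (iter k) normrM normrX rE ler_wpM2l ?exprn_ge0 -?rE//.
apply: le_trans (norm_dot_le _ _) _; rewrite ler_wpM2l//.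
by rewrite L2_normE dot_e eqxx sqrtC1.
Qed.

Lemma multiplier_blaschke a : `|a| < 1 -> multiplier (blaschke_factor a).
Proof.
move=> a1; apply: multiplierM; first by apply: multiplierD; [exact: multiplier_id|exact: multiplier_cst].
have m1 : multiplier (fun z => 1 - a^* * z).
  apply: multiplierD; first exact: multiplier_cst.
  apply: multiplier_circle (multiplierM (multiplier_cst (- a^* )) (multiplier_id R)) => t.
  by rewrite mulNr.
have [r rE] : exists r : R, `|a| = r%:C by exists (complex.Re `|a|); rewrite normc_def.
apply: (@multiplier_inv _ (1 - r)) => //; first by rewrite subr_gt0 -ltcR -rE.
move=> t; rewrite rmorphB /= -rE; apply: le_trans (lerB_dist _ _).
by rewrite normr1 normrM cis_norm mulr1 norm_conjC.
Qed.

Lemma inner_blaschke a : `|a| < 1 -> inner_function (blaschke_factor a).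
Proof.
move=> a1; have mb := multiplier_blaschke a1; split.
- exact: multiplier_square_integrable.
- apply: (@hardy_div_outer a^* ); first by rewrite norm_conjC.
  have -> : mul_L2 (fun z => (1 - a^* *: 'X : {poly C}).[z]) (to_L2 (blaschke_factor a)) =
      mul_L2 (fun z => ('X - a%:P).[z]) (e 0).
    rewrite to_L2_mul// mul_L2M//; last exact: multiplier_poly.
    rewrite (_ : e 0 = to_L2 (fun=> 1)); last by congr to_L2; apply/funext => z; rewrite expr0z.
    apply: mul_ext; [exact/multiplierM/mb/multiplier_poly|exact: multiplier_poly|].
    apply: aeW => t; rewrite !(hornerD, hornerN, hornerZ, hornerX, hornerC) /blaschke_factor [LHS]mulrC divfK//.
    by rewrite -normr_gt0 blaschke_denom_gt0// cis_norm.
  exact/hardy_poly/hardy_e.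
- by apply: aeW => t; rewrite blaschke_norm// cis_norm.
Qed.

Lemma inner_mul f g : inner_function f -> inner_function g -> inner_function (fun z => f z * g z).
Proof.
move=> hf hg; have mf := inner_multiplier hf; have mg := inner_multiplier hg; split.
- exact/multiplier_square_integrable/multiplierM.
- rewrite to_L2_mul; last exact: multiplierM.
  by rewrite -mul_L2M// -to_L2_mul//; apply: hardy_inner => //; case: hg.
- by apply: filterS2 (inner_unimodular hf) (inner_unimodular hg) => t h1 h2; rewrite normrM h1 h2 mulr1.
Qed.

Lemma inner_cst c : `|c| = 1 -> inner_function (fun=> c).
Proof.
move=> c1; split; [exact/multiplier_square_integrable/multiplier_cst| |by apply: aeW].
rewrite to_L2_mul; last exact: multiplier_cst.
rewrite mul_cst; apply: (@linear_subspaceZ R (@hardy R)) => //; first exact: linear_subspace_hardy.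
have := @hardy_e R 0 (lexx _); rewrite (_ : e 0 = to_L2 (fun=> 1))//.
Qed.

Section ModelSpace.
Variable theta : C -> C.
Hypothesis it : inner_function theta.
Let mt := inner_multiplier it.
Let ut := inner_unimodular it.
Local Notation K := (model_space theta).
Local Notation theta' := (fun z => (theta z)^* ).
Let mt' : multiplier theta' := multiplier_conj mt.

Lemma dot_mul_theta x y : '[mul_L2 theta' x, y] = '[x, mul_L2 theta y].
Proof. by rewrite [RHS]dotC (mul_adj y x mt) -dotC. Qed.

(** As [|theta| = 1], being orthogonal to [theta H^2] means that [conj theta x] is
    orthogonal to the Hardy space. *)
Lemma model_spaceP x : K x <-> hardy x /\ antihardy (mul_L2 theta' x).
Proof.
split=> [[hx ox]|[hx ax]]; split=> //.
  by move=> n n0; rewrite dot_mul_theta ox//; exists (e n) => //; exact: hardy_e.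
by move=> _ [h hh <-]; rewrite -dot_mul_theta antihardy_dot.
Qed.

Lemma model_space_hardy x : K x -> hardy x. Proof. by case. Qed.

Lemma model_space_ortho x h : K x -> hardy h -> '[x, mul_L2 theta h] = 0.
Proof. by move=> [_ ox] hh; apply: ox; exists h. Qed.

Lemma closed_model_space : closed K.
Proof.
have -> : K = @hardy R `&` [set x | forall y, (mul_L2 theta @` @hardy R) y -> '[x, y] = 0] by [].
by apply: closedI; [exact: closed_hardy|exact: closed_ortho].
Qed.

Lemma linear_subspace_model_space : linear_subspace K.
Proof. exact: linear_subspaceI (@linear_subspace_hardy R) (linear_subspace_ortho (mul_L2 theta @` @hardy R)). Qed.

Lemma model_projP x : K (P K x) /\ forall h, K h -> '[x - P K x, h] = 0.
Proof. exact: projP closed_model_space linear_subspace_model_space. Qed.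

(** The factor [r] is the projection of [conj theta x] onto the Hardy space; then
    [x - theta r] is orthogonal to [theta H^2]. *)
Lemma hardy_split x : hardy x -> exists2 r, hardy r & x = P K x + mul_L2 theta r.
Proof.
move=> hx; pose r := P (@hardy R) (mul_L2 theta' x).
have [hr orr] := projP (mul_L2 theta' x) (@closed_hardy R) (@linear_subspace_hardy R).
exists r => //; have htr : hardy (mul_L2 theta r) by exact: hardy_inner.
suff -> : P K x = x - mul_L2 theta r by rewrite subrK.
apply: projU; first exact: linear_subspace_model_space.
  split; first exact: linear_subspaceB (@linear_subspace_hardy R) _ _.
  move=> _ [h hh <-]; rewrite -dot_mul_theta mul_L2B// mul_conjK//; exact: orr.
by move=> h Kh; rewrite subKr dotC model_space_ortho ?rmorph0.
Qed.

Variable N : nat.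
Hypothesis N0 : (0 < N)%N.
Local Notation T := (truncated_toeplitz theta (fun z => z ^+ N)).

Lemma toeplitz_K x : K (T x). Proof. exact: (model_projP _).1. Qed.

Lemma toeplitz_dot x y : K y -> '[T x, y] = '[Z N%:Z x, y].
Proof. by move=> Ky; apply/esym/eqP; rewrite -subr_eq0 -dotBl (model_projP _).2. Qed.

(** The discarded part is [theta r] with [r = conj theta (z^N x - T x)]. As
    [conj theta x] and [conj theta T x] are antianalytic, the coefficients of [r]
    stop before index [N]. *)
Lemma toeplitz_split x : K x -> exists2 r, hardy r /\ (forall n : int, N%:Z <= n -> '[r, e n] = 0)
  & Z N%:Z x = T x + mul_L2 theta r.
Proof.
move=> Kx; have [r hr E] := @hardy_split (Z N%:Z x) (@hardy_Z R N%:Z x isT (model_space_hardy Kx)).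
exists r => //; split=> // n Nn.
have -> : r = mul_L2 theta' (Z N%:Z x) - mul_L2 theta' (T x).
  by rewrite -mul_L2B// {1}E addrAC subrr add0r mul_conjK.
rewrite dotBl /Z (mul_L2C _ mt' (multiplier_exprz R N%:Z)) coef_Z.
have /model_spaceP[_ ax] := Kx; have /model_spaceP[_ aT] := toeplitz_K x.
by rewrite ax ?subr_ge0// aT ?subr0//; apply: le_trans Nn.
Qed.

Definition bshift (m : nat) x : H := Z (- m%:Z) (x - \sum_(j < m) '[x, e j%:Z] *: e j%:Z).

Lemma coef_bshift m x (n : int) : hardy x -> '[bshift m x, e n] = if 0 <= n then '[x, e (n + m%:Z)] else 0.
Proof.
move=> /hardyP hx; rewrite coef_Z opprK dotBl dot_suml.
have E (k : int) : \sum_(j < m) '['[x, e j%:Z] *: e j%:Z, e k] =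
    if (0 <= k) && (k < m%:Z) then '[x, e k] else 0.
  under eq_bigr do rewrite dotZl dot_e.
  case: ifPn => [/andP[k0 km]|km].
    case: k k0 km => // k _ km; rewrite (bigD1 (Ordinal (km : (k < m)%N))) //= eqxx mulr1.
    rewrite big1 ?addr0// => j jk; rewrite (_ : (_ == _) = false) ?mulr0//.
    by apply/negbTE; apply: contra jk => /eqP[E]; apply/eqP/val_inj.
  apply: big1 => j _; case: eqP; rewrite ?mulr0// => E; move: km; rewrite -E.
  by rewrite lez_nat ltz_nat ltn_ord.
rewrite E; have [n0|n0] := leP 0 n.
  by rewrite [n + _ < _]ltNge lerDr n0 andbF subr0.
case: ifPn => h; first by rewrite subrr.
rewrite subr0; apply: hx; move: h; rewrite negb_and -ltNge => /orP[//|].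
by rewrite gtrDr n0.
Qed.

Lemma hardy_bshift m x : hardy x -> hardy (bshift m x).
Proof. by move=> hx; apply/hardyP => n n0; rewrite coef_bshift// leNgt n0. Qed.

Lemma bshift_dot m x y : hardy x -> hardy y -> '[Z m%:Z x, y] = '[x, bshift m y].
Proof.
move=> hx hy; rewrite Z_adj; apply/eqP; rewrite -subr_eq0 -dotBr; apply/eqP.
rewrite dotC antihardy_dot ?rmorph0// => n n0.
by rewrite dotBl coef_bshift// n0 coef_Z opprK subrr.
Qed.

(** [theta H^2] is invariant under multiplication by [z^m], of which [bshift m] is
    the adjoint on the Hardy space. *)
Lemma bshift_K m x : K x -> K (bshift m x).
Proof.
move=> Kx; split; first exact/hardy_bshift/model_space_hardy.
move=> _ [h hh <-]; rewrite dotC -bshift_dot; [|exact: hardy_inner|exact: model_space_hardy].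
rewrite /Z (mul_L2C _ (multiplier_exprz R m%:Z) mt) dotC model_space_ortho ?rmorph0 ?conjCK//.
exact: hardy_Z.
Qed.

Lemma toeplitz_adj x y : K x -> K y -> '[T x, y] = '[x, bshift N y].
Proof. by move=> Kx Ky; rewrite toeplitz_dot// bshift_dot//; exact: model_space_hardy. Qed.

End ModelSpace.
End Model.

(** * Composition with a power *)

Section Composition.
Variable R : realType.
Local Notation C := R[i].
Local Notation H := (L2 R).
Local Notation mu := (circle_measure R).
Local Notation "''[' x , y ]" := (L2_dot x y) : ring_scope.
Local Notation e := (e R).
Implicit Types (x y h : H) (a b c : C) (K M : set H) (f g : C -> C) (p q : {poly C}).

Lemma to_L2K x : to_L2 (repr x) = x.
Proof. by rewrite /to_L2 valKd reprK. Qed.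

(** Isometric images of closed subspaces are closed, because [L2] is complete. *)
Lemma closed_isometry_image (J : H -> H) (V : set H) : closed V -> linear_subspace V ->
  (forall a x y, J (a *: x + y) = a *: J x + J y) -> (forall x, `|J x| = `|x|) ->
  closed (J @` V) /\ linear_subspace (J @` V).
Proof.
move=> cV sV Jl Ji.
have JB x y : J (x - y) = J x - J y.
  by rewrite [x - y]addrC -scaleN1r Jl scaleN1r addrC.
have J0 : J 0 = 0 by rewrite -{1}(subrr (0 : H)) JB subrr.
split; last first.
  split; first by exists 0; [exact: sV.1|].
  by move=> a _ _ [x Vx <-] [y Vy <-]; exists (a *: x + y); [exact: sV.2|].
apply: closedP => y u Ju uy.
have [v hv] : {v : nat -> H & forall n, V (v n) /\ J (v n) = u n.+1}.
  by apply: (@choice _ _ (fun n v => V v /\ J v = u n.+1)) => n; have [v Vv <-] := Ju n.+1; exists v.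
have vg n : `|v n.+1 - v n| <= 2^-1 ^+ n.
  rewrite -Ji JB (hv n.+1).2 (hv n).2.
  have -> : u n.+2 - u n.+1 = (y - u n.+1) - (y - u n.+2) by rewrite opprB [RHS]addrC addrA subrK.
  apply: le_trans (ler_normB _ _) _; apply: le_trans (lerD (uy _) (uy _)) _.
  rewrite !exprS -[leRHS]mul1r mulrA -mulrDl; apply: ler_wpM2r; first by rewrite exprn_ge0// invr_ge0.
  rewrite -subr_ge0 (_ : _ - _ = 4^-1); last by field.
  by rewrite invr_ge0.
have [w hw] := L2_complete vg; exists w.
  by apply: (@closed_geometric_lim _ V w v 2) => // n; exact: (hv n).1.
apply/eqP; rewrite -subr_eq0 -normr_eq0; apply/eqP.
apply: (@geometric_small_eq0 _ 3) => n; rewrite normr_id.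
have -> : J w - y = J (w - v n) - (y - u n.+1) by rewrite JB (hv n).2 opprB addrA subrK.
apply: le_trans (ler_normB _ _) _; rewrite Ji.
apply: le_trans (lerD (hw n) (uy _)) _.
rewrite exprS -mulrDl; apply: ler_wpM2r; first by rewrite exprn_ge0// invr_ge0.
rewrite -subr_ge0 (_ : _ - _ = 2^-1); last by field.
by rewrite invr_ge0.
Qed.

Lemma isometry_norm (J : H -> H) : (forall x, '[J x, J x] = '[x, x]) -> forall x, `|J x| = `|x|.
Proof. by move=> h x; rewrite !L2_normE h. Qed.

Variable N : nat.
Hypothesis N0 : (0 < N)%N.

Lemma ae_power_eq f g : f \in @square_integrable R -> g \in @square_integrable R ->
  {ae mu, forall t, f (cis t ^+ N) = g (cis t ^+ N)} <-> {ae mu, forall t, f (cis t) = g (cis t)}.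
Proof.
move=> /square_integrableP[fr fi _] /square_integrableP[gr gi _].
have E z : f z = g z <-> sqmod (f z - g z) = 0.
  rewrite /sqmod cReB cImB; split=> [->|]; first by rewrite !subrr expr0n addr0.
  move/eqP; rewrite paddr_eq0 ?sqr_ge0// !sqrf_eq0 !subr_eq0 => /andP[/eqP h1 /eqP h2].
  by apply/eqP; rewrite eq_complex h1 h2 !eqxx.
have m : measurable_fun setT (fun t => sqmod (f (cis t) - g (cis t))).
  rewrite /sqmod; under eq_fun do rewrite cReB cImB.
  apply: measurable_funD; apply: measurable_funX; first exact: (measurable_funB fr gr).
  exact: (measurable_funB fi gi).
have := @ae_circle_power R (fun z => sqmod (f z - g z)) N N0 m => -[h1 h2].
split=> h.
  by apply: filterS (h1 _) => [t /E //|]; apply: filterS h => t /E.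
by apply: filterS (h2 _) => [t /E //|]; apply: filterS h => t /E.
Qed.

Definition comp x : H := to_L2 (fun z => repr x (z ^+ N)).

Lemma compE x : {ae mu, forall t, repr (comp x) (cis t) = repr x (cis t ^+ N)}.
Proof. by apply: to_L2E; apply: square_integrable_power => //; exact: valP. Qed.

Lemma comp_to_L2 f : f \in @square_integrable R -> comp (to_L2 f) = to_L2 (fun z => f (z ^+ N)).
Proof.
move=> f2; apply/L2_eqP; apply: (ae_mp (compE (to_L2 f))).
apply: (ae_mp (to_L2E (square_integrable_power N0 f2))).
apply: (ae_mp ((ae_power_eq (valP (repr (to_L2 f))) f2).2 (to_L2E f2))).
by apply: aeW => t -> -> ->.
Qed.

Lemma comp_linear a x y : comp (a *: x + y) = a *: comp x + comp y.
Proof.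
have h : (fun z => a * repr x z + repr y z) \in @square_integrable R.
  exact: (valP (a *: repr x + repr y)).
have E : {ae mu, forall t, repr (a *: x + y) (cis t) = a * repr x (cis t) + repr y (cis t)}.
  apply: (ae_mp (reprD (a *: x) y)); apply: (ae_mp (reprZ a x)).
  by apply: aeW => t -> ->.
apply/L2_eqP; apply: (ae_mp (compE (a *: x + y))); apply: (ae_mp (compE x)).
apply: (ae_mp (compE y)); apply: (ae_mp (reprD (a *: comp x) (comp y))).
apply: (ae_mp (reprZ a (comp x))).
apply: (ae_mp ((ae_power_eq (valP (repr (a *: x + y))) h).2 E)).
by apply: aeW => t -> -> -> -> -> ->.
Qed.

Lemma comp_dot x y : '[comp x, comp y] = '[x, y].
Proof.
have [h1 h2] := circle_integral_power N0 (circle_integrable_repr x y).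
rewrite [RHS]dotE -h2; apply: eq_ae_circle_integral => //; first exact: circle_integrable_repr.
by apply: filterS2 (compE x) (compE y) => t -> ->.
Qed.

Lemma multiplier_power f : multiplier f -> multiplier (fun z => f (z ^+ N)).
Proof.
move=> mf; have /square_integrableP[fr fi _] := square_integrable_power N0 (multiplier_square_integrable mf).
split=> //; have [_ _ [K fK]] := mf; exists K.
have [fr' fi' _] := mf.
pose h z : R := Num.max (complex.Re `|f z| - K) 0.
have hE z : h z = 0 <-> `|f z| <= (real_complex R K).
  have [s sE] : exists s : R, `|f z| = real_complex R s.
    by exists (complex.Re `|f z|); rewrite normc_def.
  rewrite /h sE lecR /=; split=> [E|hK].
    have : s - K <= Num.max (s - K) 0 by rewrite le_max lexx.
    by rewrite E subr_le0.
  by apply/max_idPr; rewrite subr_le0.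
have mh : measurable_fun setT (fun t => h (cis t)).
  apply: measurable_maxr => //; apply: measurable_funB => //.
  under eq_fun do rewrite normc_def /=.
  have msq : measurable_fun setT (@Num.sqrt R).
    exact: measurable_realfun.continuous_measurable_fun (@sqrt_continuous R).
  apply: (measurableT_comp msq).
  by apply: measurable_funD; exact: measurable_funX.
have [_ h2] := ae_circle_power N0 mh.
by apply: filterS (h2 _) => [t /hE //|]; apply: filterS fK => t /hE.
Qed.

Lemma unimodular_power f : f \in @square_integrable R ->
  {ae mu, forall t, `|f (cis t ^+ N)| = 1} <-> unimodular f.
Proof.
move=> /square_integrableP[fr fi _].
pose h z : R := sqmod (f z) - 1.
have hE z : h z = 0 <-> `|f z| = 1.
  rewrite normc_def /h -/(sqmod (f z)); split.
    by move/eqP; rewrite subr_eq0 => /eqP ->; rewrite sqrtr1.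
  case=> E; apply/eqP; rewrite subr_eq0; apply/eqP.
  by rewrite -[LHS]sqr_sqrtr ?sqmod_ge0// E expr1n.
have mh : measurable_fun setT (fun t => h (cis t)).
  by apply: measurable_funB => //; apply: measurable_funD; exact: measurable_funX.
have [h1 h2] := ae_circle_power N0 mh.
split=> hu.
  by apply: filterS (h1 _) => [t /hE //|]; apply: filterS hu => t /hE.
by apply: filterS (h2 _) => [t /hE //|]; apply: filterS hu => t /hE.
Qed.

Lemma comp_mul f x : multiplier f -> comp (mul_L2 f x) = mul_L2 (fun z => f (z ^+ N)) (comp x).
Proof.
move=> mf; have h := square_integrableM mf (valP (repr x)).
rewrite {1}/mul_L2 comp_to_L2//; apply/L2_eqP.
apply: (ae_mp (to_L2E (square_integrable_power N0 h))).
apply: (ae_mp (mul_L2E (comp x) (multiplier_power mf))); apply: (ae_mp (compE x)).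
by apply: aeW => t -> -> ->.
Qed.

Lemma comp_Z (n : int) x : comp (Z n x) = Z (n * N%:Z) (comp x).
Proof.
rewrite /Z comp_mul; last exact: multiplier_exprz.
apply: mul_ext; [exact: (multiplier_power (multiplier_exprz R n))|exact: multiplier_exprz|].
by apply: aeW => t; rewrite -exprz_exp exprzAC.
Qed.

Lemma comp_e (n : int) : comp (e n) = e (n * N%:Z).
Proof.
rewrite e_Z comp_Z [in RHS]e_Z; congr Z.
rewrite /e comp_to_L2; last exact/multiplier_square_integrable/multiplier_exprz.
by congr to_L2; apply/funext => z; rewrite !expr0z.
Qed.

(** The range of the isometry [comp N] is closed, and the projection onto it
    represents [y] on that range. *)
Lemma comp_adjoint y : exists w, forall x, '[y, comp x] = '[w, x].
Proof.
have [cI sI] : closed (comp @` setT) /\ linear_subspace (comp @` setT).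
  apply: closed_isometry_image; [exact: closedT|by split|exact: comp_linear|].
  by apply: isometry_norm => x; exact: comp_dot.
have [[w _ wE] oP] := projP y cI sI.
exists w => x; rewrite -[RHS]comp_dot wE; apply/eqP; rewrite -subr_eq0 -dotBl; apply/eqP/oP.
by exists x.
Qed.

(** The representative given by [comp_adjoint] has no Fourier coefficient. This
    avoids expanding elements of [L2] in Fourier series. *)
Lemma comp_ortho y x : (forall k : int, '[y, e (k * N%:Z)] = 0) -> '[y, comp x] = 0.
Proof.
move=> y0; have [w hw] := comp_adjoint y.
suff w0 : w = 0 by rewrite hw w0 dot0l.
by apply: coef_inj => n; rewrite -hw comp_e.
Qed.

Lemma comp_coef x (k j : int) : 0 <= j < N%:Z ->
  '[comp x, e (k * N%:Z + j)] = if j == 0 then '[x, e k] else 0.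
Proof.
move=> jN; case: eqP => [->|j0]; first by rewrite addr0 -comp_e comp_dot.
rewrite dotC comp_ortho ?rmorph0// => m; rewrite dot_e.
case: eqP => // E; exfalso; apply: j0.
have E2 : j = (m - k) * N%:Z by rewrite mulrBl -E addrAC subrr add0r.
case/andP: jN; rewrite E2 => h1 h2.
have N0' : 0 < N%:Z by rewrite ltz_nat.
move: h1; rewrite pmulr_lge0// => h1.
move: h2; rewrite -[X in _ < X]mul1r ltr_pM2r// => h2.
by have -> : m - k = 0; [lia|rewrite mul0r].
Qed.

End Composition.

(** * Lifting functions by a polynomial *)

Section PolyLift.
Variable R : realType.
Local Notation C := R[i].
Local Notation H := (L2 R).
Local Notation mu := (circle_measure R).
Local Notation "''[' x , y ]" := (L2_dot x y) : ring_scope.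
Local Notation e := (e R).
Implicit Types (x y h : H) (a b c : C) (K M : set H) (f g : C -> C) (p q : {poly C}).
Variable N : nat.
Hypothesis N0 : (0 < N)%N.

Lemma residue_ge0 (k : int) (j : 'I_N) : (0 <= k * N%:Z + j%:Z) = (0 <= k).
Proof.
apply/idP/idP => [n0|k0]; last by rewrite addr_ge0// mulr_ge0.
rewrite leNgt; apply/negP => k0; move: n0; rewrite leNgt => /negP; apply.
have : k * N%:Z <= - 1 * N%:Z by rewrite ler_pM2r ?ltz_nat//; lia.
by have := ltn_ord j; move: (k * N%:Z) => w; lia.
Qed.

Lemma residueP (n : int) : exists (k : int) (j : 'I_N), n = k * N%:Z + j%:Z.
Proof.
have N0' : 0 < N%:Z by rewrite ltz_nat.
have h0 := modz_ge0 n (lt0r_neq0 N0'); have hN := ltz_pmod n N0'.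
exists (n %/ N%:Z)%Z; case Ej : (n %% N%:Z)%Z h0 hN => [j|//] _ jN.
by exists (Ordinal (jN : (j < N)%N)); rewrite /= -Ej -divz_eq.
Qed.

Lemma coef_ext_mod x y :
  (forall (k : int) (j : 'I_N), '[x, e (k * N%:Z + j%:Z)] = '[y, e (k * N%:Z + j%:Z)]) -> x = y.
Proof.
by move=> h; apply: coef_ext => n; have [k [j ->]] := residueP n; exact: h.
Qed.

Lemma comp_Z_dot x y (i j : 'I_N) :
  '[Z i%:Z (comp N x), Z j%:Z (comp N y)] = if i == j then '[x, y] else 0.
Proof.
case: eqP => [->|/eqP ij].
  by rewrite Z_adj ZM addNr Z0 comp_dot.
rewrite dotC Z_adj dotC conjCK ZM [X in '[X, _]](_ : _ = Z (i%:Z - j%:Z) (comp N x)); last first.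
  by rewrite addrC.
apply: comp_ortho => // k; rewrite coef_Z.
have [ji|ji] := leqP i j.
  rewrite (_ : _ - _ = k * N%:Z + (j%:Z - i%:Z)); last by rewrite opprB addrA.
  rewrite comp_coef//; last by have := ltn_ord j; lia.
  by case: eqP => // E; case/eqP: ij; apply: val_inj => /=; lia.
rewrite (_ : _ - _ = (k - 1) * N%:Z + (N%:Z + j%:Z - i%:Z)); last by ring.
rewrite comp_coef//; last by have := ltn_ord i; lia.
by case: eqP => // E; have := ltn_ord i; lia.
Qed.

(** For [q] of degree less than [N], the coefficients of [q(z) x(z^N)] of index
    [k N + j] are those of [x] of index [k] times [q_j]: the terms of [q] occupy
    different residue classes, and the map is a multiple of an isometry. *)
Definition lift q x : H := mul_L2 (fun z => q.[z]) (comp N x).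

Lemma lift_linear q a x y : lift q (a *: x + y) = a *: lift q x + lift q y.
Proof. by rewrite /lift comp_linear// mul_linear//; exact: multiplier_poly. Qed.

Lemma lift_coef q x (k : int) (j : 'I_N) : (size q <= N)%N ->
  '[lift q x, e (k * N%:Z + j%:Z)] = q`_j * '[x, e k].
Proof.
move=> qN; rewrite (coef_mul_poly _ _ qN) (bigD1 j)//= addrK -comp_e// comp_dot//.
rewrite big1 ?addr0// => i ij.
suff -> : '[comp N x, e (k * N%:Z + j%:Z - i%:Z)] = 0 by rewrite mulr0.
have [ji|ji] := leqP i j.
  rewrite -addrA comp_coef//; last by have := ltn_ord j; lia.
  by case: eqP => // E; case/eqP: ij; apply: val_inj => /=; lia.
rewrite (_ : _ - _ = (k - 1) * N%:Z + (N%:Z + j%:Z - i%:Z)); last by ring.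
rewrite comp_coef//; last by have := ltn_ord i; lia.
by case: eqP => // E; have := ltn_ord i; lia.
Qed.

Definition poly_norm2 q : C := \sum_(i < N) `|q`_i| ^+ 2.

Lemma lift_dot q x y : (size q <= N)%N -> '[lift q x, lift q y] = poly_norm2 q * '[x, y].
Proof.
move=> qN; rewrite /lift !(mul_polyE _ qN) dot_suml big_distrl /=; apply: eq_bigr => i _.
rewrite dot_sumr (bigD1 i)//= !(dotZl, dotZr) comp_Z_dot eqxx mulrA -normCK big1 ?addr0// => j ji.
by rewrite !(dotZl, dotZr) comp_Z_dot eq_sym (negbTE ji) !mulr0.
Qed.

Lemma poly_norm2_gt0 q : (size q <= N)%N -> q != 0 -> 0 < poly_norm2 q.
Proof.
move=> qN q0; rewrite lt_def sumr_ge0 ?andbT => [|i _]; last exact: exprn_ge0.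
apply: contra q0 => /eqP E; apply/eqP/polyP => i; rewrite coef0.
have [iN|iN] := ltnP i N; last by rewrite nth_default//; exact: leq_trans qN iN.
have /psumr_eq0P/(_ E)/(_ (Ordinal iN) isT) : forall i : 'I_N, true -> 0 <= `|q`_i| ^+ 2.
  by move=> j _; exact: exprn_ge0.
by move/eqP; rewrite sqrf_eq0 normr_eq0 => /eqP.
Qed.

Lemma lift_Z q (n : int) x : lift q (Z n x) = Z (n * N%:Z) (lift q x).
Proof. by rewrite /lift comp_Z// /Z mul_L2C//; [exact: multiplier_poly|exact: multiplier_exprz]. Qed.

Lemma lift_e0 q : lift q (e 0) = to_L2 (fun z => q.[z]).
Proof.
rewrite /lift comp_e// mul0r to_L2_mul; last exact: multiplier_poly.
by congr (mul_L2 _ _); congr to_L2; apply/funext => z; rewrite expr0z.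
Qed.

(** The hypothesis says that [theta p = q f(z^N)] with [f] in [L2]. Since
    [|theta| = 1], the coefficients ['[z^(n N) theta p, theta p]] are those of [p]
    alone and vanish for [n <> 0]; the same numbers are multiples of the Fourier
    coefficients of [|f|^2], which is therefore constant. *)
Lemma inner_factor theta p q (phi : int -> C) : inner_function theta ->
  (size p <= N)%N -> p != 0 -> (size q <= N)%N -> q != 0 ->
  (forall (k : int) (j : 'I_N), '[mul_L2 theta (to_L2 (fun z => p.[z])), e (k * N%:Z + j%:Z)] = phi k * q`_j) ->
  exists u q', [/\ inner_function u, (size q' <= N)%N, q' != 0 &
    {ae mu, forall t, theta (cis t) * p.[cis t] = q'.[cis t] * u (cis t ^+ N)}].
Proof.
move=> it pN p0 qN q0 hphi; have mt := inner_multiplier it; have ut := inner_unimodular it.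
set y := mul_L2 theta _ in hphi.
have [j qj] : exists j : 'I_N, q`_j != 0.
  have h : ((size q).-1 < N)%N by rewrite prednK ?size_poly_gt0.
  by exists (Ordinal h); rewrite /= -lead_coefE lead_coef_eq0.
have [w hw] := comp_adjoint N0 (Z (- j%:Z) y).
have wE k : '[w, e k] = phi k * q`_j.
  by rewrite -hw comp_e// coef_Z opprK hphi.
pose f := (q`_j)^-1 *: w.
have fE k : '[f, e k] = phi k by rewrite dotZl wE mulrC mulfK.
have yE : y = lift q f.
  by apply: coef_ext_mod => k i; rewrite hphi lift_coef// fE mulrC.
pose c := poly_norm2 p / poly_norm2 q.
have np := poly_norm2_gt0 pN p0; have nq := poly_norm2_gt0 qN q0.
have c0 : 0 < c by exact: divr_gt0.
have ffn (n : int) : '[Z n f, f] = c * (n == 0)%:R.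
  have : '[Z (n * N%:Z) y, y] = poly_norm2 q * '[Z n f, f] by rewrite yE -lift_Z lift_dot.
  rewrite /y -lift_e0 /Z mul_L2C//; last exact: multiplier_exprz.
  rewrite mul_isometry// -/(Z _ _) -lift_Z lift_dot// Ze addr0 dot_e => E.
  by rewrite /c mulrAC E mulrC mulKf// gt_eqF.
have f1 : {ae mu, forall t, repr f (cis t) * (repr f (cis t))^* = c}.
  have ic : circle_integrable (fun z => repr f z * (repr f z)^* + (- c)).
    have [h1 h2] := circle_integrable_repr f f.
    have [h3 h4] := circle_integrable_multiplier (multiplier_cst (- c)).
    split.
      by apply: eq_integrable (integrableD measurableT h1 h3) => // t _; rewrite /= cReD.
    by apply: eq_integrable (integrableD measurableT h2 h4) => // t _; rewrite /= cImD.
  have : {ae mu, forall t, repr f (cis t) * (repr f (cis t))^* + (- c) = 0}.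
    apply: (@fourier_uniqueness R (fun z => repr f z * (repr f z)^* + - c)) => // n.
    have im := circle_integrableM (multiplier_exprz R n) (circle_integrable_repr f f).
    have iz := circle_integrable_multiplier (multiplier_exprz R n).
    rewrite (@circle_integral_eq _ _ (fun z => (- c) * z ^ n + z ^ n * (repr f z * (repr f z)^* ))); last first.
      by move=> t; ring.
    rewrite circle_integral_linear// circle_integral_exprz.
    rewrite [X in _ + X](_ : _ = '[Z n f, f]).
      by rewrite ffn mulNr addNr.
    apply: eq_ae_circle_integral => //; first exact: circle_integrable_repr.
    by apply: filterS (mul_L2E f (multiplier_exprz R n)) => t; rewrite -/(Z n f) => ->; rewrite mulrA.
  by apply: filterS => t /eqP; rewrite subr_eq0 => /eqP.
pose s := sqrtC c; have s0 : 0 < s by rewrite sqrtC_gt0.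
have f1' : {ae mu, forall t, `|repr f (cis t)| = s}.
  by apply: filterS f1 => t; rewrite -normCK => E; rewrite /s -E sqrCK.
pose g := s^-1 *: f.
have gs := reprZ s^-1 f; rewrite -/g in gs.
exists (repr g), (s *: q); split.
- split; first exact: valP.
    rewrite to_L2K; apply/hardyP => n n0.
    rewrite /g /f !dotZl -hw comp_e// coef_Z opprK.
    have /hardyP hy : hardy y.
      apply: hardy_inner => //; rewrite to_L2_mul; last exact: multiplier_poly.
      apply: hardy_poly; have := @hardy_e R 0 (lexx _).
      by rewrite /e (_ : (fun z => _) = fun=> 1)//; apply/funext => z; rewrite expr0z.
    by rewrite hy ?mulr0// ltNge residue_ge0 -ltNge.
  apply: filterS2 f1' gs => t h1 h2; rewrite h2 normrM h1 normfV gtr0_norm// mulVf// gt_eqF//.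
- by apply: leq_trans (size_scale_leq _ _) qN.
- by rewrite scaler_eq0 gt_eqF.
have ypt : {ae mu, forall t, repr y (cis t) = theta (cis t) * p.[cis t]}.
  apply: (ae_mp (mul_L2E (to_L2 (fun z => p.[z])) mt)).
  apply: (ae_mp (to_L2E (multiplier_square_integrable (multiplier_poly p)))).
  by apply: aeW => t -> ->.
have h2 : (fun z => s^-1 * repr f z) \in @square_integrable R by exact: (valP (s^-1 *: repr f)).
have gsN := (ae_power_eq N0 (valP (repr g)) h2).2 gs.
apply: (ae_mp ypt); apply: (ae_mp gsN).
apply: (ae_mp (mul_L2E (comp N f) (multiplier_poly q))); apply: (ae_mp (compE N0 f)).
apply: aeW => t h3 h4 h5 h6; rewrite -h6 yE /lift h4 h3 h5 hornerZ.
by rewrite mulrACA mulfV ?gt_eqF// mul1r.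
Qed.
End PolyLift.

(** * From rank-one defects to a polynomial identity *)

Section RankOne.
Variable R : realType.
Local Notation C := R[i].
Local Notation H := (L2 R).
Local Notation "''[' x , y ]" := (L2_dot x y) : ring_scope.
Local Notation e := (e R).
Implicit Types (x y h : H) (a b c : C) (K M : set H) (f g : C -> C) (p q : {poly C}).

Lemma adjoint_onU M (T : H -> H) x y : linear_subspace M -> M y ->
  (forall z, M z -> '[T z, x] = '[z, y]) -> adjoint_on M T x = y.
Proof.
move=> sM My yP.
have [] := @xgetPex _ 0 [set y | M y /\ forall z, M z -> '[T z, x] = '[z, y]] (ex_intro _ y (conj My yP)).
rewrite -/(adjoint_on M T x); set w := adjoint_on M T x => Mw wP.
have Mwy : M (w - y) by exact: linear_subspaceB.
apply/eqP; rewrite -subr_eq0; apply/eqP/dot_eq0.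
by rewrite dotBr -wP// -yP// subrr.
Qed.

Lemma closure0 (S : set H) x : S `<=` [set 0] -> closure S x -> x = 0.
Proof.
move=> S0 cx; apply: contrapT => /eqP x0.
have n0 : 0 < `|x| by rewrite normr_gt0.
have [y [/S0 -> ]] := cx _ (nbhsx_ballx x _ n0).
by rewrite -ball_normE /= subr0 ltxx.
Qed.

(** Polarization: the numbers ['[D (a x + y), a x + y]] are real for [a = 1] and
    [a = 'i], which is what a complex space has over a real one. *)
Lemma positive_symmetric M (D : H -> H) : linear_subspace M -> linear_on M D ->
  (forall x, M x -> 0 <= '[D x, x]) ->
  forall x y, M x -> M y -> '[D x, y] = '[x, D y].
Proof.
move=> sM Dl Dp x y Mx My.
have r z : M z -> '[D z, z]^* = '[D z, z].
  by move=> /Dp h; apply/CrealP; exact: ger0_real.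
have DD a : D (a *: x + y) = a *: D x + D y by apply: Dl.
have ra a : (a * '[D x, y] + a^* * '[D y, x])^* = a * '[D x, y] + a^* * '[D y, x].
  have := r _ (sM.2 a x y Mx My); rewrite DD !(dotDl, dotDr, dotZl, dotZr).
  have := r _ Mx; have := r _ My; move: ('[D x, x]) ('[D y, y]) ('[D x, y]) ('[D y, x]) => xx yy xy yx hy hx.
  rewrite !rmorphD !rmorphM /= !rmorphD !rmorphM /= hx hy conjCK => /eqP.
  rewrite -subr_eq0 => /eqP h; apply/eqP; rewrite -subr_eq0 -h; apply/eqP; ring.
have h1 := ra 1; have hi := ra 'i.
rewrite [RHS]dotC.
move: h1 hi; move: ('[D x, y]) ('[D y, x]) => u v.
rewrite !rmorphD !rmorphM /= !conjCK rmorph1 !mul1r conjCi => h1.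
rewrite mulNr mulNr => hi.
have {}hi : 'i * (- u^* + v^* ) = 'i * (u - v) by rewrite mulrBr -hi; ring.
have {}hi := mulfI (neq0Ci _) hi.
have : u *+ 2 = v^* *+ 2.
  have -> : u *+ 2 = (u + v) + (u - v) by ring.
  rewrite -h1 -hi; ring.
by move/eqP; rewrite -subr_eq0 -mulrnBl mulrn_eq0 /= subr_eq0 => /eqP.
Qed.

(** The range of the square root [D] is dense in a line, hence contained in it, and
    [D] is symmetric: so [D x] is a multiple of ['[x, v] v] for a vector [v] of the
    range. If the defect operator were only a default value, it would be 0 and its
    range would not have dimension 1. *)
Lemma rank_one_defect M (T : H -> H) : linear_subspace M -> has_dim (defect_space M T) 1 ->
  exists v l, [/\ M v, v != 0, l != 0 &
    forall x, M x -> x - adjoint_on M T (T x) = (l * '[x, v]) *: v].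
Proof.
move=> sM [b [bS bf bg]]; set b0 := b ord0.
have b00 : b0 != 0.
  apply/eqP => E; have s0 : \sum_(i < 1) 1 *: b i = 0 by rewrite big_ord1 scale1r.
  by have /eqP := bf (fun=> 1) s0 ord0; rewrite oner_eq0.
set D := defect_operator M T; have DM x : M x -> exists a, D x = a *: b0.
  move=> Mx; have [|c ->] := bg (D x); first by apply: subset_closure; exists x.
  by exists (c ord0); rewrite big_ord1.
have [x0 [Mx0 Dx0]] : exists x0, M x0 /\ D x0 != 0.
  apply: contrapT => h; case/eqP: b00; apply: (@closure0 (D @` M)); last exact: (bS ord0).
  move=> _ [x Mx <-]; apply: contrapT => /eqP Dx; by apply: h; exists x.
have [Di Dl _ Dp DD] : positive_sqrt_on M (fun x => x - adjoint_on M T (T x)) D.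
  have [[D' hD']|nD] := EM (exists D', positive_sqrt_on M (fun x => x - adjoint_on M T (T x)) D').
    exact: (@xgetPex _ (fun=> 0 : H) [set D | positive_sqrt_on M (fun x => x - adjoint_on M T (T x)) D]
      (ex_intro _ D' hD')).
  have D0 : D = fun=> 0.
    by rewrite /D /defect_operator; case: xgetP => // D' _ hD'; case: nD; exists D'.
  by move: Dx0; rewrite D0 eqxx.
have Ds := positive_symmetric sM Dl Dp.
set v := D x0 in Dx0; have Mv : M v by exact: Di.
have Dv x : M x -> exists a, D x = a *: v.
  move=> Mx; have [a ->] := DM x Mx; have [b' E] := DM x0 Mx0.
  have b'0 : b' != 0 by apply: contra_neq Dx0; rewrite /v E => ->; rewrite scale0r.
  by exists (a / b'); rewrite /v E scalerA divfK.
have [m mE] := Dv v Mv; have vv : 0 < '[v, v] := L2_dot_gt0 Dx0.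
have m0 : m != 0.
  apply: contraNneq Dx0 => m0; apply/eqP/dot_eq0.
  by rewrite {2}/v -Ds// mE m0 scale0r dot0l.
exists v, (m^* * m / '[v, v]); split => //.
  by rewrite !mulf_neq0 ?conjC_eq0 ?invr_neq0// gt_eqF.
move=> x Mx; rewrite -DD//; have [a aE] := Dv x Mx.
have : '[D x, v] = m^* * '[x, v] by rewrite Ds// mE dotZr.
rewrite aE dotZl => E.
have {}E : a = m^* * '[x, v] / '[v, v] by rewrite -E mulfK// gt_eqF.
have Dlin c : D (c *: v) = c *: D v.
  have D0 : D 0 = 0.
    have := Dl (-1) 0 0 sM.1 sM.1; rewrite scaler0 addr0 scaleN1r addNr; done.
  by rewrite -[c *: v]addr0 (Dl c v 0 Mv sM.1) D0 addr0.
rewrite Dlin mE scalerA E; congr (_ *: _); ring.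
Qed.

Lemma bshift_norm (m : nat) x : hardy x ->
  '[x, x] = \sum_(j < m) `|'[x, e j%:Z]| ^+ 2 + '[bshift m x, bshift m x].
Proof.
move=> hx; have hb := hardy_bshift m hx.
have xE : x = \sum_(j < m) '[x, e j%:Z] *: e j%:Z + Z m%:Z (bshift m x).
  by rewrite /bshift ZM subrr Z0 addrC subrK.
rewrite {2}xE dotDr dot_sumr; congr (_ + _).
  by apply: eq_bigr => j _; rewrite dotZr mulrC normCK.
by rewrite dotC bshift_dot// -dotC.
Qed.

Lemma poly_of_coef (N : nat) x (q := \poly_(j < N) '[x, e j%:Z]) : (0 < N)%N ->
  (forall n : int, n < 0 -> '[x, e n] = 0) -> (forall n : int, N%:Z <= n -> '[x, e n] = 0) ->
  to_L2 (fun z => q.[z]) = x.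
Proof.
move=> N0 x0 xN; rewrite -(lift_e0 N0); apply: (coef_ext_mod N0) => k j.
rewrite lift_coef ?size_poly// dot_e coef_poly ltn_ord.
case: eqP => [<-|/eqP k0]; first by rewrite mulr1 mul0r add0r.
rewrite mulr0; have [kn|kp] := ltP k 0.
  by rewrite x0// ltNge residue_ge0// -ltNge.
rewrite xN//; have : 1 * N%:Z <= k * N%:Z by rewrite ler_pM2r ?ltz_nat//; lia.
by move: (k * N%:Z) => u; lia.
Qed.

Section Reducing.
Variables (N : nat) (theta : C -> C).
Hypotheses (N0 : (0 < N)%N) (it : inner_function theta).
Local Notation K := (model_space theta).
Local Notation T := (truncated_toeplitz theta (fun z => z ^+ N)).
Variable M : set H.
Hypotheses (redM : reducing K T M) (defM : has_defects M T 1).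

Let cM : closed M. Proof. by have [/closed_subspaceP[]] := redM. Qed.
Let sM : linear_subspace M. Proof. by have [/closed_subspaceP[]] := redM. Qed.
Let MK x : M x -> K x. Proof. by have [_ h _ _] := redM; exact: h. Qed.
Let MT x : M x -> M (T x). Proof. by have [_ _ h _] := redM; exact: h. Qed.
Let Mh x : M x -> hardy x. Proof. by move=> /MK; exact: model_space_hardy. Qed.

(** Projecting [bshift x] onto [M] leaves a vector [d] of the complement of [M],
    which is invariant, so that ['[d, d] = '[T d, x] = 0]. *)
Lemma reducing_bshift x : M x -> M (bshift N x).
Proof.
move=> Mx; have KS := bshift_K it N (MK Mx).
have [Mp op] := projP (bshift N x) cM sM; set w := orthogonal_projection M _ in Mp op.
have Kd : K (bshift N x - w) by apply: linear_subspaceB (linear_subspace_model_space theta) KS (MK Mp).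
have [_ _ _ inv] := redM.
have [_ Td] := inv _ (conj Kd op).
have z0 : '[bshift N x - w, bshift N x - w] = 0.
  rewrite dotBr (op w Mp) subr0 -(@toeplitz_adj R theta)//; last exact: MK.
  exact: Td.
by have /eqP := dot_eq0 z0; rewrite subr_eq0 => /eqP ->.
Qed.

Lemma reducing_adjoint x : M x -> adjoint_on M T x = bshift N x.
Proof.
move=> Mx; apply: adjoint_onU => //; first exact: reducing_bshift.
by move=> z Mz; rewrite toeplitz_adj//; exact: MK.
Qed.

Lemma reducing_adjointK x : M x -> adjoint_on M (adjoint_on M T) x = T x.
Proof.
move=> Mx; apply: adjoint_onU => //; first exact: MT.
move=> z Mz; rewrite reducing_adjoint// dotC -(@toeplitz_adj R theta)//; [|exact: MK..].
by rewrite -dotC.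
Qed.

(** Let [w] span the range of [I - T T^*] on [M], where [T^*] is [bshift N]. A
    vector [y] of [M] orthogonal to [w] satisfies [T (bshift y) = y], so [bshift]
    preserves its norm and its coefficients of index below [N] vanish. Hence the
    first [N] coefficients of any element of [M] are proportional to those of [w],
    which form [q], and shifting gives the same for every block of [N]
    coefficients. If [v] spans the range of [I - T^* T], the identity
    [z^N v = T v + theta p] transfers this to [theta p]; here [p = 0] is
    impossible, since then [T] would preserve the norm of [v]. *)
Lemma reducing_factor : exists p q u, [/\ inner_function u,
  (size p <= N)%N /\ p != 0, (size q <= N)%N /\ q != 0 &
  {ae circle_measure R, forall t, theta (cis t) * p.[cis t] = q.[cis t] * u (cis t ^+ N)}].
Proof.
have [d1 d2] := defM.
have [v [l [Mv v0 l0 vP]]] := rank_one_defect sM d1.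
have [w [m [Mw w0 m0 wP]]] := rank_one_defect sM d2.
have {}vP x : M x -> x - bshift N (T x) = (l * '[x, v]) *: v.
  by move=> Mx; rewrite -vP// reducing_adjoint//; exact: MT.
have {}wP x : M x -> x - T (bshift N x) = (m * '[x, w]) *: w.
  move=> Mx; rewrite -wP// reducing_adjoint// reducing_adjointK//; exact: reducing_bshift.
have vv : 0 < '[v, v] := L2_dot_gt0 v0; have ww : 0 < '[w, w] := L2_dot_gt0 w0.
have TS x : M x -> '[T (bshift N x), x] = '[bshift N x, bshift N x].
  by move=> Mx; rewrite toeplitz_adj//; apply: MK => //; exact: reducing_bshift.
pose q := \poly_(j < N) '[w, e j%:Z].
have qE (j : 'I_N) : q`_j = '[w, e j%:Z] by rewrite coef_poly ltn_ord.
pose c x := '[x, w] / '[w, w].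
have low x (j : 'I_N) : M x -> '[x, e j%:Z] = c x * q`_j.
  move=> Mx; pose y := x - c x *: w.
  have My : M y by apply: linear_subspaceB => //; exact: linear_subspaceZ.
  have yw : '[y, w] = 0 by rewrite dotBl dotZl divfK ?subrr// gt_eqF.
  have TSy : T (bshift N y) = y.
    by apply/esym/eqP; rewrite -subr_eq0 wP// yw mulr0 scale0r.
  have := bshift_norm N (Mh My); rewrite -TS// TSy => /eqP.
  rewrite -subr_eq0 opprD addrCA subrr addr0 oppr_eq0 => /eqP s0.
  have /psumr_eq0P/(_ s0)/(_ j isT) : forall i : 'I_N, true -> 0 <= `|'[y, e i%:Z]| ^+ 2.
    by move=> i _; exact: exprn_ge0.
  move/eqP; rewrite sqrf_eq0 normr_eq0 dotBl dotZl subr_eq0 => /eqP ->.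
  by rewrite qE.
have q0 : q != 0.
  apply/eqP => q0; have := bshift_norm N (Mh Mw); rewrite big1 => [|j _]; last first.
    by rewrite -qE q0 coef0 normr0 expr0n.
  rewrite add0r -TS// => E.
  have : '[w - T (bshift N w), w] = 0 by rewrite dotBl -E subrr.
  rewrite wP// dotZl => /eqP; by rewrite !mulf_eq0 (negbTE m0) gt_eqF.
pose phi x (k : int) := if k is Posz n then c (iter n (bshift N) x) else 0.
have neg k (j : 'I_N) : k < 0 -> k * N%:Z + j%:Z < 0.
  by rewrite !ltNge residue_ge0.
have colin x (k : int) (j : 'I_N) : M x -> '[x, e (k * N%:Z + j%:Z)] = phi x k * q`_j.
  case: k => [n|n] Mx; last first.
    by rewrite /phi mul0r; have /hardyP := Mh Mx; apply; exact: neg.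
  elim: n x Mx => [|n IH] x Mx; first by rewrite mul0r add0r low.
  have := IH _ (reducing_bshift Mx); rewrite coef_bshift; last exact: Mh.
  have -> : 0 <= n%:Z * N%:Z + j%:Z by rewrite addr_ge0// mulr_ge0.
  rewrite /phi iterSr => <-.
  by congr ('[_, e _]); rewrite -addn1 PoszD; ring.
have [r [hr rN] rE] := toeplitz_split it N (MK Mv).
have r0 : r != 0.
  apply/eqP => r0; move: rE; rewrite r0 mul_0 ?addr0 => [E|]; last exact: inner_multiplier.
  have h : '[T v, T v] = '[v, v] by rewrite -E Z_adj ZM addNr Z0.
  have : '[v - bshift N (T v), v] = 0.
    rewrite dotBl [X in _ - X]dotC -(@toeplitz_adj R theta)//; [|exact: MK|exact/MK/MT].
    by rewrite -dotC h subrr.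
  rewrite vP// dotZl => /eqP; by rewrite !mulf_eq0 (negbTE l0) gt_eqF.
pose p := \poly_(j < N) '[r, e j%:Z].
have pE : to_L2 (fun z => p.[z]) = r by apply: poly_of_coef => //; exact/hardyP.
have p0 : p != 0.
  apply/eqP => p0; move: r0; rewrite -pE p0 (_ : (fun z => _) = fun=> 0); last first.
    by apply/funext => z; rewrite horner0.
  by rewrite to_L2_mul ?mul_cst ?scale0r ?eqxx//; exact: multiplier_cst.
have [] := @inner_factor R N N0 theta p q (fun k => phi v (k - 1) - phi (T v) k) it (size_poly _ _) p0 (size_poly _ _) q0.
  move=> k j; rewrite pE mulrBl -!colin//; last exact: MT.
  rewrite (_ : mul_L2 theta r = Z N%:Z v - T v); last by rewrite rE addrAC subrr add0r.
  rewrite dotBl coef_Z; congr ('[_, e _] - _); ring.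
move=> u [q' [iu q'N q'0 E]]; exists p, q', u; split => //; split => //; exact: size_poly.
Qed.
End Reducing.
End RankOne.

(** * Reflected zeros and divisibility by Blaschke factors *)

Section Algebra.
Variable R : realType.
Local Notation C := R[i].
Local Notation H := (L2 R).
Local Notation mu := (circle_measure R).
Implicit Types (x y h : H) (a b c : C) (f g : C -> C) (p q : {poly C}).

Lemma cos_eq1 (x : R) : cos x = 1 -> - (2 * pi) < x < 2 * pi -> x = 0.
Proof.
move=> cx /andP[x1 x2].
have s0 : sin (x / 2) = 0.
  have E : x = (x / 2) *+ 2 by rewrite mulr2n; field.
  move: cx; rewrite {1}E cos_mulr2n cos2sin2 => h.
  have : sin (x / 2) ^+ 2 = 0 by move: h; rewrite mulr2n; lra.
  by move/eqP; rewrite sqrf_eq0 => /eqP.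
have [xn|xp|//] := ltgtP x 0.
  have : 0 < sin (- (x / 2)) by apply: sin_gt0_pi; apply/andP; split; lra.
  by rewrite sinN s0 oppr0 ltxx.
have : 0 < sin (x / 2) by apply: sin_gt0_pi; apply/andP; split; lra.
by rewrite s0 ltxx.
Qed.

Lemma cis_ae_neq (w : C) : {ae mu, forall t, cis t != w}.
Proof.
have [[t0 [t00 t0w]]|nt0] := EM (exists t0, 0 < t0 < 2 * pi /\ cis t0 = w); last first.
  by apply: filterS (circle_measure_itv R) => t tt; apply/eqP => tw; apply: nt0; exists t.
apply: filterS2 (circle_measure_itv R) (circle_measure_neq t0) => t tt tn; apply: contra_neq tn => tw.
apply/eqP; rewrite -subr_eq0; apply/eqP/cos_eq1; last by apply/andP; split; lra.
have : cis (t - t0) = 1.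
  by rewrite cisD -conj_cis -cisV tw t0w divff// -t0w cis_neq0.
by case.
Qed.

Lemma poly_ae_neq0 p : p != 0 -> {ae mu, forall t, p.[cis t] != 0}.
Proof.
move=> p0; have [r pE] := closed_field_poly_normal p.
have : {ae mu, forall t, (\prod_(z <- r) ('X - z%:P)).[cis t] != 0}.
  elim: r {pE} => [|w r IH]; first by apply: aeW => t; rewrite big_nil hornerC oner_eq0.
  apply: filterS2 IH (cis_ae_neq w) => t h1 h2.
  by rewrite big_cons hornerM mulf_neq0// hornerXsubC subr_eq0.
apply: filterS => t h; rewrite pE hornerZ mulf_neq0// lead_coef_eq0//.
Qed.

Lemma ae_False : ~ {ae mu, forall t : R, False}.
Proof.
move=> [A [mA A0 sA]]; have : (mu setT <= mu A)%E.
  by apply: le_measure; rewrite ?inE//; move=> t _; apply: sA; case.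
rewrite A0 (_ : mu _ = 1%E); last exact: probability_setT.
by rewrite lee_fin ler10.
Qed.

Lemma poly_ae_eq0 p : {ae mu, forall t, p.[cis t] = 0} -> p = 0.
Proof.
move=> p0; apply: contrapT => /eqP/poly_ae_neq0 h; apply: ae_False.
by apply: filterS2 p0 h => t -> /eqP.
Qed.

(** The polynomial [z^m conj (q (1 / conj z))], whose modulus on the circle is
    that of [q] and whose zeros are the reflected zeros of [q]. *)
Definition reflect_poly (m : nat) q : {poly C} := \poly_(i < m.+1) (q`_(m - i))^*.

Lemma reflect_polyE m q z : (size q <= m.+1)%N -> z != 0 ->
  (reflect_poly m q).[z] = z ^+ m * (q.[(z^* )^-1])^*.
Proof.
move=> qm z0; rewrite horner_poly (horner_coef_wide _ qm) rmorph_sum /= big_distrr /=.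
rewrite (reindex_inj rev_ord_inj) /=; apply: eq_bigr => i _.
have im : (i <= m)%N by rewrite -ltnS.
rewrite subSS (subKn im). rewrite rmorphM /= rmorphXn /= fmorphV /= conjCK mulrCA; congr (_ * _).
by rewrite exprVn -[X in z ^+ X / _](subnK im) exprD mulfK// expf_neq0.
Qed.

(** With [p~] for the reflected polynomial, [p p~ = q q~], both being [z^m |p|^2] on
    the circle. So a zero of [p] which is not one of [q] is a zero of [q~], and its
    reflection is a zero of [q]. The reflection of 0 is infinity: for [a = 0] the
    conclusion says that the degree of [q] is less than [m]. *)
Lemma reflect_root (m : nat) p q a : (size p <= m.+1)%N -> (size q <= m.+1)%N ->
  {ae mu, forall t, `|p.[cis t]| = `|q.[cis t]|} -> p.[a] = 0 -> q.[a] != 0 ->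
  exists2 q1, q = q1 * (1 - a^* *: 'X) & (size q1 <= m)%N.
Proof.
move=> pm qm pq pa qa.
have E : p * reflect_poly m p = q * reflect_poly m q.
  apply/eqP; rewrite -subr_eq0; apply/eqP/poly_ae_eq0; apply: filterS pq => t pqt.
  rewrite hornerD hornerN !hornerM !reflect_polyE ?cis_neq0//.
  rewrite -cisV invrK ![_ * (cis t ^+ m * _)]mulrCA -!normCK pqt subrr//.
have q0 : q != 0 by apply: contra_neq qa => ->; rewrite horner0.
have : (reflect_poly m q).[a] = 0.
  have : (p * reflect_poly m p).[a] = 0 by rewrite hornerM pa mul0r.
  by rewrite E hornerM => /eqP; rewrite mulf_eq0 (negbTE qa) => /eqP.
have [->|a0] := eqVneq a 0.
  rewrite horner_coef0 coef_poly /= subn0 => /eqP; rewrite conjC_eq0 => /eqP qm0.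
  exists q; first by rewrite conjC0 scale0r subr0 mulr1.
  rewrite leqNgt; apply/negP => mq.
  have sq : size q = m.+1 by apply/eqP; rewrite eqn_leq qm.
  by move: q0; rewrite -lead_coef_eq0 lead_coefE sq qm0 eqxx.
rewrite reflect_polyE// => /eqP; rewrite mulf_eq0 expf_eq0 (negbTE a0) andbF conjC_eq0.
rewrite /= -/(root _ _) => /factor_theorem[q1 qE].
have b0 : a^* != 0 by rewrite conjC_eq0.
exists (- (a^* )^-1 *: q1).
  rewrite qE -scalerAl scalerAr; congr (_ * _).
  by rewrite scaleNr scalerBr scalerA mulVf// scale1r alg_polyC opprB.
apply: leq_trans (size_scale_leq _ _) _.
have q10 : q1 != 0 by apply: contra_neq q0 => q10; rewrite qE q10 mul0r.
by move: qm; rewrite qE size_Mmonic ?monicXsubC// size_XsubC addn2.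
Qed.

Lemma to_L2_ext f g : multiplier f -> multiplier g ->
  {ae mu, forall t, f (cis t) = g (cis t)} -> to_L2 f = to_L2 g.
Proof. by move=> mf mg fg; rewrite (to_L2_mul mf) (to_L2_mul mg); exact: mul_ext. Qed.

Lemma mul_poly_to_L2 p f : multiplier f ->
  mul_L2 (fun z => p.[z]) (to_L2 f) = to_L2 (fun z => p.[z] * f z).
Proof.
move=> mf; rewrite (to_L2_mul mf) mul_L2M//; last exact: multiplier_poly.
by rewrite -to_L2_mul//; apply: multiplierM => //; exact: multiplier_poly.
Qed.

(** The Hardy space is a module over the polynomials, in which a Bezout relation
    [a p + b q = 1] recovers [x] from [p x] and [q x]. Applied to a quotient of
    boundary functions, this replaces the evaluation of analytic functions at
    points of the disc. *)
Lemma hardy_bezout p q x : coprimep p q -> hardy (mul_L2 (fun z => p.[z]) x) ->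
  hardy (mul_L2 (fun z => q.[z]) x) -> hardy x.
Proof.
move=> /Bezout_eq1_coprimepP[[u v] /= E] hp hq.
have mp := @multiplier_poly R.
have -> : x = mul_L2 (fun z => u.[z]) (mul_L2 (fun z => p.[z]) x) +
    mul_L2 (fun z => v.[z]) (mul_L2 (fun z => q.[z]) x).
  rewrite !mul_L2M// -mul_addf; [|exact: multiplierM..].
  rewrite -[LHS]scale1r -mul_cst; congr mul_L2; apply/funext => z.
  by rewrite -!hornerM -hornerD E hornerC.
by apply: (@linear_subspaceD R (@hardy R)); [exact: linear_subspace_hardy|exact: hardy_poly|exact: hardy_poly].
Qed.

Lemma blaschke_mul_denom a z : `|a| < 1 -> `|z| = 1 ->
  z - a = blaschke_factor a z * (1 - a^* * z).
Proof. by move=> a1 z1; rewrite /blaschke_factor divfK// -normr_gt0 blaschke_denom_gt0. Qed.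

Lemma inner_prod_blaschke (r : seq C) : (forall a, a \in r -> `|a| < 1) ->
  inner_function (fun z => \prod_(a <- r) blaschke_factor a z).
Proof.
elim: r => [|a r IH] r1.
  rewrite (_ : (fun z => _) = fun=> 1); last by apply/funext => z; rewrite big_nil.
  exact/inner_cst/normr1.
rewrite (_ : (fun z => _) = fun z => blaschke_factor a z * \prod_(b <- r) blaschke_factor b z).
  apply: inner_mul; first by apply/inner_blaschke/r1; rewrite mem_head.
  by apply: IH => b br; apply: r1; rewrite inE br orbT.
by apply/funext => z; rewrite big_cons.
Qed.

(** By induction it is enough to divide one factor with zero [a]. The quotient
    [theta1 = conj phi_a theta] satisfies [(z - a) theta1 = (1 - conj a z) theta],
    and [p theta1] is [q v] times the other factors; both are in the Hardy space,
    and [z - a] is coprime to [p]. *)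
Lemma blaschke_divide (r : seq C) theta v p q : inner_function theta -> inner_function v ->
  (forall a, a \in r -> `|a| < 1 /\ p.[a] != 0) ->
  {ae mu, forall t, theta (cis t) * p.[cis t] =
    q.[cis t] * \prod_(a <- r) blaschke_factor a (cis t) * v (cis t)} ->
  exists theta1, [/\ inner_function theta1,
    {ae mu, forall t, theta (cis t) = \prod_(a <- r) blaschke_factor a (cis t) * theta1 (cis t)} &
    {ae mu, forall t, theta1 (cis t) * p.[cis t] = q.[cis t] * v (cis t)}].
Proof.
elim: r theta => [|a r IH] theta it iv r1 E.
  exists theta; split=> //; first by apply: aeW => t; rewrite big_nil mul1r.
  by apply: filterS E => t ->; rewrite big_nil mulr1.
have [a1 pa] := r1 a (mem_head _ _).
have r1' b : b \in r -> `|b| < 1 /\ p.[b] != 0 by move=> br; apply: r1; rewrite inE br orbT.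
have ia := inner_blaschke a1; have ma := inner_multiplier ia; have mt := inner_multiplier it.
have bn t : `|blaschke_factor a (cis t)| = 1 by rewrite blaschke_norm// cis_norm.
have bb t : blaschke_factor a (cis t) * (blaschke_factor a (cis t))^* = 1.
  by rewrite -normCK bn expr1n.
pose theta1 z := (blaschke_factor a z)^* * theta z.
have m1 : multiplier theta1 by apply: multiplierM => //; exact: multiplier_conj.
have ib := inner_prod_blaschke (fun b br => (r1' b br).1).
have E1 : {ae mu, forall t, theta1 (cis t) * p.[cis t] =
    q.[cis t] * \prod_(a <- r) blaschke_factor a (cis t) * v (cis t)}.
  apply: filterS E => t Et; rewrite /theta1 -mulrA Et big_cons -[RHS]mul1r -(bb t).
  ring.
have i1 : inner_function theta1.
  split; first exact: multiplier_square_integrable.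
    have cop : coprimep p ('X - a%:P) by rewrite coprimep_XsubC.
    apply: (hardy_bezout cop).
      rewrite mul_poly_to_L2// (@to_L2_ext _ (fun z => q.[z] * (\prod_(a <- r) blaschke_factor a z * v z))).
      - have im := inner_mul ib iv.
        by rewrite -mul_poly_to_L2; [apply: hardy_poly; case: im|exact: inner_multiplier].
      - by apply: multiplierM => //; exact: multiplier_poly.
      - apply: multiplierM; [exact: multiplier_poly|exact: (inner_multiplier (inner_mul ib iv))].
      - by apply: filterS E1 => t; rewrite mulrC => ->; rewrite mulrA.
    rewrite mul_poly_to_L2// (@to_L2_ext _ (fun z => (1 - a^* *: 'X : {poly C}).[z] * theta z)).
    - by rewrite -mul_poly_to_L2//; apply: hardy_poly; case: it.
    - by apply: multiplierM => //; exact: multiplier_poly.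
    - by apply: multiplierM => //; exact: multiplier_poly.
    - apply: aeW => t; rewrite hornerXsubC (blaschke_mul_denom a1 (cis_norm t)) /theta1.
      rewrite !(hornerD, hornerN, hornerZ, hornerX, hornerC) mulrACA bb mul1r; done.
  apply: filterS (inner_unimodular it) => t ut.
  by rewrite /theta1 normrM norm_conjC bn ut mulr1.
have [theta2 [i2 E2 E3]] := IH _ i1 iv r1' E1.
exists theta2; split=> //; apply: filterS E2 => t E2.
by rewrite big_cons -mulrA -E2 /theta1 mulrA bb mul1r.
Qed.

Section RootsOfUnity.
Variable N : nat.
Hypothesis N0 : (0 < N)%N.

Lemma omega_prim : N.-primitive_root (omega R N).
Proof.
apply/andP; split=> //; apply/forallP => i; rewrite unity_rootE; apply/eqP.
have NR : (0 : R) < N%:R by rewrite ltr0n.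
have E (k : nat) : omega R N ^+ k = cis (2 * pi * (k%:R / N%:R)).
  by rewrite /omega cisX; congr cis; field; rewrite gt_eqF.
case: (eqVneq i.+1 N) => [->|iN].
  have NN : N%:R / N%:R = 1 :> R by rewrite divff// gt_eqF.
  by rewrite E NN mulr1 -[2 * pi]add0r cis_periodic cis0 !eqxx.
apply/negbTE/negP => /eqP; rewrite E => -[/cos_eq1 h _].
have lt1 : i.+1%:R / N%:R < 1 :> R by rewrite ltr_pdivrMr// mul1r ltr_nat ltn_neqAle iN ltn_ord.
have gt0 : 0 < i.+1%:R / N%:R :> R by rewrite divr_gt0.
have p0 : 0 < 2 * pi :> R := twopi_gt0 R.
have : 2 * pi * (i.+1%:R / N%:R) = 0 :> R.
  by apply: h; apply/andP; split; [apply: lt_trans (mulr_gt0 p0 gt0); rewrite oppr_lt0|rewrite gtr_pMr].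
by move/eqP; rewrite gt_eqF// mulr_gt0.
Qed.

Lemma omega_norm (i : nat) : `|omega R N ^+ i| = 1.
Proof. by rewrite normrX cis_norm expr1n. Qed.

Lemma prod_omega_sub (a z : C) : \prod_(i < N) (z - omega R N ^+ i * a) = z ^+ N - a ^+ N.
Proof.
have [->|a0] := eqVneq a 0.
  under eq_bigr do rewrite mulr0 subr0.
  by rewrite prodr_const card_ord expr0n gtn_eqF// subr0.
have E : \prod_(0 <= i < N) ('X - (omega R N ^+ i)%:P).[z / a] = (z / a) ^+ N - 1.
  by rewrite -horner_prod (factor_Xn_sub_1 omega_prim) hornerD hornerN hornerXn hornerC.
transitivity (a ^+ N * \prod_(0 <= i < N) ('X - (omega R N ^+ i)%:P).[z / a]).
  rewrite big_mkord -[in a ^+ N](card_ord N) -prodr_const -big_split /=; apply: eq_bigr => i _.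
  by rewrite hornerXsubC mulrBr mulrCA divff// mulr1 mulrC.
by rewrite E mulrBr mulr1 exprMn exprVn mulrCA divff ?mulr1// expf_neq0.
Qed.

(** Both the numerators and the denominators multiply to a polynomial in [z^N], by
    the factorization of [X^N - 1] into the powers of the primitive root. *)
Lemma prod_blaschke_orbit (a z : C) : `|z| = 1 ->
  \prod_(i < N) blaschke_factor (omega R N ^+ i * a) z = blaschke_factor (a ^+ N) (z ^+ N).
Proof.
move=> z1; rewrite /blaschke_factor big_split /= prod_omega_sub prodfV; congr (_ / _).
have zc : z * z^* = 1 by rewrite -normCK z1 expr1n.
have -> : 1 - (a ^+ N)^* * z ^+ N = z ^+ N * (z ^+ N - a ^+ N)^*.
  rewrite rmorphB !rmorphXn /= mulrBr; congr (_ - _); last exact: mulrC.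
  by rewrite -exprMn zc expr1n.
rewrite -prod_omega_sub rmorph_prod -[in z ^+ N](card_ord N) -prodr_const -big_split /=.
by apply: eq_bigr => i _; rewrite rmorphB /= mulrBr zc; congr (_ - _); exact: mulrC.
Qed.

End RootsOfUnity.
End Algebra.

(** * Factorization into orbit products *)

Section Factorization.
Variable R : realType.
Local Notation C := R[i].
Local Notation mu := (circle_measure R).
Implicit Types (a b c : C) (f g u v theta : C -> C) (p q : {poly C}).

Lemma norm_XsubC_reflect a (t : R) : `|('X - a%:P).[cis t]| = `|(1 - a^* *: 'X : {poly C}).[cis t]|.
Proof.
rewrite !(hornerD, hornerN, hornerZ, hornerX, hornerC).
have zc : cis t * (cis t)^* = 1 by rewrite -normCK cis_norm expr1n.
rewrite -[RHS]norm_conjC rmorphB rmorph1 rmorphM /= conjCK.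
have -> : `|cis t - a| = `|(cis t)^* * (cis t - a)| by rewrite normrM norm_conjC cis_norm mul1r.
by congr `|_|; rewrite mulrBr mulrC zc [a * _]mulrC.
Qed.

Lemma reflect_roots (r : seq C) (m : nat) p q : (size (p * \prod_(a <- r) ('X - a%:P))%R <= m.+1)%N ->
  p != 0 -> (size q <= m.+1)%N ->
  {ae mu, forall t, `|(p * \prod_(a <- r) ('X - a%:P)).[cis t]| = `|q.[cis t]|} ->
  (forall a, a \in r -> q.[a] != 0) ->
  exists2 q1, q = q1 * \prod_(a <- r) (1 - a^* *: 'X) & (size q1 + size r <= m.+1)%N.
Proof.
elim: r m p q => [|a r IH] m p q pm p0 qm pq qr.
  by exists q; rewrite ?big_nil ?mulr1 ?addn0.
have pr0 : p * \prod_(a <- r) ('X - a%:P) != 0.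
  by rewrite mulf_neq0// monic_neq0// monic_prod_XsubC.
have pE : p * \prod_(a <- a :: r) ('X - a%:P) = (p * \prod_(a <- r) ('X - a%:P)) * ('X - a%:P).
  by rewrite big_cons mulrA mulrAC.
rewrite pE in pm pq.
have qa := qr a (mem_head _ _).
have [q1 qE q1m] : exists2 q1, q = q1 * (1 - a^* *: 'X) & (size q1 <= m)%N.
  by apply: reflect_root pm qm pq _ qa; rewrite hornerM hornerXsubC subrr mulr0.
have pm' : (size (p * \prod_(a <- r) ('X - a%:P))%R <= m)%N.
  by move: pm; rewrite size_Mmonic ?monicXsubC// size_XsubC addn2.
have q10 : q1 != 0 by apply: contra_neq qa => q10; rewrite qE q10 mul0r horner0.
have m0 : (0 < m)%N by apply: leq_trans q1m; rewrite size_poly_gt0.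
have [q2 q1E q2m] : exists2 q2, q1 = q2 * \prod_(a <- r) (1 - a^* *: 'X) & (size q2 + size r <= m.-1.+1)%N.
  apply: (IH _ p q1); rewrite ?prednK//.
    have Xa0 : 'X - a%:P != 0 by rewrite polyXsubC_eq0.
    apply: filterS2 pq (poly_ae_neq0 Xa0) => t; rewrite qE !hornerM !normrM norm_XsubC_reflect => h n0.
    by apply: (mulIf _ h); rewrite -norm_XsubC_reflect normr_eq0.
  by move=> b br; have := qr b; rewrite inE br orbT qE hornerM mulf_eq0 negb_or => /(_ isT)/andP[].
exists q2; first by rewrite qE q1E big_cons [RHS]mulrCA mulrC.
by move: q2m; rewrite prednK//= addnS.
Qed.

Section Main.
Variable N : nat.
Hypothesis N0 : (0 < N)%N.

Definition psi_prod (s : seq (C * {set 'I_N})) (z : C) : C := \prod_(i <- s) psi i.1 i.2 z.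

Lemma inner_comp u : inner_function u -> inner_function (fun z => u (z ^+ N)).
Proof.
move=> iu; have [u2 hu uu] := iu; split; first exact: square_integrable_power.
  rewrite -comp_to_L2//; apply/hardyP => n; have [k [j ->]] := residueP N0 n.
  rewrite ltNge residue_ge0// -ltNge comp_coef ?ltz_nat//= => k0; case: eqP => // _.
  by move/hardyP: hu; exact.
by apply/unimodular_power.
Qed.

(** With [b = a^N] and [u1 = conj phi_b u], one has to see that [u1] is analytic.
    Write [z^N - b = (z - a) G] with [G] monic of degree [N - 1]; then
    [G u1(z^N)] is in the Hardy space because its products with [q] and with
    [z - a] are, and the residue class of [N - 1] reads off the coefficients of
    [u1]. *)
Lemma inner_power_divide theta u p q a : inner_function theta -> inner_function u ->
  `|a| < 1 -> q.[a] != 0 ->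
  {ae mu, forall t, theta (cis t) * (p * ('X - a%:P)).[cis t] = q.[cis t] * u (cis t ^+ N)} ->
  exists2 u', inner_function u' & {ae mu, forall t, u (cis t) = blaschke_factor (a ^+ N) (cis t) * u' (cis t)}.
Proof.
move=> it iu a1 qa E; pose b := a ^+ N.
have b1 : `|b| < 1 by rewrite normrX exprn_ilt1 ?normr_ge0// -lt0n.
have ib := inner_blaschke b1; have mb := inner_multiplier ib; have mu' := inner_multiplier iu.
have bn t : `|blaschke_factor b (cis t)| = 1 by rewrite blaschke_norm// cis_norm.
have bb t : blaschke_factor b (cis t) * (blaschke_factor b (cis t))^* = 1.
  by rewrite -normCK bn expr1n.
pose u1 z := (blaschke_factor b z)^* * u z.
have m1 : multiplier u1 by apply: multiplierM => //; exact: multiplier_conj.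
have uE t : u (cis t) = blaschke_factor b (cis t) * u1 (cis t) by rewrite mulrA bb mul1r.
exists u1; last by apply: aeW => t; exact: uE.
split; first exact: multiplier_square_integrable; last first.
  by apply: filterS (inner_unimodular iu) => t ut; rewrite /u1 normrM norm_conjC bn ut mulr1.
pose G : {poly C} := \sum_(j < N) 'X ^+ (N.-1 - j) * a%:P ^+ j.
have GX : ('X - a%:P) * G = 'X^N - b%:P by rewrite /b rmorphXn subrXX.
have mXN : 'X^N - b%:P \is monic by rewrite monicXnsubC.
have mG : G \is monic by move: mXN; rewrite -GX monicMl// monicXsubC.
have sG : size G = N.
  have := congr1 (fun p : {poly C} => size p) GX.
  by rewrite size_monicM ?monicXsubC ?monic_neq0// size_XsubC size_XnsubC// => -[].
have GXt t : ('X - a%:P).[cis t] * G.[cis t] = cis t ^+ N - b.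
  by rewrite -hornerM GX hornerD hornerN hornerXn hornerC.
have m1N := multiplier_power N0 m1.
have u12 := multiplier_square_integrable m1.
have hy : hardy (lift N G (to_L2 u1)).
  rewrite /lift comp_to_L2//.
  have iuN := inner_comp iu; have muN := inner_multiplier iuN; have mt := inner_multiplier it.
  have mp := @multiplier_poly R.
  have mG1 : multiplier (fun z => G.[z] * u1 (z ^+ N)) := multiplierM (mp G) m1N.
  have cop : coprimep q ('X - a%:P) by rewrite coprimep_XsubC.
  apply: (hardy_bezout cop).
    rewrite !mul_poly_to_L2//.
    rewrite (@to_L2_ext _ _ (fun z => (p * (1 - b^* *: 'X^N)).[z] * theta z)).
    - by rewrite -mul_poly_to_L2//; apply: hardy_poly; case: it.
    - exact: multiplierM (mp q) mG1.
    - exact: multiplierM (mp _) mt.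
    apply: filterS E => t E; have := bb (N%:R * t); rewrite -cisX => bbN.
    have b1N := blaschke_mul_denom b1 (cis_norm (N%:R * t)); rewrite -cisX in b1N.
    rewrite /u1 (_ : q.[_] * _ = (blaschke_factor b (cis t ^+ N))^* * G.[cis t] *
      (q.[cis t] * u (cis t ^+ N))); last by ring.
    rewrite -E !hornerM (_ : _ * _ = (blaschke_factor b (cis t ^+ N))^* *
      (('X - a%:P).[cis t] * G.[cis t]) * (theta (cis t) * p.[cis t])); last by ring.
    rewrite GXt !(hornerD, hornerN, hornerZ, hornerXn, hornerC) b1N.
    rewrite [RHS](_ : _ = 1 * (1 - b^* * cis t ^+ N) * (theta (cis t) * p.[cis t])); last by ring.
    by rewrite -bbN; ring.
  rewrite !mul_poly_to_L2//.
  rewrite (@to_L2_ext _ _ (fun z => (1 - b^* *: 'X^N).[z] * u (z ^+ N))).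
  - by rewrite -(@mul_poly_to_L2 _ _ (fun z => u (z ^+ N)))//; apply: hardy_poly; case: iuN.
  - exact: multiplierM (mp _) mG1.
  - exact: multiplierM (mp _) muN.
  apply: aeW => t; have := bb (N%:R * t); rewrite -cisX => bbN.
  have b1N := blaschke_mul_denom b1 (cis_norm (N%:R * t)); rewrite -cisX in b1N.
  rewrite mulrA GXt !(hornerD, hornerN, hornerZ, hornerXn, hornerC) b1N /u1.
  by rewrite -[RHS]mul1r -bbN; ring.
apply/hardyP => k k0; have lastN : (N.-1 < N)%N by rewrite prednK.
have := lift_coef N0 (to_L2 u1) k (Ordinal lastN) (eq_leq sG).
rewrite /= -[in G`_ _]sG -lead_coefE (monicP mG) mul1r => <-.
by move/hardyP: hy; apply; rewrite ltNge (residue_ge0 N0 k (Ordinal lastN)) -ltNge.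
Qed.

(** Induction on the degree bound [m]. Zeros common to [p] and [q] cancel. A zero
    of [q] in the disc is a zero of [theta], and removing it lowers the bound by
    one. At a zero [a] of [p] in the disc, it is [u(z^N)] that must vanish, hence
    [u] has the Blaschke factor of [a^N], whose composition with [z^N] vanishes on
    the whole orbit of [a]. If [I] is a largest index set for which
    the product of the [z - omega^i a] divides [p], the other points of the orbit
    are zeros of [theta], which thus has the factor [psi a (~: I)], and the bound
    drops by [#|I|], the size of the complement of [~: I]. *)
Lemma psi_factorization (m : nat) theta u p q : inner_function theta -> inner_function u ->
  (m < N)%N -> p != 0 -> q != 0 -> (size p <= m.+1)%N -> (size q <= m.+1)%N ->
  {ae mu, forall t, theta (cis t) * p.[cis t] = q.[cis t] * u (cis t ^+ N)} ->
  exists (s : seq (C * {set 'I_N})) u', [/\ inner_function u', (size s <= m)%N, (forall i, i \in s -> `|i.1| < 1),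
    (\sum_(i <- s) minn #|i.2| (N - #|i.2|) <= m)%N &
    {ae mu, forall t, theta (cis t) = psi_prod s (cis t) * u' (cis t ^+ N)}].
Proof.
have [k] := ubnP m; elim: k => // k IH in m theta u p q *.
rewrite ltnS => mk it iu mN p0 q0 pm qm E.
have pq : {ae mu, forall t, `|p.[cis t]| = `|q.[cis t]|}.
  apply: (ae_mp E); apply: (ae_mp (inner_unimodular it)).
  apply: (ae_mp (inner_unimodular (inner_comp iu))); apply: aeW => t ut tt Et.
  by move/(congr1 Num.norm): Et; rewrite !normrM ut tt mul1r mulr1.
have Xa0 a : 'X - a%:P != 0 by rewrite polyXsubC_eq0.
have drop a p' (m' : nat) : (size (p' * ('X - a%:P))%R <= m'.+1)%N -> p' != 0 -> (size p' <= m')%N.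
  by move=> h p'0; move: h; rewrite size_Mmonic ?monicXsubC// size_XsubC addn2.
have [[a [pa qa]]|nocommon] := EM (exists a, p.[a] = 0 /\ q.[a] = 0).
  have /factor_theorem[p1 pE] : root p a by apply/eqP.
  have /factor_theorem[q1 qE] : root q a by apply/eqP.
  have p10 : p1 != 0 by apply: contra_neq p0 => h; rewrite pE h mul0r.
  have q10 : q1 != 0 by apply: contra_neq q0 => h; rewrite qE h mul0r.
  rewrite pE in pm; rewrite qE in qm; have p1m := drop _ _ _ pm p10; have q1m := drop _ _ _ qm q10.
  have m0 : (0 < m)%N by apply: leq_trans p1m; rewrite size_poly_gt0.
  have m1k : (m.-1 < k)%N by rewrite prednK.
  have m1N := leq_ltn_trans (leq_pred m) mN.
  have E1 : {ae mu, forall t, theta (cis t) * p1.[cis t] = q1.[cis t] * u (cis t ^+ N)}.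
    apply: filterS2 E (poly_ae_neq0 (Xa0 a)) => t; rewrite pE qE !hornerM => Et n0.
    by apply: (mulIf n0); rewrite -mulrA Et; ring.
  rewrite -(prednK m0) in p1m q1m.
  have [s [u' [h1 h2 h3 h4 h5]]] := IH m.-1 theta u p1 q1 m1k it iu m1N p10 q10 p1m q1m E1.
  by exists s, u'; split => //; [exact: leq_trans h2 (leq_pred m)|exact: leq_trans h4 (leq_pred m)].
have nc a : p.[a] = 0 -> q.[a] != 0 by move=> pa; apply/eqP => qa; apply: nocommon; exists a.
have [[a [qa a1]]|noq] := EM (exists a, q.[a] = 0 /\ `|a| < 1).
  have pa : p.[a] != 0 by apply/eqP => pa; apply: nocommon; exists a.
  have qp : {ae mu, forall t, `|q.[cis t]| = `|p.[cis t]|} by apply: filterS pq => t ->.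
  have [p1 pE p1m] := reflect_root qm pm qp qa pa.
  have /factor_theorem[q1 qE] : root q a by apply/eqP.
  have p10 : p1 != 0 by apply: contra_neq p0 => h; rewrite pE h mul0r.
  have q10 : q1 != 0 by apply: contra_neq q0 => h; rewrite qE h mul0r.
  rewrite qE in qm; have q1m := drop _ _ _ qm q10.
  have m0 : (0 < m)%N by apply: leq_trans p1m; rewrite size_poly_gt0.
  have Ed : {ae mu, forall t, theta (cis t) * p1.[cis t] =
      q1.[cis t] * \prod_(b <- [:: a]) blaschke_factor b (cis t) * u (cis t ^+ N)}.
    apply: filterS E => t; rewrite pE qE big_seq1 !hornerM hornerXsubC.
    rewrite (blaschke_mul_denom a1 (cis_norm t)) !(hornerD, hornerN, hornerZ, hornerX, hornerC) => Et.
    have n0 : 1 - a^* * cis t != 0 by rewrite -normr_gt0 blaschke_denom_gt0// cis_norm.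
    by apply: (mulIf n0); rewrite -[LHS]mulrA; apply: (etrans Et); ring.
  have [|theta1 [it1 Et Et1]] := blaschke_divide it (inner_comp iu) _ Ed.
    by move=> b; rewrite inE => /eqP ->; split=> //; move: pa; rewrite pE hornerM mulf_eq0 negb_or => /andP[].
  have m1k : (m.-1 < k)%N by rewrite prednK.
  have m1N := leq_ltn_trans (leq_pred m) mN.
  rewrite -(prednK m0) in p1m q1m.
  have [s [u' [h1 h2 h3 h4 h5]]] := IH m.-1 theta1 u p1 q1 m1k it1 iu m1N p10 q10 p1m q1m Et1.
  exists ((a, [set Ordinal N0]%SET) :: s), u'; split=> //.
  - by rewrite /= -(prednK m0).
  - by move=> i; rewrite inE => /orP[/eqP ->|/h3].
  - rewrite big_cons /= cards1 -[leqRHS](prednK m0) -[leqRHS]add1n.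
    by apply: leq_add => //; exact: geq_minl.
  apply: filterS2 Et h5 => t -> ->; rewrite big_seq1 /psi_prod big_cons /= mulrA; congr (_ * _ * _).
  by rewrite /psi big_set1 expr0 mul1r.
have [[a [pa a1]]|nop] := EM (exists a, p.[a] = 0 /\ `|a| < 1).
  pose w (i : 'I_N) : C := omega R N ^+ i * a.
  have wn i : `|w i| < 1 by rewrite normrM omega_norm mul1r.
  have [I /andP[Ip Imax]] : exists I : {set 'I_N}, (\prod_(i in I) ('X - (w i)%:P) %| p) &&
      [forall J : {set 'I_N}, (\prod_(i in J) ('X - (w i)%:P) %| p) ==> (#|J| <= #|I|)%N].
    have P0 : \prod_(i in (finset.set0 : {set 'I_N})) ('X - (w i)%:P) %| p by rewrite big_set0 dvd1p.
    pose I := [arg max_(J > finset.set0 | \prod_(i in J) ('X - (w i)%:P) %| p) #|J|].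
    exists I; rewrite /I; case: arg_maxnP => // J -> hJ /=.
    by apply/forallP => K; apply/implyP; exact: hJ.
  have {}Imax (J : {set 'I_N}) : \prod_(i in J) ('X - (w i)%:P) %| p -> (#|J| <= #|I|)%N.
    by move=> h; move/forallP: Imax => /(_ J); rewrite h.
  have prodI (J : {set 'I_N}) : \prod_(i in J) ('X - (w i)%:P) = \prod_(b <- map w (enum J)) ('X - b%:P).
    by rewrite big_map big_enum.
  have [p1 pE] := dvdpP _ _ Ip.
  have p10 : p1 != 0 by apply: contra_neq p0 => h; rewrite pE h mul0r.
  have I0 : (0 < #|I|)%N.
    rewrite -(cards1 (Ordinal N0)); apply: Imax; rewrite big_set1 /w expr0 mul1r.
    by rewrite dvdp_XsubCl; apply/eqP.
  have p1n i : i \notin I -> p1.[w i] != 0.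
    move=> iI; apply/eqP => h; have /factor_theorem[p2 p2E] : root p1 (w i) by apply/eqP.
    have : (#|(i |: I)%SET| <= #|I|)%N.
      by apply: Imax; rewrite big_setU1//= pE p2E -mulrA dvdp_mull.
    by rewrite cardsU1 iI add1n ltnn.
  pose r : seq C := map w (enum I).
  have sr : size r = #|I| by rewrite size_map cardE.
  have qr b : b \in r -> q.[b] != 0.
    move=> bI; case/mapP: bI => i; rewrite mem_enum => iI ->; apply: nc.
    by rewrite pE hornerM (bigD1 i)//= hornerM hornerXsubC subrr mul0r mulr0.
  rewrite prodI -/r in pE; rewrite pE in pm pq.
  have [q1 qE q1m] := reflect_roots pm p10 qm pq qr.
  have q10 : q1 != 0 by apply: contra_neq q0 => h; rewrite qE h mul0r.
  have sI : (#|I| <= m)%N.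
    rewrite -sr -ltnS; apply: leq_trans q1m.
    by rewrite -[leqLHS]add1n leq_add2r size_poly_gt0.
  pose m' := (m - #|I|)%N; have m'm : (m' <= m)%N := leq_subr _ _.
  have q1m' : (size q1 <= m'.+1)%N by rewrite /m' -subSn// leq_subRL ?(leq_trans sI)// addnC -sr.
  have p1m' : (size p1 <= m'.+1)%N.
    move: pm; rewrite size_Mmonic ?monic_prod_XsubC// size_prod_XsubC sr addnS /=.
    by rewrite /m' -subSn// leq_subRL ?(leq_trans sI)// addnC.
  have [u1 iu1 uE] : exists2 u1, inner_function u1 &
      {ae mu, forall t, u (cis t) = blaschke_factor (a ^+ N) (cis t) * u1 (cis t)}.
    have /factor_theorem[p2 p2E] : root p a by apply/eqP.
    apply: (@inner_power_divide theta u p2 q a) => //; first exact: nc.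
    by rewrite -p2E.
  have prodJ (J : {set 'I_N}) t : psi a J (cis t) = \prod_(b <- map w (enum J)) blaschke_factor b (cis t).
    by rewrite big_map big_enum.
  have uNE : {ae mu, forall t, u (cis t ^+ N) = blaschke_factor (a ^+ N) (cis t ^+ N) * u1 (cis t ^+ N)}.
    have aN1 : `|a ^+ N| < 1 by rewrite normrX exprn_ilt1 ?normr_ge0// -lt0n.
    have ib := inner_mul (inner_blaschke aN1) iu1.
    by apply/(ae_power_eq N0 _ (multiplier_square_integrable (inner_multiplier ib))) => //; case: iu.
  have E1 : {ae mu, forall t, theta (cis t) * p1.[cis t] =
      q1.[cis t] * \prod_(b <- map w (enum (~: I)%SET)) blaschke_factor b (cis t) * u1 (cis t ^+ N)}.
    have r0 : \prod_(b <- r) ('X - b%:P) != 0 by rewrite monic_neq0// monic_prod_XsubC.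
    apply: (ae_mp uNE); apply: filterS2 E (poly_ae_neq0 r0) => t Et n0 uNt.
    apply: (mulIf n0); rewrite -[LHS]mulrA -hornerM -pE Et uNt qE hornerM.
    rewrite -(prod_blaschke_orbit N0 a (cis_norm t)) (bigID (mem I))/=.
    have -> : (\prod_(b <- r) ('X - b%:P)).[cis t] = \prod_(i in I) blaschke_factor (w i) (cis t) *
        (\prod_(b <- r) (1 - b^* *: 'X)).[cis t].
      rewrite !horner_prod !big_map !big_enum -big_split; apply: eq_bigr => i _ /=.
      rewrite hornerXsubC !(hornerD, hornerN, hornerZ, hornerX, hornerC).
      exact: blaschke_mul_denom (wn i) (cis_norm t).
    have -> : \prod_(b <- map w (enum (~: I)%SET)) blaschke_factor b (cis t) =
        \prod_(i | i \notin I) blaschke_factor (w i) (cis t).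
      by rewrite big_map big_enum; apply: eq_bigl => i; rewrite finset.in_setC.
    by ring.
  have [|theta1 [it1 Et Et1]] := blaschke_divide it (inner_comp iu1) _ E1.
    by move=> b bI; case/mapP: bI => i; rewrite mem_enum finset.in_setC => iI ->; split; [exact: wn|exact: p1n].
  have m'k : (m' < k)%N by move: I0 sI mk; rewrite /m'; lia.
  have m'N := leq_ltn_trans m'm mN.
  have [s [u' [h1 h2 h3 h4 h5]]] := IH m' theta1 u1 p1 q1 m'k it1 iu1 m'N p10 q10 p1m' q1m' Et1.
  exists ((a, (~: I)%SET) :: s), u'; split=> //.
  - by apply: leq_ltn_trans h2 _; move: I0 sI; rewrite /m'; lia.
  - by move=> i; rewrite inE => /orP[/eqP ->|/h3].
  - rewrite big_cons /= -(subnKC sI); apply: leq_add => //.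
    by apply: leq_trans (geq_minr _ _) _; rewrite leq_subLR addnC cardsC card_ord.
  by apply: filterS2 Et h5 => t -> ->; rewrite /psi_prod big_cons /= mulrA -prodJ.
(* As [|p| = |q|], a zero of [p] outside the closed disc reflects to a zero of
   [q] inside, and one on the circle is a common zero. *)
have norb f a : a != 0 -> (1 - a^* *: 'X : {poly C}).[(a^* )^-1] = 0.
  by move=> a0; rewrite !(hornerD, hornerN, hornerZ, hornerX, hornerC) divff ?subrr// conjC_eq0.
have constp (f g : {poly C}) : (size f <= m.+1)%N -> (size g <= m.+1)%N -> f != 0 ->
    {ae mu, forall t, `|f.[cis t]| = `|g.[cis t]|} ->
    (forall a, f.[a] = 0 -> g.[a] != 0) -> ~ (exists a, f.[a] = 0 /\ `|a| < 1) ->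
    ~ (exists a, g.[a] = 0 /\ `|a| < 1) -> exists2 c, c != 0 & f = c%:P.
  move=> fm gm f0 fg fgn nof nog.
  have [/size_poly1P//|s1] := boolP (size f == 1); exfalso.
  have /closed_rootP[a /eqP fa] : size f != 1 by [].
  have [g1 gE _] := reflect_root fm gm fg fa (fgn a fa).
  have [a0|a0] := eqVneq a 0; first by apply: nof; exists a; rewrite fa a0 normr0 ltr01.
  have ga : g.[(a^* )^-1] = 0 by rewrite gE hornerM norb// mulr0.
  have [a1|a1|a1] := real_ltgtP (normr_real a) (@real1 _).
  - by apply: nof; exists a.
  - apply: nog; exists (a^* )^-1; split=> //.
    by rewrite normfV norm_conjC invf_lt1// (lt_trans ltr01 a1).
  have := fgn a fa; suff -> : a = (a^* )^-1 by rewrite ga eqxx.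
  by rewrite -[RHS]mul1r; apply: (canRL (mulfK _)); rewrite ?conjC_eq0// -normCK a1 expr1n.
have [c c0 pE] := constp p q pm qm p0 pq nc nop noq.
have [d d0 qE] : exists2 d, d != 0 & q = d%:P.
  apply: (constp q p) => //; first by apply: filterS pq => t ->.
  by move=> a qa; apply/eqP => pa; apply: nocommon; exists a.
have dc : `|d / c| = 1.
  apply/eqP/negP => h; apply: (@ae_False R); apply: filterS pq => t; rewrite pE qE !hornerC => cd.
  by apply: h; rewrite normrM normfV cd divff// normr_eq0.
exists [::], (fun z => d / c * u z); split=> //; first exact: inner_mul (inner_cst dc) iu.
  by rewrite big_nil.
apply: filterS E => t; rewrite pE qE !hornerC /psi_prod big_nil mul1r => Et.
by apply: (mulIf c0); rewrite Et mulrAC divfK.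
Qed.
End Main.
End Factorization.

(** * Operators whose defect has rank one *)

Section RankOneConverse.
Variable R : realType.
Local Notation C := R[i].
Local Notation H := (L2 R).
Local Notation "''[' x , y ]" := (L2_dot x y) : ring_scope.
Implicit Types (x y h v : H) (a b c : C) (K M : set H).

(** A line is its double orthogonal complement, and orthogonal complements are
    closed. *)
Lemma closed_line (b : H) : closed [set x | exists a : C, x = a *: b].
Proof.
have [->|b0] := eqVneq b 0.
  rewrite (_ : mkset _ = [set x | forall y, setT y -> '[x, y] = 0]); first exact: closed_ortho.
  apply/seteqP; split=> [x [a ->] y _|x h]; first by rewrite scaler0 dot0l.
  by exists 0; rewrite scaler0; apply/dot_eq0/h.
have bb : 0 < '[b, b] := L2_dot_gt0 b0.
rewrite (_ : mkset _ = [set x | forall y, [set z | '[b, z] = 0] y -> '[x, y] = 0]); first exact: closed_ortho.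
apply/seteqP; split=> [x [a ->] y /= by0|x h]; first by rewrite dotZl by0 mulr0.
exists ('[x, b] / '[b, b]); apply/eqP; rewrite -subr_eq0; apply/eqP/dot_eq0.
set w := x - _; have bw : '[b, w] = 0.
  by rewrite dotC dotBl dotZl divfK ?gt_eqF// subrr rmorph0.
by rewrite {1}/w dotBl dotZl bw mulr0 subr0; apply: h.
Qed.

(** If [I - T^* T] is [x |-> '[x, v] v], its square root is the same operator
    divided by the norm of [v], and any positive square root has range
    spanned by the image of [v], because it kills the complement of [v]. *)
Lemma defect_rank_one M (T : H -> H) v : linear_subspace M -> M v -> v != 0 ->
  (forall x, M x -> x - adjoint_on M T (T x) = '[x, v] *: v) ->
  has_dim (defect_space M T) 1.
Proof.
move=> sM Mv v0 TE; have vv : 0 < '[v, v] := L2_dot_gt0 v0.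
set D := defect_operator M T.
have [Di Dl _ Dp DD] : positive_sqrt_on M (fun x => x - adjoint_on M T (T x)) D.
  have n0 : 0 < `|v| by rewrite normr_gt0.
  have nE : `|v| * `|v| = '[v, v] by rewrite -expr2 L2_normE sqrtCK.
  apply: (@xgetPex _ (fun=> 0 : H) [set D | positive_sqrt_on M (fun x => x - adjoint_on M T (T x)) D]).
  exists (fun x => ('[x, v] / `|v|) *: v); split.
  - by move=> x Mx; exact: linear_subspaceZ.
  - by move=> a x y Mx My; rewrite dotDl dotZl mulrDl scalerDl -mulrA scalerA.
  - exists `|v| => x Mx; rewrite normrZ normrM normfV normr_id divfK ?gt_eqF//.
    by rewrite mulrC norm_dot_le.
  - move=> x Mx; rewrite dotZl [X in _ * X]dotC mulrAC -normCK.
    by rewrite divr_ge0// exprn_ge0.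
  - move=> x Mx; rewrite TE// dotZl -nE; congr (_ *: _).
    by field; rewrite gt_eqF.
have Ds := positive_symmetric sM Dl Dp.
have D0 : D 0 = 0.
  by have := Dl (-1) 0 0 sM.1 sM.1; rewrite scaler0 addr0 scaleN1r addNr.
have Dlin a x : M x -> D (a *: x) = a *: D x.
  by move=> Mx; rewrite -[a *: x]addr0 (Dl a x 0 Mx sM.1) D0 addr0.
set b := D v; have b0 : b != 0.
  apply/eqP => b0; have := DD v Mv; rewrite TE// -/b b0 D0.
  by move/esym/eqP; rewrite scaler_eq0 (negbTE v0) orbF gt_eqF.
have DE x : M x -> D x = ('[x, v] / '[v, v]) *: b.
  move=> Mx; set c := _ / _; pose w := x - c *: v.
  have Mw : M w by apply: linear_subspaceB => //; exact: linear_subspaceZ.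
  have wv : '[w, v] = 0 by rewrite dotBl dotZl divfK ?gt_eqF// subrr.
  have Dw : D w = 0 by apply: dot_eq0; rewrite -Ds//; [rewrite DD// TE// wv scale0r dot0l|exact: Di].
  by rewrite -[x in LHS](subrK (c *: v)) -/w addrC Dl// Dw addr0.
exists (fun=> b); split=> [_|c|x].
- by apply: subset_closure; exists v.
- by rewrite big_ord1 => /eqP; rewrite scaler_eq0 (negbTE b0) orbF => /eqP c0 i; rewrite ord1.
move=> cx; have [a ->] : exists a, x = a *: b.
  apply: (closed_line (b := b)); apply: (closure_subset _ cx) => _ [y My <-] /=.
  by exists ('[y, v] / '[v, v]); exact: DE.
by exists (fun=> a); rewrite big_ord1.
Qed.
End RankOneConverse.

(** * The reducing subspace of a polynomial identity *)

Section Converse.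
Variable R : realType.
Local Notation C := R[i].
Local Notation H := (L2 R).
Local Notation mu := (circle_measure R).
Local Notation P := (@orthogonal_projection R).
Local Notation "''[' x , y ]" := (L2_dot x y) : ring_scope.
Local Notation e := (e R).
Implicit Types (x y h : H) (a b c : C) (K M : set H) (f g u v theta : C -> C) (p q : {poly C}).

Section Shift.
Variable theta : C -> C.
Hypothesis it : inner_function theta.
Local Notation K := (model_space theta).
Local Notation T := (truncated_toeplitz theta (fun z => z ^+ 1)).
Local Notation theta1 := (mul_L2 theta (e 0)).

Lemma hardy_theta1 : hardy theta1.
Proof. by apply: hardy_inner => //; exact: hardy_e. Qed.

Let shift_K x : K (T x). Proof. exact: toeplitz_K. Qed.

Lemma bshift1E x : bshift 1 x = Z (- 1) (x - '[x, e 0] *: e 0).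
Proof. by rewrite /bshift big_ord1. Qed.

(** [z^-1 (theta1 - c)] is orthogonal to [theta h] because [z^-1] is orthogonal to
    both [h] and [theta h]. *)
Lemma bshift_theta_K : K (bshift 1 theta1).
Proof.
have mt := inner_multiplier it; split; first exact/hardy_bshift/hardy_theta1.
have n0 h : hardy h -> '[e (-1), h] = 0.
  by move=> /hardyP hh; rewrite dotC hh ?rmorph0.
move=> _ [h hh <-]; rewrite bshift1E /Z mul_L2B; last exact: multiplier_exprz.
rewrite mul_L2Z; last exact: multiplier_exprz.
rewrite mul_L2C //; last exact: multiplier_exprz.
rewrite -/(Z _ _) Ze addr0 dotBl dotZl mul_isometry//; last exact: inner_unimodular.
by rewrite !n0// ?mulr0 ?subrr//; exact: hardy_inner.
Qed.

Lemma shift_split x : K x -> Z 1 x = T x + '[x, bshift 1 theta1] *: theta1.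
Proof.
move=> Kx; have mt := inner_multiplier it.
have [r [hr r1] rE] := toeplitz_split it 1 Kx.
have r0 : r = '[r, e 0] *: e 0.
  apply: coef_ext => n; rewrite dotZl dot_e; case: eqP => [<-|n0]; first by rewrite mulr1.
  rewrite mulr0; have [nn|nn] := ltP n 0; first by move/hardyP: hr; apply.
  by apply: r1; move: n0 nn; lia.
suff E : '[r, e 0] = '[x, bshift 1 theta1] by rewrite rE -E -mul_L2Z// -r0.
rewrite -(bshift_dot 1 (model_space_hardy Kx) hardy_theta1).
rewrite rE dotDl (model_space_ortho (shift_K x) (@hardy_e R 0 (lexx _))) add0r.
by rewrite mul_isometry//; exact: inner_unimodular.
Qed.

(** The vectors [bshift theta1] and [P 1] span the defects of the compression of
    multiplication by [z] to the model space of [theta]. *)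
Lemma shift_defect x : K x ->
  x - bshift 1 (T x) = '[x, bshift 1 theta1] *: bshift 1 theta1.
Proof.
move=> Kx; have hx := model_space_hardy Kx; have hT := model_space_hardy (shift_K x).
have /hardyP h1 := hx.
apply: coef_ext => n.
rewrite dotBl dotZl (coef_bshift 1 n hT) (coef_bshift 1 n hardy_theta1).
case: leP => n0; last by rewrite h1 ?subr0 ?mulr0.
have -> : T x = Z 1 x - '[x, bshift 1 theta1] *: theta1 by rewrite shift_split// addrK.
by rewrite dotBl dotZl coef_Z addrK opprB addrC subrK.
Qed.

Lemma shift_adjoint_defect x : K x ->
  x - T (bshift 1 x) = '[x, P K (e 0)] *: P K (e 0).
Proof.
move=> Kx; have Kb := bshift_K it 1 Kx; have [Kp op] := model_projP theta (e 0).
have sK := linear_subspace_model_space theta.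
have xe : '[x, e 0] = '[x, P K (e 0)].
  by apply/eqP; rewrite -subr_eq0 -dotBr dotC op ?rmorph0.
have TE : T (bshift 1 x) = x - '[x, P K (e 0)] *: P K (e 0).
  apply: projU => //; first by apply: linear_subspaceB => //; exact: linear_subspaceZ.
  move=> h Kh; rewrite -[mul_L2 _ _]/(Z 1%:Z _) bshift1E ZM subrr Z0 xe opprB addrC addrA subrK.
  by rewrite -scalerBr dotZl -opprB -scaleN1r dotZl op// !mulr0.
by rewrite TE opprB addrC subrK.
Qed.

(** Since [theta1 = '[theta1, e 0] e 0 + z (bshift theta1)]. *)
Lemma inner_constant : bshift 1 theta1 = 0 ->
  exists2 c, `|c| = 1 & {ae mu, forall t, theta (cis t) = c}.
Proof.
have mt := inner_multiplier it; rewrite bshift1E => E.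
have {}E : theta1 = '[theta1, e 0] *: e 0.
  apply/eqP; rewrite -subr_eq0; move/(congr1 (Z 1)): E; rewrite ZM subrr Z0 => ->.
  by rewrite /Z mul_0//; exact: multiplier_exprz.
have tE : {ae mu, forall t, theta (cis t) = '[theta1, e 0]}.
  move/L2_eqP: E => E; apply: (ae_mp E); apply: (ae_mp (mul_L2E (e 0) mt)).
  apply: (ae_mp (reprZ '[theta1, e 0] (e 0))).
  apply: (ae_mp (to_L2E (multiplier_square_integrable (multiplier_exprz R 0)))).
  by apply: aeW => t h1 h2 h3; rewrite h3 h2 -/(e 0) h1 !expr0z !mulr1.
exists '[theta1, e 0] => //; apply/eqP/negP => h.
by apply: (@ae_False R); apply: filterS2 (inner_unimodular it) tE => t ut tt; apply: h; rewrite -tt ut.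
Qed.
End Shift.

Section Lift.
Variables (N : nat) (theta phi : C -> C) (p q : {poly C}).
Hypotheses (N0 : (0 < N)%N) (it : inner_function theta) (ip : inner_function phi).
Hypotheses (pN : (size p <= N)%N) (qN : (size q <= N)%N).
Hypothesis E : {ae mu, forall t, theta (cis t) * p.[cis t] = q.[cis t] * phi (cis t ^+ N)}.
Local Notation K := (model_space theta).
Local Notation L := (model_space phi).
Local Notation T := (truncated_toeplitz theta (fun z => z ^+ N)).
Local Notation S := (truncated_toeplitz phi (fun z => z ^+ 1)).

Let mt := inner_multiplier it.
Let mf := inner_multiplier ip.
Let mfN : multiplier (fun z => phi (z ^+ N)) := multiplier_power N0 mf.
Let mp (r : {poly C}) := @multiplier_poly R r.

Lemma lift_hardy (r : {poly C}) x : (size r <= N)%N -> hardy x -> hardy (lift N r x).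
Proof.
move=> rN /hardyP hx; apply/hardyP => n n0; have [k [j nE]] := residueP N0 n.
by move: n0; rewrite nE lift_coef// ltNge residue_ge0// -ltNge => k0; rewrite hx ?mulr0.
Qed.

Lemma lift_antihardy (r : {poly C}) x : (size r <= N)%N -> antihardy x -> antihardy (lift N r x).
Proof.
move=> rN hx n n0; have [k [j nE]] := residueP N0 n.
by move: n0; rewrite nE lift_coef// residue_ge0// => k0; rewrite hx ?mulr0.
Qed.

(** This is the meaning of [theta p = q phi(z^N)]: the lift by [q] carries
    [phi H^2] into [theta H^2]. *)
Lemma lift_mul_inner x : lift N q (mul_L2 phi x) = mul_L2 theta (lift N p x).
Proof.
rewrite /lift comp_mul// !mul_L2M//; apply: mul_ext; try exact: multiplierM.
by apply: filterS E => t ->.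
Qed.

Lemma lift_mul_conj x :
  mul_L2 (fun z => (theta z)^* ) (lift N q x) = lift N p (mul_L2 (fun z => (phi z)^* ) x).
Proof.
have mcf := multiplier_conj mf; have mct := multiplier_conj mt.
rewrite -{1}[x](@mul_Kconj R phi)//; last exact: inner_unimodular.
by rewrite lift_mul_inner mul_conjK//; exact: inner_unimodular.
Qed.

(** Conjugating the identity exchanges the roles of [p] and [q]. *)
Lemma lift_K x : L x -> K (lift N q x).
Proof.
move=> /(model_spaceP ip)[hx ax]; apply/(model_spaceP it); split; first exact: lift_hardy.
by rewrite lift_mul_conj; exact: lift_antihardy.
Qed.

Lemma lift_bshift x : hardy x -> bshift N (lift N q x) = lift N q (bshift 1 x).
Proof.
move=> hx; apply: (coef_ext_mod N0) => k j.
rewrite lift_coef// coef_bshift; last exact: lift_hardy.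
rewrite coef_bshift// residue_ge0//; case: ifP => _; last by rewrite mulr0.
by rewrite -lift_coef// mulrDl mul1r addrAC.
Qed.

Lemma lift_linearB x y : lift N q (x - y) = lift N q x - lift N q y.
Proof. by rewrite addrC -scaleN1r lift_linear// scaleN1r addrC. Qed.

Lemma lift_linearZ a x : lift N q (a *: x) = a *: lift N q x.
Proof.
have l0 : lift N q 0 = 0 by have := lift_linearB 0 0; rewrite !subrr.
by rewrite -[a *: x]addr0 lift_linear// l0 addr0.
Qed.

(** The part [phi r] of [z x] which the compression discards is lifted into
    [theta H^2]. *)
Lemma lift_toeplitz x : L x -> T (lift N q x) = lift N q (S x).
Proof.
move=> Lx; have LS : L (S x) by exact: toeplitz_K.
have [r [hr _] rE] := toeplitz_split ip 1 Lx.
apply: projU; [exact: linear_subspace_model_space|exact: lift_K|move=> h Kh].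
rewrite -[mul_L2 _ _]/(Z N%:Z _) -[X in Z X _]mul1r -lift_Z// rE -lift_linearB addrAC subrr add0r.
rewrite lift_mul_inner dotC (model_space_ortho Kh) ?rmorph0//; exact: lift_hardy.
Qed.

Hypothesis nq : poly_norm2 N q = 1.
Local Notation M := (lift N q @` L).

Lemma lift_dot1 x y : '[lift N q x, lift N q y] = '[x, y].
Proof. by rewrite lift_dot// nq mul1r. Qed.

Lemma lift_reducing : reducing K T M.
Proof.
have [cM sM] : closed M /\ linear_subspace M.
  apply: closed_isometry_image.
  - exact: closed_model_space.
  - exact: linear_subspace_model_space.
  - by move=> a x y; exact: lift_linear.
  - by apply: isometry_norm => x; exact: lift_dot1.
split.
- exact/closed_subspaceP.
- by move=> _ [x Lx <-]; exact: lift_K.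
- by move=> _ [x Lx <-]; rewrite lift_toeplitz//; exists (S x) => //; exact: toeplitz_K.
move=> y [Ky oy]; split; first exact: toeplitz_K.
move=> _ [x Lx <-]; rewrite (@toeplitz_adj R theta)//; last exact: lift_K.
rewrite lift_bshift; last exact: model_space_hardy Lx.
by apply: oy; exists (bshift 1 x) => //; exact: bshift_K.
Qed.

(** The lift is unitary and intertwines the two operators, so it carries the
    defects over. The second defect vector is not zero when the first is not:
    if the constants were orthogonal to the model space of [phi], then so would be
    all powers of [z], by the invariance under [bshift]. *)
Lemma lift_defects : bshift 1 (mul_L2 phi (e 0)) != 0 -> has_defects M T 1.
Proof.
move=> b0; have red := lift_reducing; have [/closed_subspaceP[_ sM] _ _ _] := red.
have lift_neq0 x : x != 0 -> lift N q x != 0.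
  by move=> x0; apply: contra_neq x0 => l0; apply: dot_eq0; rewrite -lift_dot1 l0 dot0l.
set v := bshift 1 _ in b0; have Lv : L v by exact: bshift_theta_K.
have [Lw _] := model_projP phi (e 0); set w := P L (e 0) in Lw.
have xw x : L x -> '[x, e 0] = '[x, w].
  move=> Lx; apply/eqP; rewrite -subr_eq0 -dotBr dotC.
  by rewrite (model_projP phi (e 0)).2 ?rmorph0.
have w0 : w != 0.
  apply: contraNneq b0 => w0; apply/eqP/coef_ext => n; rewrite dot0l.
  have Lb (k : nat) : L (iter k (bshift 1) v) by elim: k => [|k IH]; [exact: Lv|rewrite iterS; exact: (bshift_K ip 1 IH)].
  have hv := model_space_hardy Lv.
  case: n => n; last by move/hardyP: hv; apply.
  suff -> : '[v, e n%:Z] = '[iter n (bshift 1) v, e 0] by rewrite xw// w0 dot0r.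
  have -> : '[v, e n%:Z] = '[v, e (0 + n%:Z)] by rewrite add0r.
  have : forall m : nat, '[iter n (bshift 1) v, e m%:Z] = '[v, e (m%:Z + n%:Z)].
    elim: n => [|n IH] m /=; first by rewrite addr0.
    rewrite (coef_bshift 1 m (model_space_hardy (Lb n))).
    by rewrite -PoszD IH; congr ('[_, e _]); rewrite -[n.+1]addn1 !PoszD; ring.
  by move=> ->.
split.
  have Mv : M (lift N q v) by exists v.
  apply: (defect_rank_one sM Mv (lift_neq0 _ b0)) => _ [x Lx <-].
  rewrite (reducing_adjoint it red); last by have [_ _ h _] := red; apply: h; exists x.
  rewrite lift_toeplitz// lift_bshift; last exact/model_space_hardy/toeplitz_K.
  by rewrite -lift_linearB shift_defect// lift_linearZ lift_dot1.
have Mw : M (lift N q w) by exists w.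
apply: (defect_rank_one sM Mw (lift_neq0 _ w0)) => _ [x Lx <-]; have Mx : M (lift N q x) by exists x.
rewrite (reducing_adjoint it red)//.
rewrite (reducing_adjointK it red); last exact: reducing_bshift red _ Mx.
rewrite lift_bshift; last exact: model_space_hardy Lx.
rewrite lift_toeplitz; last exact: bshift_K.
by rewrite -lift_linearB shift_adjoint_defect// lift_linearZ lift_dot1.
Qed.

End Lift.
End Converse.

(** * From orbit products to a reducing subspace *)

Section Sufficiency.
Variable R : realType.
Local Notation C := R[i].
Local Notation H := (L2 R).
Local Notation mu := (circle_measure R).
Local Notation "''[' x , y ]" := (L2_dot x y) : ring_scope.
Local Notation e := (e R).
Implicit Types (x y h : H) (a b c : C) (K M : set H) (f g u v theta : C -> C) (p q : {poly C}).
Variable N : nat.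
Hypothesis N0 : (0 < N)%N.

(** For [x] in the model space, [p x = q conj theta x] has no coefficients of
    negative index on the left, and none of index at least [N - 1] on the right.
    So [x |-> p x] is an injection into polynomials of degree at most [N - 2]. *)
Lemma dim_model_space_lt theta p q : inner_function theta -> p != 0 -> (size q <= N)%N ->
  {ae mu, forall t, theta (cis t) * p.[cis t] = q.[cis t]} ->
  ~ dim_at_least (model_space theta) N.
Proof.
move=> it p0 qN E [b [bK bf]].
have mt := inner_multiplier it; have mp := @multiplier_poly R p.
have coefs x (n : int) : model_space theta x -> n < 0 \/ N.-1%:Z <= n ->
    '[mul_L2 (fun z => p.[z]) x, e n] = 0.
  move=> Kx; have /(model_spaceP it)[hx ax] := Kx => -[n0|Nn].
    by have /hardyP := hardy_poly p hx; apply.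
  have mct := multiplier_conj mt.
  have -> : mul_L2 (fun z => p.[z]) x = mul_L2 (fun z => q.[z]) (mul_L2 (fun z => (theta z)^* ) x).
    rewrite mul_L2M//; last exact: multiplier_poly.
    apply: mul_ext => //; first by apply: multiplierM => //; exact: multiplier_poly.
    apply: filterS2 E (inner_unimodular it) => t <- tt.
    by rewrite mulrAC -normCK tt expr1n mul1r.
  rewrite (coef_mul_poly _ _ qN) big1// => i _; rewrite ax ?mulr0//.
  by rewrite subr_ge0; apply: le_trans Nn; rewrite lez_nat -ltnS prednK.
pose A := \matrix_(i < N, j < N.-1) '[mul_L2 (fun z => p.[z]) (b i), e j%:Z].
have : kermx A != 0.
  rewrite kermx_eq0 /row_free neq_ltn; apply/orP; left.
  by apply: leq_ltn_trans (rank_leq_col A) _; rewrite prednK.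
case/rowV0Pn => v /sub_kermxP vA v0.
pose x := \sum_(i < N) v 0 i *: b i.
have sK := linear_subspace_model_space theta.
have Kx : model_space theta x.
  rewrite /x; elim/big_ind: _ => [|y z|i _]; [exact: sK.1|exact: linear_subspaceD|exact: linear_subspaceZ].
have px0 : mul_L2 (fun z => p.[z]) x = 0.
  apply: coef_inj => n; have [n0|n0] := ltP n 0; first by apply: coefs => //; left.
  have [Nn|nN] := leP N.-1%:Z n; first by apply: coefs => //; right.
  case: n n0 nN => // n _ nN; have := congr1 (fun B : 'rV_(N.-1) => B 0 (Ordinal (nN : (n < N.-1)%N))) vA.
  rewrite !mxE => S; rewrite -[RHS]S mul_adj// dot_suml; apply: eq_bigr => i _.
  by rewrite dotZl -mul_adj// mxE.
have x0 : x = 0.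
  apply/L2_eqP; apply: (ae_mp (repr0 R)); apply: (ae_mp (mul_L2E x mp)).
  rewrite px0; apply: (ae_mp (repr0 R)); apply: filterS (poly_ae_neq0 p0) => t n0 z0 E' z0'.
  by rewrite z0; move/eqP: E'; rewrite z0 eq_sym mulf_eq0 (negbTE n0) => /eqP.
by case/eqP: v0; apply/rowP => i; rewrite mxE; exact: (bf (fun i => v 0 i)).
Qed.

Lemma size_prod_deg1 (J : {set 'I_N}) (F : 'I_N -> {poly C}) :
  (forall i, (size (F i) <= 2)%N) -> (size (\prod_(i in J) F i)%R <= #|J|.+1)%N.
Proof.
move=> hF; apply: leq_trans (size_poly_prod_leq _ _) _; rewrite leq_subLR.
rewrite addnS ltnS -[(_ + _)%N]mul1n mulnDr !mul1n addnn -muln2.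
by apply: leq_trans (leq_sum _ (fun i _ => hF i)) _; rewrite sum_nat_const.
Qed.

(** With [w] running over the points [omega^i a], [psi a J] is the quotient of
    [Prod_J (z - w)] by [Prod_J (1 - conj w z)]. As the product over the whole
    orbit is the Blaschke factor of [a^N] at [z^N], it is also that factor times
    the quotient of [Prod (1 - conj w z)] by [Prod (z - w)] over the complement
    of [J]. Taking the shorter of the two bounds the degrees by the minimum. *)
Lemma psi_prod_quotient (s : seq (C * {set 'I_N})) (m : nat) :
  (forall i, i \in s -> `|i.1| < 1) -> (\sum_(i <- s) minn #|i.2| (N - #|i.2|) <= m)%N ->
  exists p q f, [/\ inner_function f, p != 0 /\ (size p <= m.+1)%N, q != 0 /\ (size q <= m.+1)%N &
    forall t : R, psi_prod s (cis t) * p.[cis t] = q.[cis t] * f (cis t ^+ N)].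
Proof.
elim: s m => [|[a J] s IH] m sa sm.
  exists 1, 1, (fun=> 1); split; rewrite ?oner_neq0 ?size_poly1//.
  - by apply: inner_cst; rewrite normr1.
  - by move=> t; rewrite /psi_prod big_nil !hornerE.
have a1 : `|a| < 1 := sa _ (mem_head _ _).
have {}sa i : i \in s -> `|i.1| < 1 by move=> si; apply: sa; rewrite inE si orbT.
rewrite big_cons /= in sm.
set k := minn _ _ in sm; have km : (k <= m)%N := leq_trans (leq_addr _ _) sm.
have [|p [q [f [ifn [p0 pm] [q0 qm] E]]]] := IH (m - k)%N sa; first by rewrite leq_subRL.
suff [p1 [q1 [g [ign [p10 p1k] [q10 q1k] E1]]]] : exists p1 q1 g, [/\ inner_function g,
    p1 != 0 /\ (size p1 <= k.+1)%N, q1 != 0 /\ (size q1 <= k.+1)%N &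
    forall t : R, psi a J (cis t) * p1.[cis t] = q1.[cis t] * g (cis t ^+ N)].
  have szM (r1 r2 : {poly C}) : (size r1 <= k.+1)%N -> (size r2 <= (m - k).+1)%N -> (size (r1 * r2)%R <= m.+1)%N.
    by move=> h1 h2; apply: leq_trans (size_polyMleq _ _) _; move: h1 h2 km; lia.
  exists (p1 * p), (q1 * q), (fun z => g z * f z); split.
  - exact: inner_mul.
  - by rewrite mulf_neq0//; split => //; exact: szM.
  - by rewrite mulf_neq0//; split => //; exact: szM.
  by move=> t; rewrite /psi_prod big_cons !hornerM mulrACA E1 E mulrACA.
pose w (i : 'I_N) : C := omega R N ^+ i * a.
have wn i : `|w i| < 1 by rewrite normrM omega_norm mul1r.
have X0 (I : {set 'I_N}) : \prod_(i in I) ('X - (w i)%:P) != 0.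
  by apply/prodf_neq0 => i _; rewrite polyXsubC_eq0.
have Y0 (I : {set 'I_N}) : \prod_(i in I) (1 - (w i)^* *: 'X : {poly C}) != 0.
  apply/prodf_neq0 => i _; apply/eqP => /(congr1 (fun r : {poly C} => r.[0])).
  by rewrite !(hornerD, hornerN, hornerZ, hornerX, hornerC) mulr0 subr0 => /eqP; rewrite oner_eq0.
have Xs (I : {set 'I_N}) : (size (\prod_(i in I) ('X - (w i)%:P))%R <= #|I|.+1)%N.
  by apply: size_prod_deg1 => i; rewrite size_XsubC.
have Ys (I : {set 'I_N}) : (size (\prod_(i in I) (1 - (w i)^* *: 'X : {poly C}))%R <= #|I|.+1)%N.
  apply: size_prod_deg1 => i; apply: leq_trans (size_polyD _ _) _.
  rewrite geq_max size_polyN size_poly1 /=; apply: leq_trans (size_scale_leq _ _) _.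
  by rewrite size_polyX.
have XY (I : {set 'I_N}) (t : R) : (\prod_(i in I) ('X - (w i)%:P)).[cis t] =
    psi a I (cis t) * (\prod_(i in I) (1 - (w i)^* *: 'X)).[cis t].
  rewrite !horner_prod -big_split; apply: eq_bigr => i _ /=.
  rewrite hornerXsubC !(hornerD, hornerN, hornerZ, hornerX, hornerC).
  exact: blaschke_mul_denom (wn i) (cis_norm t).
have [JN|JN] := leqP #|J| (N - #|J|).
  have kE : k = #|J| by apply/minn_idPl.
  exists (\prod_(i in J) (1 - (w i)^* *: 'X)), (\prod_(i in J) ('X - (w i)%:P)), (fun=> 1).
  rewrite kE; split => //; first by apply: inner_cst; rewrite normr1.
  by move=> t; rewrite mulr1 XY.
have kE : k = #|(~: J)%SET|.
  have -> : k = (N - #|J|)%N by apply/minn_idPr/ltnW.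
  by rewrite -[X in (X - _)%N](card_ord N) -(cardsC J) addKn.
exists (\prod_(i in (~: J)%SET) ('X - (w i)%:P)), (\prod_(i in (~: J)%SET) (1 - (w i)^* *: 'X)),
  (blaschke_factor (a ^+ N)).
rewrite kE; split; [| |by split; [exact: Y0|exact: Ys]|] => //.
  by apply: inner_blaschke; rewrite normrX exprn_ilt1 ?normr_ge0// -lt0n.
move=> t; rewrite XY mulrA mulrC; congr (_ * _).
rewrite -(prod_blaschke_orbit N0 a (cis_norm t)) [RHS](bigID (mem J))/=; congr (_ * _).
by apply: eq_bigl => i; rewrite finset.in_setC.
Qed.

(** The polynomials are scaled so that [lift] becomes an isometry. *)
Lemma reducing_of_psi_prod theta u (s : seq (C * {set 'I_N})) :
  inner_function theta -> inner_function u -> dim_at_least (model_space theta) N ->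
  (forall i, i \in s -> `|i.1| < 1) -> (\sum_(i <- s) minn #|i.2| (N - #|i.2|) <= N - 1)%N ->
  {ae mu, forall t, theta (cis t) = psi_prod s (cis t) * u (cis t ^+ N)} ->
  exists M, reducing (model_space theta) (truncated_toeplitz theta (fun z => z ^+ N)) M /\
    has_defects M (truncated_toeplitz theta (fun z => z ^+ N)) 1.
Proof.
move=> it iu dK sa sN thE.
have [p [q [f [ifn [p0 pN] [q0 qN] E]]]] := psi_prod_quotient sa sN.
rewrite subn1 prednK// in pN qN.
pose g z := f z * u z; have ig : inner_function g by exact: inner_mul.
pose c := (sqrtC (poly_norm2 N q))^-1.
have nq := poly_norm2_gt0 qN q0.
have c0 : 0 < c by rewrite invr_gt0 sqrtC_gt0.
have cp0 : c *: p != 0 by rewrite scaler_eq0 gt_eqF.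
have cpN : (size (c *: p) <= N)%N := leq_trans (size_scale_leq _ _) pN.
have cqN : (size (c *: q) <= N)%N := leq_trans (size_scale_leq _ _) qN.
have Ec : {ae mu, forall t, theta (cis t) * (c *: p).[cis t] = (c *: q).[cis t] * g (cis t ^+ N)}.
  apply: filterS thE => t ->; rewrite !hornerZ /g.
  transitivity (c * (psi_prod s (cis t) * p.[cis t]) * u (cis t ^+ N)); first by ring.
  by rewrite E; ring.
have n1 : poly_norm2 N (c *: q) = 1.
  rewrite /poly_norm2; under eq_bigr do rewrite coefZ normrM exprMn.
  by rewrite -mulr_sumr gtr0_norm// exprVn sqrtCK mulVf// gt_eqF.
exists (lift N (c *: q) @` model_space g); split.
  exact: (lift_reducing N0 it ig cpN cqN Ec n1).
apply: (lift_defects N0 it ig cpN cqN Ec n1); apply/eqP => /(inner_constant ig)[d d1 gd].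
have [id gn] : inner_function (fun=> d) /\ {ae mu, forall t, g (cis t ^+ N) = d}.
  have id := inner_cst d1; split => //.
  by apply/(ae_power_eq N0 _ (multiplier_square_integrable (inner_multiplier id))) => //; case: ig.
apply: (@dim_model_space_lt theta (c *: p) (d *: (c *: q)) it cp0 _ _ dK).
  exact: leq_trans (size_scale_leq _ _) cqN.
by apply: filterS2 Ec gn => t -> ->; rewrite [RHS]hornerZ mulrC.
Qed.
End Sufficiency.

End OrbitProducts.

Theorem theorem6p4 (R : realType) (N : nat) (theta : R[i] -> R[i])
    (N_ge1 : (1 <= N)%N)
    (theta_inner : inner_function theta)
    (dim_K : dim_at_least (model_space theta) N) :
  (exists M : set (L2 R),
     reducing (model_space theta) (truncated_toeplitz theta (fun z => z ^+ N)) M /\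
     has_defects M (truncated_toeplitz theta (fun z => z ^+ N)) 1)
  <->
  (exists u b : R[i] -> R[i],
     [/\ inner_function u,
         b = (fun=> 1) \/
         (exists (l : nat) (alpha : 'I_l -> R[i]) (J : 'I_l -> {set 'I_N}),
            [/\ (l <= N - 1)%N,
                (forall i, `|alpha i| < 1),
                b = (fun z => \prod_(i < l) psi (alpha i) (J i) z)
              & (\sum_(i < l) minn #|J i| (N - #|J i|) <= N - 1)%N])
       & {ae circle_measure R, forall t, theta (cis t) = b (cis t) * u (cis t ^+ N)}]).
Proof.
split=> [[M [redM defM]]|[u [b [iu bE thE]]]].
  have [p [q [u [iu [pN p0] [qN q0] E]]]] := reducing_factor N_ge1 theta_inner redM defM.
  rewrite -(prednK N_ge1) in pN qN.
  have predN : (N.-1 < N)%N by rewrite prednK.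
  have [s [u' [iu' sN sa sm thE]]] := psi_factorization N_ge1 theta_inner iu predN p0 q0 pN qN E.
  exists u', (psi_prod s); split=> //; right.
  pose d : R[i] * {set 'I_N} := (0, finset.set0).
  exists (size s), (fun i => (nth d s i).1), (fun i => (nth d s i).2); rewrite subn1; split=> //.
  - by move=> i; apply: sa; exact: mem_nth.
  - by apply/funext => z; rewrite /psi_prod (big_nth d) big_mkord.
  - by move: sm; rewrite (big_nth d) big_mkord.
have [s [sa sN {}thE]] : exists s : seq (R[i] * {set 'I_N}), [/\ forall i, i \in s -> `|i.1| < 1,
    (\sum_(i <- s) minn #|i.2| (N - #|i.2|) <= N - 1)%N &
    {ae circle_measure R, forall t, theta (cis t) = psi_prod s (cis t) * u (cis t ^+ N)}].
  case: bE => [bE|[l [alpha [J [lN alpha1 bE JN]]]]].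
    exists [::]; split=> //; first by rewrite big_nil.
    by apply: filterS thE => t ->; rewrite bE /psi_prod big_nil.
  exists [seq (alpha i, J i) | i <- enum 'I_l]; split.
  - by move=> i /mapP[k _ ->]; exact: alpha1.
  - by rewrite big_map big_enum.
  - by apply: filterS thE => t ->; rewrite bE /psi_prod big_map big_enum.
exact: (reducing_of_psi_prod N_ge1 theta_inner iu dim_K sa sN thE).
Qed.
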